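(* Let $n\ge3$, let $k_{ab}$ be a positive-definite symmetric real $N\times N$ matrix, and let $a^a_{bc}$ be real constants ($a,b,c=1,\dots,N$). Consider, for the free theory of $N$ massless spin-2 fields in $n$-dimensional Minkowski spacetime with internal metric $k_{ab}$, the deformation of the gauge algebra determined by $$a_2=C^{*\beta}_a\,C^{\alpha b}\,\partial_\beta C^c_\alpha\, a^a_{bc}.$$ Then this deformation is first-order consistent, in the sense that there exist local Lorentz-invariant $a_1$ and $a_0$, of antifield numbers $1$ and $0$ and total ghost number $0$, with $a_0$ containing at most two derivatives, such that $$\delta a_2+\gamma a_1=\partial_\mu b_1^\mu,\qquad \delta a_1+\gamma a_0=\partial_\mu b_0^\mu$$ for some local $b_1^\mu,b_0^\mu$, if and only if the algebra $\mathcal A$ on $\mathbb R^N$ with product $(x\cdot y)^a=a^a_{bc}x^by^c$ is commutative and symmetric, i.e. $a^a_{bc}=a^a_{cb}$ and $a_{abc}:=k_{ad}a^d_{bc}$ satisfies $a_{abc}=a_{(abc)}$ (total symmetry).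
   Context: Signature $(-,+,\dots,+)$; indices raised and lowered with $\eta_{\mu\nu}$. The variables are: symmetric fields $h^a_{\mu\nu}$ (commuting, ghost number $0$, antifield number $0$); ghosts $C^a_\mu$ (anticommuting, ghost number $1$, antifield number $0$); antifields $h^{*\mu\nu}_a=h^{*\nu\mu}_a$ (anticommuting, ghost number $-1$, antifield number $1$); antifields $C^{*\mu}_a$ (commuting, ghost number $-2$, antifield number $2$). ''Local'' means polynomial in these variables and finitely many of their derivatives, with no explicit dependence on $x^\mu$. Free action: $$S_0=\int d^nx\,k_{ab}\Big[-\tfrac12(\partial_\mu h^a_{\nu\rho})(\partial^\mu h^{b\nu\rho})+(\partial_\mu h^{a\mu}{}_\nu)(\partial_\rho h^{b\rho\nu})-(\partial_\nu h^{a\mu}{}_\mu)(\partial_\rho h^{b\rho\nu})+\tfrac12(\partial_\mu h^{a\nu}{}_\nu)(\partial^\mu h^{b\rho}{}_\rho)\Big].$$ $\gamma$ and $\delta$ are graded (odd) derivations commuting with $\partial_\mu$, vanishing on all the variables except $$\gamma h^a_{\alpha\beta}=\partial_\alpha C^a_\beta+\partial_\beta C^a_\alpha,\qquad \delta h^{*\alpha\beta}_a=\frac{\delta S_0}{\delta h^a_{\alpha\beta}},\qquad \delta C^{*\alpha}_a=-2\partial_\beta h^{*\beta\alpha}_a .$$ *)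

(* Defs.v *)
From HB Require Import structures.
From mathcomp Require Import all_boot all_order all_algebra.
From mathcomp Require Import boolp reals.

Set Implicit Arguments.
Unset Strict Implicit.
Unset Printing Implicit Defensive.

Import Order.TTheory GRing.Theory Num.Theory.
Local Open Scope ring_scope.
Local Open Scope quotient_scope.

(* Index positions: h^a_{mu nu}, C^a_mu, h^*_a^{mu nu}, C^*_a^mu. *)
Inductive field (n N : nat) :=
| Fh of 'I_N & 'I_n & 'I_n
| FC of 'I_N & 'I_n
| Fhs of 'I_N & 'I_n & 'I_n
| FCs of 'I_N & 'I_n.
Arguments Fh {n N}.
Arguments FC {n N}.
Arguments Fhs {n N}.
Arguments FCs {n N}.

(* (phi, kap) stands for the derivative of phi taken kap mu times along each
   direction mu. *)
Definition jet (n N : nat) := (field n N * {ffun 'I_n -> nat})%type.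

Definition odd_field n N (f : field n N) : bool :=
  match f with Fh _ _ _ => false | FC _ _ => true
             | Fhs _ _ _ => true | FCs _ _ => false end.

Definition ghost n N (v : jet n N) : int :=
  match v.1 with Fh _ _ _ => 0 | FC _ _ => 1
               | Fhs _ _ _ => - 1 | FCs _ _ => - 2%:Z end.

Definition antifield n N (v : jet n N) : nat :=
  match v.1 with Fh _ _ _ => 0 | FC _ _ => 0
               | Fhs _ _ _ => 1 | FCs _ _ => 2 end.

Definition nderiv n N (v : jet n N) : nat := (\sum_mu v.2 mu)%N.

(* Local functions are polynomial expressions in the jet variables, modulo
   the laws of an associative unital R-algebra, graded commutativity, and the
   symmetry of h and h^*. *)
Inductive expr (R : Type) (n N : nat) :=
| Cst of R
| Var of jet n N
| Add of expr R n N & expr R n N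
| Mul of expr R n N & expr R n N.
Arguments Cst {R n N}.
Arguments Var {R n N}.

Inductive eqv (R : realType) (n N : nat) : expr R n N -> expr R n N -> Prop :=
| eqv_refl x : eqv x x
| eqv_sym x y : eqv x y -> eqv y x
| eqv_trans y x z : eqv x y -> eqv y z -> eqv x z
| eqv_add x x' y y' : eqv x x' -> eqv y y' -> eqv (Add x y) (Add x' y')
| eqv_mul x x' y y' : eqv x x' -> eqv y y' -> eqv (Mul x y) (Mul x' y')
| eqv_addA x y z : eqv (Add x (Add y z)) (Add (Add x y) z)
| eqv_addC x y : eqv (Add x y) (Add y x)
| eqv_add0 x : eqv (Add (Cst 0) x) x
| eqv_mulA x y z : eqv (Mul x (Mul y z)) (Mul (Mul x y) z)
| eqv_mul1 x : eqv (Mul (Cst 1) x) x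
| eqv_mul0 x : eqv (Mul (Cst 0) x) (Cst 0)
| eqv_mulDl x y z : eqv (Mul (Add x y) z) (Add (Mul x z) (Mul y z))
| eqv_mulDr x y z : eqv (Mul x (Add y z)) (Add (Mul x y) (Mul x z))
| eqv_cstD c d : eqv (Cst (c + d)) (Add (Cst c) (Cst d))
| eqv_cstM c d : eqv (Cst (c * d)) (Mul (Cst c) (Cst d))
| eqv_cstC c x : eqv (Mul (Cst c) x) (Mul x (Cst c))
| eqv_comm v w : eqv (Mul (Var v) (Var w))
    (Mul (Cst ((-1) ^+ (odd_field v.1 && odd_field w.1))) (Mul (Var w) (Var v)))
| eqv_h a mu nu kap : eqv (Var (Fh a mu nu, kap)) (Var (Fh a nu mu, kap))
| eqv_hs a mu nu kap : eqv (Var (Fhs a mu nu, kap)) (Var (Fhs a nu mu, kap)).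

HB.instance Definition _ (R : realType) n N := gen_eqMixin (expr R n N).
HB.instance Definition _ (R : realType) n N := gen_choiceMixin (expr R n N).

Section LocalFunctions.
Variables (R : realType) (n N : nat).
Local Notation E := (expr R n N).

Definition eqvb (x y : E) : bool := `[< eqv x y >].

Lemma eqvb_refl : reflexive eqvb.
Proof. by move=> x; apply/asboolP; apply: eqv_refl. Qed.
Lemma eqvb_sym : symmetric eqvb.
Proof. by move=> x y; apply/asboolP/asboolP; apply: eqv_sym. Qed.
Lemma eqvb_trans : transitive eqvb.
Proof.
by move=> y x z /asboolP xy /asboolP yz; apply/asboolP; apply: eqv_trans xy yz.
Qed.

Canonical eqv_rel := EquivRel eqvb eqvb_refl eqvb_sym eqvb_trans.

Definition locfun := {eq_quot eqv_rel}.
HB.instance Definition _ := Choice.on locfun.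
HB.instance Definition _ := EqQuotient.on locfun.

Lemma locP (x y : E) : reflect (eqv x y) (\pi_locfun x == \pi_locfun y).
Proof. by rewrite eqmodE; apply: asboolP. Qed.

Lemma piP (x y : E) : eqv x y -> \pi_locfun x = \pi_locfun y.
Proof. by move=> h; apply/eqP/locP. Qed.

Lemma repr_eqv (x : E) : eqv (repr (\pi_locfun x)) x.
Proof. by apply/locP; rewrite reprK. Qed.

Definition lzero : locfun := \pi_locfun (Cst 0).
Definition lone : locfun := \pi_locfun (Cst 1).
Definition ladd (x y : locfun) : locfun := \pi_locfun (Add (repr x) (repr y)).
Definition lmul (x y : locfun) : locfun := \pi_locfun (Mul (repr x) (repr y)).
Definition lscale (c : R) (x : locfun) : locfun := \pi_locfun (Mul (Cst c) (repr x)).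
Definition lopp (x : locfun) : locfun := lscale (-1) x.

Lemma pi_add x y : \pi_locfun (Add x y) = ladd (\pi_locfun x) (\pi_locfun y).
Proof. by apply: piP; apply: eqv_add; apply/eqv_sym/repr_eqv. Qed.
Lemma pi_mul x y : \pi_locfun (Mul x y) = lmul (\pi_locfun x) (\pi_locfun y).
Proof. by apply: piP; apply: eqv_mul; apply/eqv_sym/repr_eqv. Qed.
Lemma pi_scale c x : \pi_locfun (Mul (Cst c) x) = lscale c (\pi_locfun x).
Proof.
by apply: piP; apply: eqv_mul; [apply: eqv_refl | apply/eqv_sym/repr_eqv].
Qed.

Lemma loc_ind (P : locfun -> Prop) : (forall e, P (\pi_locfun e)) -> forall x, P x.
Proof. by move=> h x; rewrite -[x]reprK. Qed.

Lemma laddA : associative ladd.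
Proof.
elim/loc_ind=> x; elim/loc_ind=> y; elim/loc_ind=> z.
by rewrite -!pi_add; apply/piP/eqv_addA.
Qed.
Lemma laddC : commutative ladd.
Proof.
elim/loc_ind=> x; elim/loc_ind=> y; by rewrite -!pi_add; apply/piP/eqv_addC.
Qed.
Lemma ladd0 : left_id lzero ladd.
Proof. elim/loc_ind=> x; by rewrite -!pi_add; apply/piP/eqv_add0. Qed.
Lemma lscaleDl x (c d : R) : lscale (c + d) x = ladd (lscale c x) (lscale d x).
Proof.
elim/loc_ind: x => x; rewrite -!pi_scale -pi_add; apply: piP.
apply: eqv_trans (eqv_mulDl _ _ _).
by apply: eqv_mul; [apply: eqv_cstD | apply: eqv_refl].
Qed.
Lemma lscale0 x : lscale 0 x = lzero.
Proof. by elim/loc_ind: x => x; rewrite -pi_scale; apply/piP/eqv_mul0. Qed.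
Lemma lscale1 : left_id 1 lscale.
Proof. by elim/loc_ind=> x; rewrite -pi_scale; apply/piP/eqv_mul1. Qed.
Lemma laddN : left_inverse lzero lopp ladd.
Proof. by move=> x; rewrite -{2}[x]lscale1 -lscaleDl addNr lscale0. Qed.

HB.instance Definition _ := GRing.isZmodule.Build locfun laddA laddC ladd0 laddN.

Lemma lmulA : associative lmul.
Proof.
elim/loc_ind=> x; elim/loc_ind=> y; elim/loc_ind=> z.
by rewrite -!pi_mul; apply/piP/eqv_mulA.
Qed.
Lemma lmul1 : left_id lone lmul.
Proof. by elim/loc_ind=> x; rewrite -pi_mul; apply/piP/eqv_mul1. Qed.
Lemma lmulr1 : right_id lone lmul.
Proof.
elim/loc_ind=> x; rewrite -pi_mul; apply/piP.
by apply: eqv_trans (eqv_mul1 _); apply/eqv_sym/eqv_cstC.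
Qed.
Lemma lmulDl : left_distributive lmul ladd.
Proof.
elim/loc_ind=> x; elim/loc_ind=> y; elim/loc_ind=> z.
by rewrite -!(pi_mul, pi_add); apply/piP/eqv_mulDl.
Qed.
Lemma lmulDr : right_distributive lmul ladd.
Proof.
elim/loc_ind=> x; elim/loc_ind=> y; elim/loc_ind=> z.
by rewrite -!(pi_mul, pi_add); apply/piP/eqv_mulDr.
Qed.

Fixpoint cst_part (x : E) : R :=
  match x with
  | Cst c => c | Var _ => 0
  | Add x y => cst_part x + cst_part y | Mul x y => cst_part x * cst_part y
  end.

Lemma cst_part_eqv x y : eqv x y -> cst_part x = cst_part y.
Proof.
elim=> //=.
- by move=> y0 x0 z0 _ -> _ ->.
- by move=> x0 x' y0 y' _ -> _ ->.
- by move=> x0 x' y0 y' _ -> _ ->.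
- by move=> *; rewrite addrA.
- by move=> *; rewrite addrC.
- by move=> *; rewrite add0r.
- by move=> *; rewrite mulrA.
- by move=> *; rewrite mul1r.
- by move=> *; rewrite mul0r.
- by move=> *; rewrite mulrDl.
- by move=> *; rewrite mulrDr.
- by move=> *; rewrite mulrC.
- by move=> *; rewrite !mulr0.
Qed.

Lemma lone_neq0 : lone != lzero.
Proof. by apply/negP => /locP /cst_part_eqv /= /eqP; rewrite oner_eq0. Qed.

HB.instance Definition _ := GRing.Zmodule_isNzRing.Build locfun
  lmulA lmul1 lmulr1 lmulDl lmulDr lone_neq0.

Lemma lscaleA (c d : R) (x : locfun) : lscale c (lscale d x) = lscale (c * d) x.
Proof.
elim/loc_ind: x => x; rewrite -!pi_scale; apply/piP.
apply: eqv_trans (eqv_mulA _ _ _) _.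
by apply: eqv_mul; [apply/eqv_sym/eqv_cstM | apply: eqv_refl].
Qed.
Lemma lscaleDr : right_distributive lscale +%R.
Proof.
move=> c; elim/loc_ind=> x; elim/loc_ind=> y.
rewrite -[X in lscale _ X]/(ladd _ _) -[RHS]/(ladd _ _) -!(pi_add, pi_scale).
by apply/piP/eqv_mulDr.
Qed.
HB.instance Definition _ := GRing.Zmodule_isLmodule.Build R locfun
  lscaleA lscale1 lscaleDr lscaleDl.

Lemma lscaleAl (c : R) (x y : locfun) : c *: (x * y) = (c *: x) * y.
Proof.
elim/loc_ind: x => x; elim/loc_ind: y => y.
by rewrite -[LHS]/(lscale c (lmul _ _)) -[RHS]/(lmul (lscale c _) _)
  -!(pi_scale, pi_mul); apply/piP/eqv_mulA.
Qed.
HB.instance Definition _ := GRing.Lmodule_isLalgebra.Build R locfun lscaleAl.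

Lemma lscaleAr (c : R) (x y : locfun) : c *: (x * y) = x * (c *: y).
Proof.
elim/loc_ind: x => x; elim/loc_ind: y => y.
rewrite -[LHS]/(lscale c (lmul _ _)) -[RHS]/(lmul _ (lscale c _))
  -!(pi_scale, pi_mul); apply/piP.
apply: eqv_trans (eqv_mulA _ _ _) _.
apply: eqv_trans (eqv_sym (eqv_mulA _ _ _)).
by apply: eqv_mul; [apply: eqv_cstC | apply: eqv_refl].
Qed.
HB.instance Definition _ := GRing.Lalgebra_isAlgebra.Build R locfun lscaleAr.

Lemma piD x y : \pi_locfun (Add x y) = \pi_locfun x + \pi_locfun y.
Proof. exact: pi_add. Qed.
Lemma piM x y : \pi_locfun (Mul x y) = \pi_locfun x * \pi_locfun y.
Proof. exact: pi_mul. Qed.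
Lemma piC c : \pi_locfun (Cst c) = c%:A.
Proof.
rewrite -[RHS]/(lscale c lone) -pi_scale; apply: piP.
by rewrite -{1}[c]mulr1; apply: eqv_cstM.
Qed.

Definition var (v : jet n N) : locfun := \pi_locfun (Var v).

Definition sgn (b : bool) : R := (-1) ^+ b.

Lemma var_comm v w : var v * var w =
  sgn (odd_field v.1 && odd_field w.1) *: (var w * var v).
Proof.
by rewrite -mulr_algl -piC /var -!piM; apply/piP/eqv_comm.
Qed.

Definition symmetric_jets (f : jet n N -> locfun) : Prop :=
  forall a mu nu kap,
    f (Fh a mu nu, kap) = f (Fh a nu mu, kap) /\
    f (Fhs a mu nu, kap) = f (Fhs a nu mu, kap).

Lemma var_sym : symmetric_jets var.
Proof. by move=> a mu nu kap; split; apply: piP; constructor. Qed.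

(* subst f is the algebra morphism sending each jet variable v to f v. *)
Fixpoint substE (f : jet n N -> locfun) (e : E) : locfun :=
  match e with
  | Cst c => c%:A
  | Var v => f v
  | Add x y => substE f x + substE f y
  | Mul x y => substE f x * substE f y
  end.

Definition subst f (x : locfun) : locfun := substE f (repr x).

Section Subst.
Variable f : jet n N -> locfun.
Hypothesis fcomm : forall v w,
  f v * f w = sgn (odd_field v.1 && odd_field w.1) *: (f w * f v).
Hypothesis fsym : symmetric_jets f.

Lemma substE_eqv x y : eqv x y -> substE f x = substE f y.
Proof.
elim=> //=.
- by move=> ? ? ? _ -> _ ->.
- by move=> ? ? ? ? _ -> _ ->.
- by move=> ? ? ? ? _ -> _ ->.
- by move=> *; rewrite addrA.
- by move=> *; rewrite addrC.
- by move=> *; rewrite scale0r add0r.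
- by move=> *; rewrite mulrA.
- by move=> *; rewrite scale1r mul1r.
- by move=> *; rewrite scale0r mul0r.
- by move=> *; rewrite mulrDl.
- by move=> *; rewrite mulrDr.
- by move=> *; rewrite scalerDl.
- by move=> c d; rewrite mulr_algl scalerA.
- by move=> *; rewrite mulr_algl mulr_algr.
- by move=> v w; rewrite fcomm mulr_algl.
- by move=> a mu nu kap; case: (fsym a mu nu kap).
- by move=> a mu nu kap; case: (fsym a mu nu kap).
Qed.

Lemma subst_pi e : subst f (\pi_locfun e) = substE f e.
Proof. exact/substE_eqv/repr_eqv. Qed.
Lemma subst_var v : subst f (var v) = f v.
Proof. exact: subst_pi. Qed.
Lemma subst_add x y : subst f (x + y) = subst f x + subst f y.
Proof. by elim/loc_ind: x => x; elim/loc_ind: y => y; rewrite -piD !subst_pi. Qed.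
Lemma subst_mul x y : subst f (x * y) = subst f x * subst f y.
Proof. by elim/loc_ind: x => x; elim/loc_ind: y => y; rewrite -piM !subst_pi. Qed.
Lemma subst_cst c : subst f c%:A = c%:A.
Proof. by rewrite -[in LHS]piC subst_pi. Qed.
Lemma subst_scale c x : subst f (c *: x) = c *: subst f x.
Proof. by rewrite -mulr_algl subst_mul subst_cst mulr_algl. Qed.
End Subst.

Definition parity : locfun -> locfun :=
  subst (fun v => sgn (odd_field v.1) *: var v).

Definition has_parity (p : bool) (x : locfun) : Prop := parity x = sgn p *: x.

Lemma sgnM b c : sgn b * sgn c = sgn (b (+) c).
Proof. by rewrite /sgn; case: b; case: c; rewrite /= ?expr0 ?expr1 ?mulr1 ?mul1r ?mulrNN ?mulr1. Qed.

Lemma parity_comm v w : (sgn (odd_field v.1) *: var v) * (sgn (odd_field w.1) *: var w)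
  = sgn (odd_field v.1 && odd_field w.1) *:
    ((sgn (odd_field w.1) *: var w) * (sgn (odd_field v.1) *: var v)).
Proof.
rewrite -!scalerAl -!scalerAr var_comm !scalerA.
by congr (_ *: _); rewrite !sgnM; case: odd_field; case: odd_field.
Qed.
Lemma parity_sym : symmetric_jets (fun v => sgn (odd_field v.1) *: var v).
Proof. by move=> a mu nu kap /=; case: (var_sym a mu nu kap) => -> ->. Qed.

Lemma parity_var v : parity (var v) = sgn (odd_field v.1) *: var v.
Proof. exact: (subst_var parity_comm parity_sym). Qed.
Lemma parity_add x y : parity (x + y) = parity x + parity y.
Proof. exact: (subst_add parity_comm parity_sym). Qed.
Lemma parity_mul x y : parity (x * y) = parity x * parity y.
Proof. exact: (subst_mul parity_comm parity_sym). Qed.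
Lemma parity_cst c : parity c%:A = c%:A.
Proof. exact: (subst_cst parity_comm parity_sym). Qed.
Lemma parity_scale c x : parity (c *: x) = c *: parity x.
Proof. exact: (subst_scale parity_comm parity_sym). Qed.

Lemma loc_elim (P : locfun -> Prop) :
  (forall c, P c%:A) -> (forall v, P (var v)) ->
  (forall x y, P x -> P y -> P (x + y)) -> (forall x y, P x -> P y -> P (x * y)) ->
  forall x, P x.
Proof.
move=> hc hv hD hM; elim/loc_ind; elim=> [c|v|x Px y Py|x Px y Py].
- by rewrite piC.
- exact: hv.
- by rewrite piD; apply: hD.
- by rewrite piM; apply: hM.
Qed.

Lemma parityK : involutive parity.
Proof.
move=> x; pattern x; move: x; apply: loc_elim => [c|v|x y hx hy|x y hx hy].
- by rewrite !parity_cst.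
- by rewrite parity_var parity_scale parity_var scalerA sgnM addbb scale1r.
- by rewrite !parity_add hx hy.
- by rewrite !parity_mul hx hy.
Qed.

Lemma var_parity v : has_parity (odd_field v.1) (var v).
Proof. exact: parity_var. Qed.

Lemma mul_var v x : var v * x = iter (odd_field v.1) parity x * var v.
Proof.
pattern x; move: x; apply: loc_elim => [c|w|x y hx hy|x y hx hy].
- by rewrite mulr_algr; case: odd_field; rewrite /= ?[parity _]parity_cst mulr_algl.
- rewrite var_comm; case: odd_field => /=; last by rewrite scale1r.
  by rewrite [parity _]parity_var -scalerAl.
- rewrite mulrDr hx hy -mulrDl; case: odd_field => //=.
  by rewrite [parity (_ + _)]parity_add.
- rewrite mulrA hx -mulrA hy mulrA; case: odd_field => //=.
  by rewrite [parity (_ * _)]parity_mul.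
Qed.

Lemma mul_var_parity v q y : has_parity q y ->
  var v * y = sgn (odd_field v.1 && q) *: (y * var v).
Proof.
by move=> hy; rewrite mul_var; case: odd_field => /=;
  rewrite ?hy ?scalerAl // scale1r.
Qed.

Lemma mul_comm p q x y : has_parity p x -> has_parity q y ->
  x * y = sgn (p && q) *: (y * x).
Proof.
move=> hx hy; suff -> : x * y = y * iter q parity x.
  by case: q hy => hy /=; rewrite ?andbT ?andbF ?scale1r // hx scalerAr.
clear hx; pattern x; move: x; apply: loc_elim => [c|w|x z hx hz|x z hx hz].
- by rewrite mulr_algl; case: q hy => hy /=; rewrite ?[parity _]parity_cst mulr_algr.
- rewrite (mul_var_parity _ hy); case: q hy => hy /=.
    by rewrite andbT var_parity scalerAr.
  by rewrite andbF scale1r.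
- rewrite mulrDl hx hz -mulrDr; case: q hy {hx hz} => //= _.
  by rewrite [parity (_ + _)]parity_add.
- rewrite -mulrA hz mulrA hx -mulrA; case: q hy {hx hz} => //= _.
  by rewrite [parity (_ * _)]parity_mul.
Qed.

(* The derivation of parity s (acting from the left) sending each jet
   variable v to f v, which must have parity odd_field v.1 (+) s. *)
Fixpoint derE (s : bool) (f : jet n N -> locfun) (e : E) : locfun :=
  match e with
  | Cst _ => 0
  | Var v => f v
  | Add x y => derE s f x + derE s f y
  | Mul x y => derE s f x * \pi_locfun y
               + iter s parity (\pi_locfun x) * derE s f y
  end.

Definition der s f (x : locfun) : locfun := derE s f (repr x).

Section Der.
Variables (s : bool) (f : jet n N -> locfun).
Hypothesis fpar : forall v, has_parity (odd_field v.1 (+) s) (f v).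
Hypothesis fsym : symmetric_jets f.

Lemma iterpD x y : iter s parity (x + y) = iter s parity x + iter s parity y.
Proof. by case: (s) => //=; apply: parity_add. Qed.
Lemma iterpM x y : iter s parity (x * y) = iter s parity x * iter s parity y.
Proof. by case: (s) => //=; apply: parity_mul. Qed.
Lemma iterpC c : iter s parity c%:A = c%:A.
Proof. by case: (s) => //=; apply: parity_cst. Qed.

Lemma derE_eqv x y : eqv x y -> derE s f x = derE s f y.
Proof.
elim=> //=.
- by move=> ? ? ? _ -> _ ->.
- by move=> ? ? ? ? _ -> _ ->.
- by move=> x0 x' y0 y' /piP-> -> /piP-> ->.
- by move=> *; rewrite addrA.
- by move=> *; rewrite addrC.
- by move=> *; rewrite add0r.
- by move=> *; rewrite !piM iterpM !mulrDl !mulrDr !mulrA !addrA.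
- by move=> *; rewrite mul0r add0r piC iterpC mulr_algl scale1r.
- by move=> *; rewrite mul0r add0r piC iterpC mulr_algl scale0r.
- by move=> *; rewrite !piD iterpD !mulrDl addrACA.
- by move=> *; rewrite !piD !mulrDr addrACA.
- by move=> *; rewrite addr0.
- by move=> *; rewrite mul0r mulr0 addr0.
- by move=> c x0; rewrite mul0r mulr0 add0r addr0 !piC iterpC mulr_algl mulr_algr.
- move=> v w; rewrite mul0r add0r piC iterpC mulr_algl -!/(var _).
  have iv u : iter s parity (var u) = sgn (s && odd_field u.1) *: var u.
    by case: (s) => /=; rewrite ?scale1r // var_parity.
  rewrite !iv -!scalerAl !(mul_var_parity _ (fpar _)) scalerDr !scalerA addrC.
  congr (_ + _); first by congr (_ *: _);
    rewrite ?sgnM; case: odd_field; case: odd_field; case: (s).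
  rewrite !sgnM [X in sgn X *: _](_ : _ = false) ?scale1r //.
  by case: odd_field; case: odd_field; case: (s).
- by move=> a mu nu kap; case: (fsym a mu nu kap).
- by move=> a mu nu kap; case: (fsym a mu nu kap).
Qed.

Lemma der_pi e : der s f (\pi_locfun e) = derE s f e.
Proof. exact/derE_eqv/repr_eqv. Qed.
Lemma der_var v : der s f (var v) = f v.
Proof. exact: der_pi. Qed.
Lemma der_cst c : der s f c%:A = 0.
Proof. by rewrite -piC der_pi. Qed.
Lemma der_add x y : der s f (x + y) = der s f x + der s f y.
Proof. by elim/loc_ind: x => x; elim/loc_ind: y => y; rewrite -piD !der_pi. Qed.
Lemma der_mul x y : der s f (x * y) = der s f x * y + iter s parity x * der s f y.
Proof. by elim/loc_ind: x => x; elim/loc_ind: y => y; rewrite -piM !der_pi. Qed.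
Lemma der_scale c x : der s f (c *: x) = c *: der s f x.
Proof. by rewrite -mulr_algl der_mul der_cst iterpC mul0r add0r mulr_algl. Qed.

Lemma parity_iter x : parity (iter s parity x) = iter s parity (parity x).
Proof. by case: (s). Qed.

Lemma parity_der x : parity (der s f x) = sgn s *: der s f (parity x).
Proof.
pattern x; move: x; apply: loc_elim => [c|v|x y hx hy|x y hx hy].
- by rewrite parity_cst der_cst scaler0 -(scale0r 1) parity_cst.
- by rewrite var_parity der_var fpar der_scale der_var scalerA sgnM addbC.
- by rewrite der_add !parity_add der_add scalerDr hx hy.
- rewrite der_mul parity_add !parity_mul der_mul.
  by rewrite hx hy scalerDr scalerAl scalerAr parity_iter.
Qed.

Lemma der_parity p x : has_parity p x -> has_parity (p (+) s) (der s f x).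
Proof.
by move=> hx; rewrite /has_parity parity_der hx der_scale scalerA sgnM addbC.
Qed.
End Der.

Definition jet_incr (mu : 'I_n) (kap : {ffun 'I_n -> nat}) : {ffun 'I_n -> nat} :=
  [ffun nu => (kap nu + (nu == mu))%N].

(* Total derivative along x^mu *)
Definition pder (mu : 'I_n) : locfun -> locfun :=
  der false (fun v => var (v.1, jet_incr mu v.2)).

Lemma pder_fpar mu v :
  has_parity (odd_field v.1 (+) false) (var (v.1, jet_incr mu v.2)).
Proof. by rewrite addbF; apply: var_parity. Qed.
Lemma pder_fsym mu : symmetric_jets (fun v => var (v.1, jet_incr mu v.2)).
Proof. by move=> a rho sig kap; apply: var_sym. Qed.

Lemma pder_var mu v : pder mu (var v) = var (v.1, jet_incr mu v.2).
Proof. exact: (der_var (pder_fpar mu) (pder_fsym mu)). Qed.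
Lemma pder_cst mu c : pder mu c%:A = 0.
Proof. exact: (der_cst (pder_fpar mu) (pder_fsym mu)). Qed.
Lemma pder_add mu x y : pder mu (x + y) = pder mu x + pder mu y.
Proof. exact: (der_add (pder_fpar mu) (pder_fsym mu)). Qed.
Lemma pder_mul mu x y : pder mu (x * y) = pder mu x * y + x * pder mu y.
Proof. exact: (der_mul (pder_fpar mu) (pder_fsym mu)). Qed.
Lemma pder_scale mu c x : pder mu (c *: x) = c *: pder mu x.
Proof. exact: (der_scale (pder_fpar mu) (pder_fsym mu)). Qed.
Lemma pder0 mu : pder mu 0 = 0.
Proof. by have := pder_scale mu 0 0; rewrite !scale0r. Qed.
Lemma pder_parity mu p x : has_parity p x -> has_parity p (pder mu x).
Proof. by move=> /(der_parity (pder_fpar mu) (pder_fsym mu)); rewrite addbF. Qed.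

Lemma pderC mu nu x : pder mu (pder nu x) = pder nu (pder mu x).
Proof.
pattern x; move: x; apply: loc_elim => [c|v|x y hx hy|x y hx hy].
- by rewrite !pder_cst !pder0.
- rewrite !pder_var /=; congr (var (_, _)).
  by apply/ffunP=> rho; rewrite !ffunE addnAC.
- by rewrite !pder_add hx hy.
- rewrite !(pder_mul, pder_add) hx hy.
  by rewrite addrACA [X in _ + X]addrC -!addrA; congr (_ + _); rewrite addrCA.
Qed.

(* Product of the commuting operators D mu ^ kap mu over all mu *)
Definition iterD (D : 'I_n -> locfun -> locfun) (kap : {ffun 'I_n -> nat})
    (x : locfun) : locfun :=
  foldr (fun mu y => iter (kap mu) (D mu) y) x (enum 'I_n).

Lemma iterD_incr D kap mu x : (forall rho sig y, D rho (D sig y) = D sig (D rho y)) ->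
  iterD D (jet_incr mu kap) x = D mu (iterD D kap x).
Proof.
move=> DC; rewrite /iterD.
have DI rho sig m y : iter m (D rho) (D sig y) = D sig (iter m (D rho) y).
  by elim: m => //= m ->.
have : mu \in enum 'I_n by rewrite mem_enum.
have := enum_uniq 'I_n; elim: (enum _) => //= nu s IH /andP[nus us].
rewrite inE ffunE => /orP[/eqP munu | mus]; first subst nu.
  rewrite eqxx addn1 /=; congr (D mu (iter _ _ _)).
  elim: s nus {IH us} => //= rho s IH; rewrite inE negb_or => /andP[nr ns].
  by rewrite IH // ffunE eq_sym (negPf nr) addn0.
rewrite IH //; case: eqP => [nm | _]; first by rewrite nm mus in nus.
by rewrite addn0 DI.
Qed.

Lemma iterD_ind (P : locfun -> Prop) D kap x :
  P x -> (forall mu y, P y -> P (D mu y)) -> P (iterD D kap x).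
Proof.
move=> Px PD; rewrite /iterD; elim: (enum _) => //= mu s IH.
by elim: (kap mu) => //= m; apply: PD.
Qed.

(* The derivation of parity s commuting with total derivatives and sending
   each undifferentiated field phi to g phi *)
Definition prolong (s : bool) (g : field n N -> locfun) : locfun -> locfun :=
  der s (fun v => iterD pder v.2 (g v.1)).

Section Prolong.
Variables (s : bool) (g : field n N -> locfun).
Hypothesis gpar : forall phi, has_parity (odd_field phi (+) s) (g phi).
Hypothesis gsym : forall a mu nu,
  g (Fh a mu nu) = g (Fh a nu mu) /\ g (Fhs a mu nu) = g (Fhs a nu mu).

Lemma prolong_fpar v :
  has_parity (odd_field v.1 (+) s) (iterD pder v.2 (g v.1)).
Proof. by apply: iterD_ind => [|mu y]; [apply: gpar | apply: pder_parity]. Qed.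
Lemma prolong_fsym : symmetric_jets (fun v => iterD pder v.2 (g v.1)).
Proof. by move=> a mu nu kap /=; case: (gsym a mu nu) => -> ->. Qed.

Lemma prolong_var v : prolong s g (var v) = iterD pder v.2 (g v.1).
Proof. exact: (der_var prolong_fpar prolong_fsym). Qed.
Lemma prolong_cst c : prolong s g c%:A = 0.
Proof. exact: (der_cst prolong_fpar prolong_fsym). Qed.
Lemma prolong_add x y : prolong s g (x + y) = prolong s g x + prolong s g y.
Proof. exact: (der_add prolong_fpar prolong_fsym). Qed.
Lemma prolong_mul x y :
  prolong s g (x * y) = prolong s g x * y + iter s parity x * prolong s g y.
Proof. exact: (der_mul prolong_fpar prolong_fsym). Qed.
Lemma prolong_scale c x : prolong s g (c *: x) = c *: prolong s g x.
Proof. exact: (der_scale prolong_fpar prolong_fsym). Qed.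
Lemma prolong0 : prolong s g 0 = 0.
Proof. by have := prolong_scale 0 0; rewrite !scale0r. Qed.

Lemma parity_pder mu x : parity (pder mu x) = pder mu (parity x).
Proof. by rewrite (parity_der (pder_fpar mu) (pder_fsym mu)) scale1r. Qed.

Lemma prolong_pder mu x : prolong s g (pder mu x) = pder mu (prolong s g x).
Proof.
pattern x; move: x; apply: loc_elim => [c|v|x y hx hy|x y hx hy].
- by rewrite pder_cst prolong_cst prolong0 pder0.
- rewrite pder_var !prolong_var /=; apply: iterD_incr; exact: pderC.
- by rewrite pder_add !prolong_add pder_add hx hy.
- rewrite !(pder_mul, prolong_mul, prolong_add, pder_add) hx hy.
  have -> : pder mu (iter s parity x) = iter s parity (pder mu x).
    by case: (s) => //=; rewrite parity_pder.
  by rewrite addrACA [X in _ + X]addrC -!addrA; congr (_ + _); rewrite addrCA.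
Qed.
End Prolong.

End LocalFunctions.

Arguments var {R n N}.

Section MasslessSpin2.
Variables (R : realType) (n N : nat).
Local Notation A := (locfun R n N).

Definition hf (a : 'I_N) (mu nu : 'I_n) : A := var (Fh a mu nu, [ffun=> 0%N]).
Definition Cf (a : 'I_N) (mu : 'I_n) : A := var (FC a mu, [ffun=> 0%N]).
Definition hsf (a : 'I_N) (mu nu : 'I_n) : A := var (Fhs a mu nu, [ffun=> 0%N]).
Definition Csf (a : 'I_N) (mu : 'I_n) : A := var (FCs a mu, [ffun=> 0%N]).

(* Direction 0 is time.  The inverse metric has the same entries. *)
Definition eta : 'M[R]_n :=
  \matrix_(mu, nu) (if mu == nu then (if val mu == 0%N then -1 else 1) else 0).

Definition raise (T : 'I_n -> A) (mu : 'I_n) : A :=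
  \sum_nu eta mu nu *: T nu.

Definition trh (a : 'I_N) : A := \sum_mu raise (hf a mu) mu.

(* h^{a nu rho} and \partial_mu h^{a mu}_nu *)
Definition hup (a : 'I_N) (nu rho : 'I_n) : A :=
  raise (fun nu' => raise (hf a nu') rho) nu.
Definition divh (a : 'I_N) (nu : 'I_n) : A :=
  \sum_mu pder mu (raise (fun mu' => hf a mu' nu) mu).

Definition lagrangian0 (k : 'M[R]_N) : A :=
  \sum_a \sum_b k a b *: (
    - 2^-1 *: (\sum_mu \sum_nu \sum_rho
        pder mu (hf a nu rho) * raise (fun mu' => pder mu' (hup b nu rho)) mu)
    + \sum_nu divh a nu * raise (divh b) nu
    - \sum_nu pder nu (trh a) * raise (divh b) nu
    + 2^-1 *: (\sum_mu pder mu (trh a) * raise (fun mu' => pder mu' (trh b)) mu)).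

(* Partial derivative with respect to the jet (Fh a al be, kap), normalized as
   usual for a symmetric tensor:
   d h_{rho sig} / d h_{al be} = (d_rho^al d_sig^be + d_rho^be d_sig^al) / 2. *)
Definition dh_jet (a : 'I_N) (al be : 'I_n) (kap : {ffun 'I_n -> nat})
    (v : jet n N) : A :=
  match v.1 with
  | Fh b rho sig =>
      if (b == a) && (v.2 == kap) then
        (2^-1 * (((rho == al) && (sig == be))%:R
                 + ((rho == be) && (sig == al))%:R))%:A
      else 0
  | _ => 0
  end.
Definition dh a al be kap : A -> A := der false (dh_jet a al be kap).

(* Euler-Lagrange derivative with respect to h^a_{al be} of a Lagrangian
   involving no derivatives beyond the first. *)
Definition euler (L : A) (a : 'I_N) (al be : 'I_n) : A :=
  dh a al be [ffun=> 0%N] L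
  - \sum_mu pder mu (dh a al be (jet_incr mu [ffun=> 0%N]) L).

Definition gamma0 (phi : field n N) : A :=
  match phi with
  | Fh a al be => pder al (Cf a be) + pder be (Cf a al)
  | _ => 0
  end.

Definition delta0 (k : 'M[R]_N) (phi : field n N) : A :=
  match phi with
  | Fhs a al be => euler (lagrangian0 k) a al be
  | FCs a al => - 2 *: \sum_be pder be (hsf a be al)
  | _ => 0
  end.

Definition gamma : A -> A := prolong true gamma0.
Definition delta (k : 'M[R]_N) : A -> A := prolong true (delta0 k).

Definition proper_orthochronous (L : 'M[R]_n) : Prop :=
  [/\ L *m eta *m L^T = eta, \det L = 1
    & forall i : 'I_n, val i = 0%N -> 0 < L i i].

(* Local functions have no explicit dependence on x, so the group only acts on
   indices: lower ones, including those of derivatives, transform with L, upper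
   ones with the contragredient matrix. *)
Definition lorentz0 (L : 'M[R]_n) (phi : field n N) : A :=
  let M := (invmx L)^T in
  match phi with
  | Fh a mu nu => \sum_rho \sum_sig (L mu rho * L nu sig) *: hf a rho sig
  | FC a mu => \sum_rho L mu rho *: Cf a rho
  | Fhs a mu nu => \sum_rho \sum_sig (M mu rho * M nu sig) *: hsf a rho sig
  | FCs a mu => \sum_rho M mu rho *: Csf a rho
  end.
Definition lorentz_pder (L : 'M[R]_n) (mu : 'I_n) (x : A) : A :=
  \sum_nu L mu nu *: pder nu x.
Definition lorentz_jet (L : 'M[R]_n) (v : jet n N) : A :=
  iterD (lorentz_pder L) v.2 (lorentz0 L v.1).
Definition lorentz (L : 'M[R]_n) : A -> A := subst (lorentz_jet L).

Definition lorentz_invariant (x : A) : Prop :=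
  forall L, proper_orthochronous L -> lorentz L x = x.

Definition spanned_by (P : pred (seq (jet n N))) (x : A) : Prop :=
  exists s : seq (R * seq (jet n N)),
    all (fun t => P t.2) s /\ x = \sum_(t <- s) t.1 *: \prod_(v <- t.2) var v.

Definition ghost_number (g : int) : A -> Prop :=
  spanned_by (fun w => \sum_(v <- w) ghost v == g).
Definition antifield_number (m : nat) : A -> Prop :=
  spanned_by (fun w => (\sum_(v <- w) antifield v)%N == m).
Definition at_most_derivatives (m : nat) : A -> Prop :=
  spanned_by (fun w => (\sum_(v <- w) nderiv v <= m)%N).

(* a i b c is a^i_{bc}. *)
Definition a2 (a : 'I_N -> 'I_N -> 'I_N -> R) : A :=
  \sum_i \sum_b \sum_c \sum_al \sum_be
    a i b c *: (Csf i be * raise (Cf b) al * pder be (Cf c al)).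

Lemma has_parity0 p : has_parity p (0 : A).
Proof. by rewrite /has_parity scaler0 -(scale0r 1) parity_cst. Qed.
Lemma has_parity_add p (x y : A) :
  has_parity p x -> has_parity p y -> has_parity p (x + y).
Proof. by rewrite /has_parity parity_add scalerDr => -> ->. Qed.
Lemma has_parity_scale p c (x : A) : has_parity p x -> has_parity p (c *: x).
Proof. by rewrite /has_parity parity_scale => ->; rewrite !scalerA mulrC. Qed.
Lemma has_parity_opp p (x : A) : has_parity p x -> has_parity p (- x).
Proof. by rewrite -scaleN1r; apply: has_parity_scale. Qed.
Lemma has_parity_mul p q (x y : A) :
  has_parity p x -> has_parity q y -> has_parity (p (+) q) (x * y).
Proof.
rewrite /has_parity parity_mul => -> ->.
by rewrite -scalerAl -scalerAr scalerA sgnM.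
Qed.
Lemma has_parity_sum p (I : Type) (s : seq I) (F : I -> A) :
  (forall i, has_parity p (F i)) -> has_parity p (\sum_(i <- s) F i).
Proof.
by move=> hF; apply: big_ind => //; [apply: has_parity0 | apply: has_parity_add].
Qed.
Lemma has_parity_raise p T mu : (forall nu, has_parity p (T nu)) ->
  has_parity p (raise T mu).
Proof. by move=> hT; apply: has_parity_sum => nu; apply: has_parity_scale. Qed.
Lemma hf_parity a mu nu : has_parity false (hf a mu nu).
Proof. exact: var_parity. Qed.

Lemma lagrangian0_parity k : has_parity false (lagrangian0 k).
Proof.
have ht a : has_parity false (trh a).
  by apply: has_parity_sum => mu; apply: has_parity_raise => ?; apply: hf_parity.
have hd a nu : has_parity false (divh a nu).
  apply: has_parity_sum => mu; apply/pder_parity/has_parity_raise => ?.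
  exact: hf_parity.
have hu a mu nu : has_parity false (hup a mu nu).
  by do 2 apply: has_parity_raise => ?; apply: hf_parity.
apply: has_parity_sum => a; apply: has_parity_sum => b; apply: has_parity_scale.
have hM (x y : A) : has_parity false x -> has_parity false y -> has_parity false (x * y).
  by move=> hx hy; apply: (has_parity_mul hx hy).
apply: has_parity_add; [apply: has_parity_add; [apply: has_parity_add|]|].
- apply: has_parity_scale; do 3 apply: has_parity_sum => ?; apply: hM.
    exact/pder_parity/hf_parity.
  by apply: has_parity_raise => ?; apply: pder_parity.
- by apply: has_parity_sum => ?; apply: hM => //; apply: has_parity_raise.
- apply: has_parity_opp; apply: has_parity_sum => ?; apply: hM.
    exact: pder_parity.
  exact: has_parity_raise.
- apply: has_parity_scale; apply: has_parity_sum => ?; apply: hM.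
    exact: pder_parity.
  by apply: has_parity_raise => ?; apply: pder_parity.
Qed.

Lemma dh_fpar a al be kap v :
  has_parity (odd_field v.1 (+) false) (dh_jet a al be kap v).
Proof.
case: v => [] [] *; rewrite /dh_jet /=; try exact: has_parity0.
case: ifP => _; last exact: has_parity0.
by rewrite /has_parity parity_cst scale1r.
Qed.
Lemma dh_fsym a al be kap : symmetric_jets (dh_jet a al be kap).
Proof.
move=> b mu nu kap'; split => //; rewrite /dh_jet /=.
by case: ifP => // _; rewrite addrC [(nu == be) && _]andbC [(nu == al) && _]andbC.
Qed.

Lemma dh_var a al be kap v : dh a al be kap (var v) = dh_jet a al be kap v.
Proof. exact: (der_var (dh_fpar a al be kap) (dh_fsym a al be kap)). Qed.
Lemma dh_add a al be kap x y :
  dh a al be kap (x + y) = dh a al be kap x + dh a al be kap y.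
Proof. exact: (der_add (dh_fpar a al be kap) (dh_fsym a al be kap)). Qed.
Lemma dh_scale a al be kap c x : dh a al be kap (c *: x) = c *: dh a al be kap x.
Proof. exact: (der_scale (dh_fpar a al be kap) (dh_fsym a al be kap)). Qed.
Lemma dh_mul a al be kap x y :
  dh a al be kap (x * y) = dh a al be kap x * y + x * dh a al be kap y.
Proof. exact: (der_mul (dh_fpar a al be kap) (dh_fsym a al be kap)). Qed.

Lemma dh_sym a al be kap x : dh a al be kap x = dh a be al kap x.
Proof.
congr (der _ _ x); apply/funext => -[] [] *; rewrite /dh_jet //=.
by case: ifP => // _; rewrite addrC.
Qed.

Lemma euler_sym L a al be : euler L a al be = euler L a be al.
Proof.
rewrite /euler dh_sym; congr (_ - _).
by apply: eq_bigr => mu _; rewrite dh_sym.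
Qed.
Lemma euler_parity L a al be : has_parity false L -> has_parity false (euler L a al be).
Proof.
have hd kap (x : A) : has_parity false x -> has_parity false (dh a al be kap x).
  by move=> hx; apply: (der_parity (dh_fpar a al be kap) (dh_fsym a al be kap) hx).
move=> hL; apply: has_parity_add; first exact: hd.
apply: has_parity_opp; apply: has_parity_sum => mu; exact/pder_parity/hd.
Qed.

Lemma gamma0_par phi : has_parity (odd_field phi (+) true) (gamma0 phi).
Proof.
case: phi => *; rewrite /gamma0; try exact: has_parity0.
by apply: has_parity_add; apply/pder_parity/var_parity.
Qed.
Lemma gamma0_sym a mu nu : gamma0 (Fh a mu nu) = gamma0 (Fh a nu mu) /\
  gamma0 (Fhs a mu nu) = gamma0 (Fhs a nu mu).
Proof. by rewrite /gamma0 addrC. Qed.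
Lemma delta0_par k phi : has_parity (odd_field phi (+) true) (delta0 k phi).
Proof.
case: phi => *; rewrite /delta0; try exact: has_parity0.
- exact/euler_parity/lagrangian0_parity.
- by apply/has_parity_scale/has_parity_sum => ?; apply/pder_parity/var_parity.
Qed.
Lemma delta0_sym k a mu nu : delta0 k (Fh a mu nu) = delta0 k (Fh a nu mu) /\
  delta0 k (Fhs a mu nu) = delta0 k (Fhs a nu mu).
Proof. by split=> //; apply: euler_sym. Qed.

Lemma iterD0 D (x : A) : iterD D [ffun=> 0%N] x = x.
Proof. by rewrite /iterD; elim: (enum _) => //= mu s ->; rewrite ffunE. Qed.

Lemma gamma_mul x y : gamma (x * y) = gamma x * y + parity x * gamma y.
Proof. exact: (prolong_mul gamma0_par gamma0_sym). Qed.
Lemma gamma_add x y : gamma (x + y) = gamma x + gamma y.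
Proof. exact: (prolong_add gamma0_par gamma0_sym). Qed.
Lemma gamma_scale c x : gamma (c *: x) = c *: gamma x.
Proof. exact: (prolong_scale gamma0_par gamma0_sym). Qed.
Lemma gamma_pder mu x : gamma (pder mu x) = pder mu (gamma x).
Proof. exact: (prolong_pder gamma0_par gamma0_sym). Qed.
Lemma gamma_var v : gamma (var v) = iterD (@pder R n N) v.2 (gamma0 v.1).
Proof. exact: (prolong_var gamma0_par gamma0_sym). Qed.
Lemma gamma_hf a al be :
  gamma (hf a al be) = pder al (Cf a be) + pder be (Cf a al).
Proof. by rewrite gamma_var iterD0. Qed.
Lemma gamma_Cf a al : gamma (Cf a al) = 0.
Proof. by rewrite gamma_var iterD0. Qed.
Lemma gamma_hsf a al be : gamma (hsf a al be) = 0.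
Proof. by rewrite gamma_var iterD0. Qed.
Lemma gamma_Csf a al : gamma (Csf a al) = 0.
Proof. by rewrite gamma_var iterD0. Qed.

Lemma delta_mul k x y : delta k (x * y) = delta k x * y + parity x * delta k y.
Proof. exact: (prolong_mul (delta0_par k) (delta0_sym k)). Qed.
Lemma delta_add k x y : delta k (x + y) = delta k x + delta k y.
Proof. exact: (prolong_add (delta0_par k) (delta0_sym k)). Qed.
Lemma delta_scale k c x : delta k (c *: x) = c *: delta k x.
Proof. exact: (prolong_scale (delta0_par k) (delta0_sym k)). Qed.
Lemma delta_pder k mu x : delta k (pder mu x) = pder mu (delta k x).
Proof. exact: (prolong_pder (delta0_par k) (delta0_sym k)). Qed.
Lemma delta_var k v : delta k (var v) = iterD (@pder R n N) v.2 (delta0 k v.1).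
Proof. exact: (prolong_var (delta0_par k) (delta0_sym k)). Qed.
Lemma delta_hf k a al be : delta k (hf a al be) = 0.
Proof. by rewrite delta_var iterD0. Qed.
Lemma delta_Cf k a al : delta k (Cf a al) = 0.
Proof. by rewrite delta_var iterD0. Qed.
Lemma delta_hsf k a al be :
  delta k (hsf a al be) = euler (lagrangian0 k) a al be.
Proof. by rewrite delta_var iterD0. Qed.
Lemma delta_Csf k a al :
  delta k (Csf a al) = - 2 *: \sum_be pder be (hsf a be al).
Proof. by rewrite delta_var iterD0. Qed.

Lemma lorentz_jet_parity L v : has_parity (odd_field v.1) (lorentz_jet L v).
Proof.
apply: iterD_ind => [|mu y hy]; last first.
  by apply: has_parity_sum => nu; apply/has_parity_scale/pder_parity.
by case: v.1 => *; do ?[apply: has_parity_sum => ?]; apply: has_parity_scale;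
  apply: var_parity.
Qed.
Lemma lorentz_comm L v w : lorentz_jet L v * lorentz_jet L w =
  sgn R (odd_field v.1 && odd_field w.1) *: (lorentz_jet L w * lorentz_jet L v).
Proof. exact: mul_comm (lorentz_jet_parity L v) (lorentz_jet_parity L w). Qed.
Lemma lorentz_sym L : symmetric_jets (lorentz_jet L).
Proof.
move=> a mu nu kap; split; rewrite /lorentz_jet /=; congr iterD;
  rewrite exchange_big; apply: eq_bigr => rho _; apply: eq_bigr => sig _;
  rewrite mulrC; congr (_ *: _);
  by case: (var_sym R a rho sig [ffun=> 0%N]).
Qed.

Lemma lorentz_add L x y : lorentz L (x + y) = lorentz L x + lorentz L y.
Proof. exact: (subst_add (lorentz_comm L) (lorentz_sym L)). Qed.
Lemma lorentz_mul L x y : lorentz L (x * y) = lorentz L x * lorentz L y.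
Proof. exact: (subst_mul (lorentz_comm L) (lorentz_sym L)). Qed.
Lemma lorentz_scale L c x : lorentz L (c *: x) = c *: lorentz L x.
Proof. exact: (subst_scale (lorentz_comm L) (lorentz_sym L)). Qed.
Lemma lorentz_var L v : lorentz L (var v) = lorentz_jet L v.
Proof. exact: (subst_var (lorentz_comm L) (lorentz_sym L)). Qed.

End MasslessSpin2.

Section InternalAlgebra.
Variables (R : realType) (N : nat).

Definition positive_definite (k : 'M[R]_N) : Prop :=
  forall x : 'rV[R]_N, x != 0 -> 0 < (x *m k *m x^T) 0 0.

Definition alg_mul (a : 'I_N -> 'I_N -> 'I_N -> R) (x y : 'rV[R]_N) : 'rV[R]_N :=
  \row_i \sum_b \sum_c a i b c * x 0 b * y 0 c.

Definition lower (k : 'M[R]_N) (a : 'I_N -> 'I_N -> 'I_N -> R)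
    (i b c : 'I_N) : R := \sum_d k i d * a d b c.

Definition sym3 (t : 'I_N -> 'I_N -> 'I_N -> R) (a b c : 'I_N) : R :=
  6^-1 * (t a b c + t a c b + t b a c + t b c a + t c a b + t c b a).

End InternalAlgebra.

(* Main.v *)
(** Lowering the upper index of [a] gives [a_{abc}].

    Sufficiency.  If [a_{abc}] is totally symmetric, [a0] is the cubic vertex
    [2 a_{abc} phi^a (G^b G^c - G^b G^c)] of the Palatini form of general relativity, where
    [phi] is the perturbation of the metric density and [G] the linearized connection, and
    [a1] is [h^*] contracted with the Lie derivative of [phi] along the ghost, up to a trace
    reversal and a [delta]-exact term.  Its gauge invariance amounts to four facts: Lie
    derivatives are skew under integration by parts, the linearized Ricci tensor is covariant
    up to the inhomogeneous term of the connection, [G] solves its equation of motion in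
    terms of [phi], and the quadratic form [G G - G G] is covariant.

    Necessity.  The two equations are evaluated by multilinear functionals: derivatives in
    the direction of field configurations polynomial in [x], taken at the origin and arranged
    so that total derivatives drop out.  When both ghosts are Killing rotations the unknown
    [gamma a1] drops out of the first equation, leaving [a^a_{[bc]} = 0].  When one ghost is
    constant, the first equation forces the part of [a1] without differentiated ghosts to be
    the translation of [h^c] along [a^a_{bc} C^b], up to a gauge transformation.  The second
    equation says that this translation is a symmetry of the free action; on a transverse
    traceless [h_{12}] depending on [x^0] only, this reads [a_{abc} = a_{cba}]. *)

Require Import Defs.
From HB Require Import structures.
From mathcomp Require Import all_boot all_order all_algebra.
From mathcomp Require Import boolp reals ring zify.

Set Implicit Arguments.
Unset Strict Implicit.
Unset Printing Implicit Defensive.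

Import Order.TTheory GRing.Theory Num.Theory.
Local Open Scope ring_scope.

(** Graded commutativity leaves no ring tactic for local functions, and no normal form of the
    quotient is used. Identities are reduced by Leibniz rules and renaming of indices to linear
    combinations of atoms; conversely, coefficients are read off by derivations with scalar values
    on the jets, followed by the constant term [cst]. The Palatini form is chosen because covariance
    of the Ricci tensor splits there, by degree in the connection, into short identities. Since G
    makes the quadratic action stationary, only its lowest-order variation under [gamma] is ever
    needed. For necessity the currents b_1 and b_0 are unknown and a1 may contain derivatives of any
    order. Polynomial configurations of degree at most three see finitely many coefficients only,
    and one of the slots (h^* in the first equation, h in the second) plays the part of a test
    function, so that integration by parts becomes a finite alternating sum. The dimension enters
    twice: the trace reversal divides by n - 2, and the configurations need three distinct
    directions, two for the polarization of h_{12} and one on which it depends. *)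

Section LinearCombinations.
Variables (R : pzRingType) (V : lmodType R).

(** Reflection for the tactic [lin] below. Monomials, whose factors commute only up to sign, become
    atoms numbered by their position in [env]; an equality then reduces to equalities between scalar
    coefficients, where [ring] and [field] apply. *)
Inductive lexp :=
| LX of nat | L0 | LD of lexp & lexp | LN of lexp | LZ of R & lexp.

Fixpoint lev (env : seq V) e : V :=
  match e with
  | LX i => nth 0 env i | L0 => 0 | LD x y => lev env x + lev env y
  | LN x => - lev env x | LZ c x => c *: lev env x
  end.

Fixpoint lcoef e (i : nat) : R :=
  match e with
  | LX j => if Nat.eqb i j then 1 else 0 | L0 => 0
  | LD x y => lcoef x i + lcoef y i
  | LN x => - lcoef x i | LZ c x => c * lcoef x i
  end.

Fixpoint lcheck m e1 e2 : Prop :=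
  if m is m'.+1 then lcoef e1 m' = lcoef e2 m' /\ lcheck m' e1 e2 else True.

Lemma levE env e : lev env e = \sum_(i < size env) lcoef e i *: env`_i.
Proof.
elim: e => /= [j||x -> y ->|x ->|c x ->].
- case: (ltnP j (size env)) => hj; last first.
    rewrite nth_default // big1 // => i _.
    case: (PeanoNat.Nat.eqb_spec i j) => [ij|_]; last by rewrite scale0r.
    by have := ltn_ord i; rewrite ij ltnNge hj.
  rewrite (bigD1 (Ordinal hj)) //= PeanoNat.Nat.eqb_refl scale1r big1 ?addr0 // => i ij.
  case: (PeanoNat.Nat.eqb_spec i j) => [eij|_]; last by rewrite scale0r.
  by case/eqP: ij; apply: val_inj.
- by rewrite big1 // => i _; rewrite scale0r.
- by rewrite -big_split; apply: eq_bigr => i _; rewrite scalerDl.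
- by rewrite -sumrN; apply: eq_bigr => i _; rewrite scaleNr.
- by rewrite scaler_sumr; apply: eq_bigr => i _; rewrite scalerA.
Qed.

Lemma lcheckP env e1 e2 : lcheck (size env) e1 e2 -> lev env e1 = lev env e2.
Proof.
move=> h; rewrite !levE; apply: eq_bigr => i _; congr (_ *: _).
elim: (size env) i h => [[]//|m IH] i /= [h1 h2].
have := ltn_ord i; rewrite ltnS leq_eqVlt => /orP[/eqP -> //|hi].
exact: (IH (Ordinal hi)).
Qed.
End LinearCombinations.

(* Atoms are compared up to the choice of canonical structures. *)
Ltac lin_same x y :=
  first
  [ constr_eq x y
  | lazymatch x with
    | (?a * ?b)%R =>
        lazymatch y with (?c * ?d)%R => lin_same a c; lin_same b d end
    | (?a *: ?b)%R =>
        lazymatch y with (?c *: ?d)%R => constr_eq a c; lin_same b d end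
    | (?a + ?b)%R =>
        lazymatch y with (?c + ?d)%R => lin_same a c; lin_same b d end
    | 1%R => lazymatch y with 1%R => idtac end
    | (- ?a)%R => lazymatch y with (- ?b)%R => lin_same a b end
    | pder ?m ?a =>
        lazymatch y with pder ?m' ?b => lin_same m m'; lin_same a b end
    | bigop _ _ ?f =>
        lazymatch y with bigop _ _ ?g => lin_same_fun f g end
    | BigBody _ _ _ ?a =>
        lazymatch y with BigBody _ _ _ ?b => lin_same a b end
    | ?f ?a =>
        lazymatch y with
        | ?g ?b =>
            lazymatch type of a with
            | forall x : _, _ => constr_eq f g; lin_same_fun a b
            | _ => constr_eq a b; lin_same f g
            end
        end
    end ]
with lin_same_fun f g :=
  assert_succeeds (
    let i := fresh in
    cut (forall i, f i = g i);
    [ move=> _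
    | intro i; cbv beta;
      lazymatch goal with
      | |- ?u = ?v => first [lin_same u v | lin_same_fun u v]
      end ]).
Ltac lin_mem x l :=
  match l with
  | nil => constr:(false)
  | cons ?y _ => let _ := match goal with _ => lin_same x y end in
                 constr:(true)
  | cons _ ?t => lin_mem x t
  end.
Ltac lin_idx x l :=
  match l with
  | cons ?y _ => let _ := match goal with _ => lin_same x y end in
                 constr:(0%N)
  | cons _ ?t => let i := lin_idx x t in constr:(S i)
  end.
Ltac lin_atoms t l :=
  lazymatch t with
  | (?x + ?y)%R => let l1 := lin_atoms x l in lin_atoms y l1
  | (- ?x)%R => lin_atoms x l
  | (_ *: ?x)%R => lin_atoms x l
  | 0%R => l
  | _ => let b := lin_mem t l in
         lazymatch b with true => l | false => constr:(cons t l) end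
  end.
Ltac lin_reify R t l :=
  lazymatch t with
  | (?x + ?y)%R => let a := lin_reify R x l in let b := lin_reify R y l in
                   constr:(LD a b)
  | (- ?x)%R => let a := lin_reify R x l in constr:(LN a)
  | (?c *: ?x)%R => let a := lin_reify R x l in constr:(LZ c a)
  | 0%R => constr:(@L0 R)
  | _ => let i := lin_idx t l in constr:(@LX R i)
  end.
(* Equality of linear combinations, modulo equality of the scalars in R *)
Ltac lin_prep :=
  lazymatch goal with
  | |- @eq ?V ?x ?y =>
    let T := type of y in
    let l0 := lin_atoms x (@nil V) in
    let l := lin_atoms y l0 in
    lazymatch goal with
    | R : realType |- _ =>
      let a := lin_reify R x l in let b := lin_reify R y l in
      refine (@lcheckP R _ l a b _); cbn [size lcheck lcoef Nat.eqb]
    end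
  end.
Ltac lin := lin_prep; repeat split; first [ring | by field | field | idtac].

(** * Lie derivatives and the Ricci tensor *)

Section IteratedSums.
Variables (R : pzRingType) (V : lmodType R) (J : finType).

(** Naming the iterated sums allows a renaming of bound indices in one chosen summand; [lin] then
    closes the goal with whole sums as atoms. *)
Definition S2 (F : J -> J -> V) := \sum_i \sum_j F i j.
Definition S3 (F : J -> J -> J -> V) := \sum_i \sum_j \sum_k F i j k.

Lemma S2D F G : S2 (fun i j => F i j + G i j) = S2 F + S2 G.
Proof. by rewrite /S2 -big_split; apply: eq_bigr => i _; rewrite big_split. Qed.
Lemma S2N F : S2 (fun i j => - F i j) = - S2 F.
Proof. by rewrite /S2 -sumrN; apply: eq_bigr => i _; rewrite sumrN. Qed.
Lemma S2Z c F : S2 (fun i j => c *: F i j) = c *: S2 F.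
Proof. by rewrite /S2 scaler_sumr; apply: eq_bigr => i _; rewrite scaler_sumr. Qed.
Lemma S2C F : S2 F = S2 (fun i j => F j i).
Proof. exact: exchange_big. Qed.
Lemma S2_eq F G : (forall i j, F i j = G i j) -> S2 F = S2 G.
Proof. by move=> h; do 2 apply: eq_bigr => ? _. Qed.
Lemma S3D F G : S3 (fun i j k => F i j k + G i j k) = S3 F + S3 G.
Proof. by rewrite /S3 -big_split; apply: eq_bigr => i _; apply: S2D. Qed.
Lemma S3N F : S3 (fun i j k => - F i j k) = - S3 F.
Proof. by rewrite /S3 -sumrN; apply: eq_bigr => i _; apply: S2N. Qed.
Lemma S3Z c F : S3 (fun i j k => c *: F i j k) = c *: S3 F.
Proof. by rewrite /S3 scaler_sumr; apply: eq_bigr => i _; apply: S2Z. Qed.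
Lemma S3_213 F : S3 F = S3 (fun i j k => F j i k).
Proof. exact: exchange_big. Qed.
Lemma S3_132 F : S3 F = S3 (fun i j k => F i k j).
Proof. by apply: eq_bigr => i _; apply: exchange_big. Qed.
Lemma S3_eq F G : (forall i j k, F i j k = G i j k) -> S3 F = S3 G.
Proof. by move=> h; do 3 apply: eq_bigr => ? _. Qed.
Lemma S3_321 F : S3 F = S3 (fun i j k => F k j i).
Proof. by rewrite S3_213 S3_132 S3_213. Qed.

End IteratedSums.
Definition S2E := (S2D, S2N, S2Z).
Definition S3E := (S3D, S3N, S3Z).

Section LieDerivative.
Variables (R : realType) (n N : nat).
Local Notation A := (locfun R n N).
Local Notation I := 'I_n.
Local Notation "'d_ mu" := (@pder R n N mu) (at level 8, mu at level 2, format "''d_' mu").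

Lemma pderD mu (x y : A) : 'd_mu (x + y) = 'd_mu x + 'd_mu y.
Proof. exact: pder_add. Qed.
Lemma pderN mu (x : A) : 'd_mu (- x) = - 'd_mu x.
Proof. by rewrite -scaleN1r pder_scale scaleN1r. Qed.
Lemma pder_sum mu (J : Type) (s : seq J) (P : pred J) (F : J -> A) :
  'd_mu (\sum_(i <- s | P i) F i) = \sum_(i <- s | P i) 'd_mu (F i).
Proof. by apply: (big_morph _ (pderD mu)); apply: pder0. Qed.
Definition pderE := (pderD, pderN, pder_scale, pder_mul, pder_sum).

Definition central (x : A) := forall y, x * y = y * x.

Lemma even_central x : has_parity false x -> central x.
Proof.
move=> hx; apply: loc_elim => [c|v|y z hy hz|y z hy hz].
- by rewrite mulr_algl mulr_algr.
- by rewrite (mul_comm hx (var_parity R v)) scale1r.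
- by rewrite mulrDl mulrDr hy hz.
- by rewrite mulrA hy -mulrA hz mulrA.
Qed.

Lemma centralCA x y z : central x -> x * (y * z) = y * x * z.
Proof. by move=> cx; rewrite mulrA cx. Qed.

(* Lie derivatives along xi of a contravariant symmetric tensor density, of a
   covariant tensor, and of the linear part of a connection (the index
   positions of the arguments are upper first). *)
Definition lieU (xi : I -> A) (X : I -> I -> A) mu nu := \sum_rho
  (xi rho * 'd_rho (X mu nu) + 'd_rho (xi rho) * X mu nu
   - 'd_rho (xi mu) * X rho nu - 'd_rho (xi nu) * X mu rho).
Definition lieL (xi : I -> A) (X : I -> I -> A) mu nu := \sum_rho
  (xi rho * 'd_rho (X mu nu) + 'd_mu (xi rho) * X rho nu
   + 'd_nu (xi rho) * X mu rho).
Definition lieG (xi : I -> A) (X : I -> I -> I -> A) al mu nu := \sum_rho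
  (xi rho * 'd_rho (X al mu nu) - 'd_rho (xi al) * X rho mu nu
   + 'd_mu (xi rho) * X al rho nu + 'd_nu (xi rho) * X al mu rho).
Definition hess (xi : I -> A) al mu nu := 'd_mu ('d_nu (xi al)).

(** The Ricci tensor of a symmetric connection X is [ric X] + [bb X X]: [ric] is its linear part and
    [bb] its polarized quadratic part. *)
Definition ric (X : I -> I -> I -> A) mu nu :=
  \sum_al 'd_al (X al mu nu) - 'd_nu (\sum_al X al al mu).
Definition bb (X Y : I -> I -> I -> A) mu nu := \sum_al \sum_be
  (X al mu nu * Y be be al - X al be mu * Y be al nu).

(** The contraction of X and Y is a scalar density of weight one, whose Lie derivative is a
    divergence. As [xi] may be odd, it stays on the left, and only X is moved past other factors. *)
Lemma lie_density xi X Y : (forall mu nu, central (X mu nu)) ->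
  \sum_mu \sum_nu (lieU xi X mu nu * Y mu nu + X mu nu * lieL xi Y mu nu)
  = \sum_rho 'd_rho (\sum_mu \sum_nu xi rho * X mu nu * Y mu nu).
Proof.
move=> cX.
have cA mu nu y z : X mu nu * (y * z) = y * X mu nu * z by exact: centralCA.
transitivity (S3 (fun mu nu rho =>
  xi rho * 'd_rho (X mu nu) * Y mu nu + 'd_rho (xi rho) * X mu nu * Y mu nu
  - 'd_rho (xi mu) * X rho nu * Y mu nu - 'd_rho (xi nu) * X mu rho * Y mu nu
  + xi rho * X mu nu * 'd_rho (Y mu nu) + 'd_mu (xi rho) * X mu nu * Y rho nu
  + 'd_nu (xi rho) * X mu nu * Y mu rho)).
  do 2 apply: eq_bigr => ? _.
  rewrite /lieU /lieL mulr_suml mulr_sumr -big_split; apply: eq_bigr => rho _ /=.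
  by rewrite !(mulrDl, mulrDr, mulNr, mulrN, cA); lin.
transitivity (S3 (fun mu nu rho =>
  xi rho * 'd_rho (X mu nu) * Y mu nu + 'd_rho (xi rho) * X mu nu * Y mu nu
  + xi rho * X mu nu * 'd_rho (Y mu nu))); last first.
  rewrite S3_132 S3_213; apply: eq_bigr => rho _; rewrite pder_sum.
  apply: eq_bigr => mu _; rewrite pder_sum; apply: eq_bigr => nu _.
  by rewrite !pderE !mulrDl; lin.
rewrite !S3E.
rewrite [S3 (fun mu nu rho => 'd_rho (xi mu) * _ * _)]S3_321.
rewrite [S3 (fun mu nu rho => 'd_rho (xi nu) * _ * _)]S3_132.
by lin.
Qed.

(** The Ricci tensor is covariant when X changes by [hess xi] + [lieG xi X]. This is the part of
    that statement linear in X: the homogeneous change enters through [ric], the inhomogeneous one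
    through [bb]. *)
Lemma ric_lieG xi X mu nu : (forall al mu nu, central (X al mu nu)) ->
  (forall al mu nu, X al mu nu = X al nu mu) ->
  ric (lieG xi X) mu nu =
  lieL xi (ric X) mu nu - bb (hess xi) X mu nu - bb X (hess xi) mu nu.
Proof.
move=> cX symX.
(* The trace is introduced opaquely, so that it stays a single atom for [lin]. *)
have [tr trD] : exists tr, forall mu, tr mu = \sum_al X al al mu by eexists.
have trE be : \sum_al lieG xi X al al be = \sum_rho (xi rho * 'd_rho (tr be) + 'd_be (xi rho) * tr rho).
  transitivity (S2 (fun al rho => xi rho * 'd_rho (X al al be)
    - 'd_rho (xi al) * X rho al be + 'd_al (xi rho) * X al rho be
    + 'd_be (xi rho) * X al al rho)) => //.
  rewrite !S2E [S2 (fun al rho => 'd_al (xi rho) * _)]S2C.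
  transitivity (S2 (fun rho al => xi rho * 'd_rho (X al al be) + 'd_be (xi rho) * X al al rho)).
    rewrite !S2E [S2 (fun al rho => xi rho * _)]S2C.
    by rewrite [S2 (fun al rho => 'd_be (xi rho) * _)]S2C; lin.
  by apply: eq_bigr => rho _; rewrite big_split /= -!mulr_sumr !trD pder_sum.
transitivity (S2 (fun al rho =>
  'd_al (xi rho) * 'd_rho (X al mu nu) + xi rho * 'd_rho ('d_al (X al mu nu))
  - 'd_rho ('d_al (xi al)) * X rho mu nu - 'd_rho (xi al) * 'd_al (X rho mu nu)
  + 'd_al ('d_mu (xi rho)) * X al rho nu + 'd_mu (xi rho) * 'd_al (X al rho nu)
  + 'd_al ('d_nu (xi rho)) * X al mu rho + 'd_nu (xi rho) * 'd_al (X al mu rho))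
  - \sum_rho ('d_nu (xi rho) * 'd_rho (tr mu) + xi rho * 'd_rho ('d_nu (tr mu))
    + 'd_nu ('d_mu (xi rho)) * tr rho + 'd_mu (xi rho) * 'd_nu (tr rho))).
  rewrite /ric trE !pder_sum; congr (_ - _).
    apply: eq_bigr => al _; rewrite pder_sum; apply: eq_bigr => rho _.
    by rewrite !pderE (pderC al rho (xi al)) (pderC al rho (X al mu nu)); lin.
  apply: eq_bigr => rho _; rewrite !pderE (pderC nu rho (tr mu)); lin.
rewrite !S2E.
rewrite [S2 (fun al rho => 'd_rho (xi al) * _)]S2C.
have -> : lieL xi (ric X) mu nu = S2 (fun al rho => xi rho * 'd_rho ('d_al (X al mu nu))
   + 'd_mu (xi rho) * 'd_al (X al rho nu) + 'd_nu (xi rho) * 'd_al (X al mu rho))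
   - \sum_rho (xi rho * 'd_rho ('d_nu (tr mu)) + 'd_mu (xi rho) * 'd_nu (tr rho)
     + 'd_nu (xi rho) * 'd_rho (tr mu)).
  rewrite S2C -sumrN -big_split; apply: eq_bigr => rho _ /=.
  rewrite /ric -!trD !pderE !mulrDr !mulrN !mulr_sumr !big_split /=.
  by lin.
have -> : bb (hess xi) X mu nu = \sum_rho 'd_nu ('d_mu (xi rho)) * tr rho
    - S2 (fun al rho => 'd_al ('d_mu (xi rho)) * X al rho nu).
  rewrite S2C -sumrN -big_split; apply: eq_bigr => rho _ /=.
  rewrite big_split /= sumrN trD mulr_sumr /hess; congr (_ - _).
  by apply: eq_bigr => al _; rewrite pderC.
have -> : bb X (hess xi) mu nu = S2 (fun al rho => 'd_rho ('d_al (xi al)) * X rho mu nu)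
    - S2 (fun al rho => 'd_al ('d_nu (xi rho)) * X al mu rho).
  rewrite /bb -!/(S2 _) !S2E; congr (_ - _); first rewrite S2C; apply: S2_eq => al rho.
    by rewrite cX /hess pderC.
  by rewrite cX symX /hess.
by rewrite !S2E !big_split /=; lin.
Qed.

(** Covariance of the Ricci tensor in degree two. Since [bb] contracts without differentiating, the
    Leibniz rule holds: the terms in which a derivative of [xi] acts on a contracted index cancel
    between the upper and the lower position. *)
Lemma lieL_bb xi X Y mu nu : (forall al mu nu, central (X al mu nu)) ->
  lieL xi (bb X Y) mu nu = bb (lieG xi X) Y mu nu + bb X (lieG xi Y) mu nu.
Proof.
move=> cX; have cA al be ga y z : X al be ga * (y * z) = y * X al be ga * z by exact: centralCA.
transitivity (S3 (fun rho al be =>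
   xi rho * ('d_rho (X al mu nu) * Y be be al) + xi rho * (X al mu nu * 'd_rho (Y be be al))
   - xi rho * ('d_rho (X al be mu) * Y be al nu) - xi rho * (X al be mu * 'd_rho (Y be al nu))
   + 'd_mu (xi rho) * (X al rho nu * Y be be al) - 'd_mu (xi rho) * (X al be rho * Y be al nu)
   + 'd_nu (xi rho) * (X al mu rho * Y be be al) - 'd_nu (xi rho) * (X al be mu * Y be al rho))).
  apply: eq_bigr => rho _; rewrite /bb pder_sum !mulr_sumr -!big_split /=.
  apply: eq_bigr => al _; rewrite pder_sum !mulr_sumr -!big_split /=.
  by apply: eq_bigr => be _; rewrite !pderE !(mulrDr, mulrN); lin.
have -> : bb (lieG xi X) Y mu nu = S3 (fun al be rho =>
   xi rho * ('d_rho (X al mu nu) * Y be be al) - 'd_rho (xi al) * (X rho mu nu * Y be be al)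
   + 'd_mu (xi rho) * (X al rho nu * Y be be al) + 'd_nu (xi rho) * (X al mu rho * Y be be al)
   - xi rho * ('d_rho (X al be mu) * Y be al nu) + 'd_rho (xi al) * (X rho be mu * Y be al nu)
   - 'd_be (xi rho) * (X al rho mu * Y be al nu) - 'd_mu (xi rho) * (X al be rho * Y be al nu)).
  apply: eq_bigr => al _; apply: eq_bigr => be _; rewrite /lieG !mulr_suml -sumrN -big_split /=.
  by apply: eq_bigr => rho _; rewrite !(mulrDl, mulNr, mulrA); lin.
have -> : bb X (lieG xi Y) mu nu = S3 (fun al be rho =>
   xi rho * (X al mu nu * 'd_rho (Y be be al)) - 'd_rho (xi be) * (X al mu nu * Y rho be al)
   + 'd_be (xi rho) * (X al mu nu * Y be rho al) + 'd_al (xi rho) * (X al mu nu * Y be be rho)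
   - xi rho * (X al be mu * 'd_rho (Y be al nu)) + 'd_rho (xi be) * (X al be mu * Y rho al nu)
   - 'd_al (xi rho) * (X al be mu * Y be rho nu) - 'd_nu (xi rho) * (X al be mu * Y be al rho)).
  apply: eq_bigr => al _; apply: eq_bigr => be _; rewrite /lieG !mulr_sumr -sumrN -big_split /=.
  by apply: eq_bigr => rho _; rewrite !(mulrDr, mulrN, cA) -!mulrA; lin.
have rot F : S3 F = S3 (fun al be rho => F rho al be) by rewrite S3_213 S3_132.
rewrite [LHS]rot !S3E.
rewrite [S3 (fun al be rho => 'd_rho (xi be) * (X al mu nu * _))]S3_132.
rewrite [S3 (fun al be rho => 'd_rho (xi al) * (X rho mu nu * _))]S3_321.
rewrite [S3 (fun al be rho => 'd_rho (xi al) * (X rho be mu * _))]S3_321.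
rewrite [S3 (fun al be rho => 'd_rho (xi be) * (X al be mu * _))]S3_132.
by lin.
Qed.
End LieDerivative.

(** * Linearized gravity *)

Section LinearizedGravity.
Variables (R : realType) (n N : nat).
Local Notation A := (locfun R n N).
Local Notation I := 'I_n.
Local Notation "'d_ mu" := (@pder R n N mu) (at level 8, mu at level 2, format "''d_' mu").
Local Notation h := (hf R).

(** The metric is diagonal with entries of square one, so moving an index up or down is
    multiplication by a sign. *)
Definition ep (mu : I) : R := Defs.eta R n mu mu.
Definition dl (i j : I) : R := (i == j)%:R.

Lemma etaE mu nu : Defs.eta R n mu nu = ep mu * dl mu nu.
Proof. by rewrite /ep /dl !mxE eqxx; case: eqP => [->|_]; rewrite ?mulr1 ?mulr0. Qed.
Lemma ep2 mu : ep mu * ep mu = 1.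
Proof. by rewrite /ep !mxE eqxx; case: ifP; rewrite ?mulrNN mulr1. Qed.
Lemma ep_pm mu : ep mu = 1 \/ ep mu = -1.
Proof. by rewrite /ep !mxE eqxx; case: ifP; [right | left]. Qed.
Lemma sum_dl (V : lmodType R) (F : I -> V) mu : \sum_nu dl mu nu *: F nu = F mu.
Proof.
rewrite (bigD1 mu) //= /dl eqxx scale1r big1 ?addr0 // => nu /negPf.
by rewrite eq_sym => ->; rewrite scale0r.
Qed.
Lemma dlC i j : dl i j = dl j i.
Proof. by rewrite /dl eq_sym. Qed.
Lemma dlxx i : dl i i = 1.
Proof. by rewrite /dl eqxx. Qed.
Lemma raiseE (T : I -> A) mu : raise T mu = ep mu *: T mu.
Proof.
rewrite /raise; under eq_bigr => nu _ do rewrite etaE -scalerA.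
by rewrite -scaler_sumr sum_dl.
Qed.
Lemma hC b mu nu : h b mu nu = h b nu mu :> A.
Proof. by case: (var_sym R b mu nu [ffun=> 0%N]). Qed.

(** The lock keeps [tr], [dv] and [xi] atomic: rules such as [pder_sum] and [pder_scale], which
    match up to unfolding, must not open them. *)
Fact lock_key : unit. Proof. exact: tt. Qed.
Definition tr : 'I_N -> A :=
  locked_with lock_key (fun b => \sum_mu ep mu *: h b mu mu).
Definition dv : 'I_N -> I -> A :=
  locked_with lock_key (fun b nu => \sum_rho ep rho *: 'd_rho (h b rho nu)).
(* phi is the perturbation of the density sqrt(-g) g^{mu nu}, and Gm the linearized
   Christoffel symbol with its upper index first. *)
Definition phi b mu nu : A :=
  (2^-1 * Defs.eta R n mu nu) *: tr b - (ep mu * ep nu) *: h b mu nu.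
Definition Gm b al mu nu : A := (2^-1 * ep al) *:
  ('d_mu (h b al nu) + 'd_nu (h b al mu) - 'd_al (h b mu nu)).
Definition Rs b : A := \sum_mu ep mu *: ric (Gm b) mu mu.

Lemma phiE b mu nu : phi b mu nu =
  (2^-1 * Defs.eta R n mu nu) *: tr b - (ep mu * ep nu) *: h b mu nu.
Proof. by []. Qed.
Lemma GmE b al mu nu : Gm b al mu nu = (2^-1 * ep al) *:
  ('d_mu (h b al nu) + 'd_nu (h b al mu) - 'd_al (h b mu nu)).
Proof. by []. Qed.
Lemma trD b : tr b = \sum_mu ep mu *: h b mu mu.
Proof. by rewrite /tr unlock. Qed.
Lemma dvD b nu : dv b nu = \sum_rho ep rho *: 'd_rho (h b rho nu).
Proof. by rewrite /dv unlock. Qed.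
Lemma trhE b : trh R n b = tr b.
Proof. by rewrite trD; apply: eq_bigr => mu _; rewrite raiseE. Qed.
Lemma divhE b nu : divh R b nu = dv b nu.
Proof. by rewrite dvD; apply: eq_bigr => mu _; rewrite raiseE pder_scale. Qed.
Lemma hupE b mu nu : hup R b mu nu = (ep mu * ep nu) *: h b mu nu :> A.
Proof. by rewrite /hup !raiseE scalerA. Qed.

Lemma tr_parity b : has_parity false (tr b).
Proof. by rewrite trD; apply: has_parity_sum => mu; apply/has_parity_scale/hf_parity. Qed.
Lemma phi_parity b mu nu : has_parity false (phi b mu nu).
Proof.
apply: has_parity_add; first exact/has_parity_scale/tr_parity.
exact/has_parity_opp/has_parity_scale/hf_parity.
Qed.
Lemma phi_central b mu nu : central (phi b mu nu).
Proof. exact/even_central/phi_parity. Qed.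
Lemma Gm_parity b al mu nu : has_parity false (Gm b al mu nu).
Proof.
apply: has_parity_scale; apply: has_parity_add; first apply: has_parity_add.
all: by try apply: has_parity_opp; apply/pder_parity/hf_parity.
Qed.
Lemma Gm_central b al mu nu : central (Gm b al mu nu).
Proof. exact/even_central/Gm_parity. Qed.

Lemma phiC b mu nu : phi b mu nu = phi b nu mu.
Proof. by rewrite /phi (hC b mu nu) !etaE [ep nu * ep mu]mulrC /dl eq_sym; case: eqP => [->|]; rewrite ?mulr0. Qed.
Lemma GmC b al mu nu : Gm b al mu nu = Gm b al nu mu.
Proof. by rewrite /Gm (hC b mu nu); lin. Qed.

Lemma Gm_tr b mu : \sum_al Gm b al al mu = 2^-1 *: 'd_mu (tr b).
Proof.
rewrite trD pder_sum scaler_sumr; apply: eq_bigr => al _.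
by rewrite /Gm pder_scale; lin.
Qed.

Definition box (x : A) := \sum_rho ep rho *: 'd_rho ('d_rho x).

Lemma ricGm b mu nu : ric (Gm b) mu nu =
  2^-1 *: ('d_mu (dv b nu) + 'd_nu (dv b mu) - box (h b mu nu) - 'd_mu ('d_nu (tr b))).
Proof.
rewrite /ric Gm_tr pder_scale !dvD !pder_sum /box (pderC nu mu (tr b)).
transitivity (2^-1 *: (\sum_rho (ep rho *: 'd_rho ('d_mu (h b rho nu)) +
  ep rho *: 'd_rho ('d_nu (h b rho mu)) - ep rho *: 'd_rho ('d_rho (h b mu nu))))
  - 2^-1 *: 'd_mu ('d_nu (tr b))).
  congr (_ - _); rewrite scaler_sumr; apply: eq_bigr => al _.
  by rewrite /Gm !pderE; lin.
rewrite !big_split /= sumrN.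
under [\sum_rho ep rho *: 'd_rho ('d_mu _)]eq_bigr => rho _ do rewrite pderC -pder_scale.
under [\sum_rho ep rho *: 'd_rho ('d_nu _)]eq_bigr => rho _ do rewrite pderC -pder_scale.
by lin.
Qed.

(** Linearization of the relation between the divergence of the metric density and the contracted
    Christoffel symbol, the quantity that vanishes in harmonic gauge. *)
Lemma div_phi b mu : \sum_nu 'd_nu (phi b mu nu) = - \sum_nu ep nu *: Gm b mu nu nu.
Proof.
have -> : \sum_nu 'd_nu (phi b mu nu) = (2^-1 * ep mu) *: 'd_mu (tr b) -
    \sum_nu (ep mu * ep nu) *: 'd_nu (h b mu nu).
  rewrite -sumrN -[X in X + _](sum_dl (fun nu => (2^-1 * ep mu) *: 'd_nu (tr b))) -big_split.
  apply: eq_bigr => nu _ /=; rewrite /phi !pderE etaE; lin.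
rewrite /Gm trD pder_sum scaler_sumr -!sumrN -big_split; apply: eq_bigr => nu _ /=.
rewrite pder_scale.
lin.
Qed.

(** The quadratic Palatini action pairs [phi] with [ric] and the Minkowski metric with [bb]. This is
    its first variation in the connection along X: at the connection [Gm b] determined by h only a
    boundary term remains. *)
Lemma phi_ric b (X : I -> I -> I -> A) :
  (forall al mu nu, X al mu nu = X al nu mu) ->
  \sum_mu \sum_nu (phi b mu nu * ric X mu nu
    + Defs.eta R n mu nu *: (bb (Gm b) X mu nu + bb X (Gm b) mu nu))
  = \sum_rho 'd_rho (\sum_mu \sum_nu phi b mu nu * X rho mu nu
      - \sum_mu phi b mu rho * \sum_al X al al mu).
Proof.
move=> symX.
have [Xt XtE] : exists Xt, forall mu, Xt mu = \sum_al X al al mu by eexists.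
have -> : \sum_rho 'd_rho (\sum_mu \sum_nu phi b mu nu * X rho mu nu
      - \sum_mu phi b mu rho * \sum_al X al al mu) =
    S3 (fun mu nu rho => 'd_rho (phi b mu nu) * X rho mu nu + phi b mu nu * 'd_rho (X rho mu nu))
    - S2 (fun mu rho => 'd_rho (phi b mu rho) * Xt mu + phi b mu rho * 'd_rho (Xt mu)).
  rewrite S2C [S3 _]S3_132 [S3 _]S3_213 -sumrN -big_split; apply: eq_bigr => rho _ /=.
  rewrite pderD pderN !pder_sum; congr (_ - _); apply: eq_bigr => mu _.
    by rewrite pder_sum; apply: eq_bigr => nu _; rewrite pder_mul.
  by rewrite -XtE pder_mul.
have -> : \sum_mu \sum_nu (phi b mu nu * ric X mu nu
    + Defs.eta R n mu nu *: (bb (Gm b) X mu nu + bb X (Gm b) mu nu)) =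
    S3 (fun mu nu rho => phi b mu nu * 'd_rho (X rho mu nu))
    - S2 (fun mu rho => phi b mu rho * 'd_rho (Xt mu))
    + \sum_mu ep mu *: (bb (Gm b) X mu mu + bb X (Gm b) mu mu).
  rewrite -sumrN -!big_split; apply: eq_bigr => mu _ /=.
  rewrite big_split /=; congr (_ + _).
    rewrite -sumrN -big_split; apply: eq_bigr => nu _ /=.
    by rewrite /ric -XtE mulrBr mulr_sumr.
  rewrite -[RHS](sum_dl (fun nu => ep mu *: (bb (Gm b) X mu nu + bb X (Gm b) mu nu))).
  by apply: eq_bigr => nu _; rewrite etaE; lin.
have -> : \sum_mu ep mu *: (bb (Gm b) X mu mu + bb X (Gm b) mu mu) =
    S3 (fun mu al be => ep mu *: (Gm b al mu mu * X be be al))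
    + S3 (fun mu al be => ep mu *: (Gm b be be al * X al mu mu))
    - S3 (fun mu al be => ep mu *: (Gm b al be mu * X be al mu))
    - S3 (fun mu al be => ep mu *: (Gm b be al mu * X al be mu)).
  rewrite -!S3E; apply: eq_bigr => mu _.
  rewrite -big_split scaler_sumr; apply: eq_bigr => al _ /=.
  rewrite -big_split scaler_sumr; apply: eq_bigr => be _ /=.
  by rewrite -!(Gm_central _ _ _ _ (X _ _ _)); lin.
have -> : S3 (fun mu al be => ep mu *: (Gm b al mu mu * X be be al)) =
    - S2 (fun mu rho => 'd_rho (phi b mu rho) * Xt mu).
  rewrite S3_213 /S3 -sumrN; apply: eq_bigr => al _.
  rewrite -mulr_suml div_phi mulNr opprK mulr_suml; apply: eq_bigr => mu _.
  by rewrite XtE -scalerAl mulr_sumr scaler_sumr.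
have -> : S3 (fun mu al be => ep mu *: (Gm b be be al * X al mu mu)) =
    S2 (fun mu rho => (2^-1 * ep mu) *: ('d_rho (tr b) * X rho mu mu)).
  apply: S2_eq => mu al; rewrite -scaler_sumr -mulr_suml Gm_tr -scalerAl; lin.
rewrite [S3 (fun mu al be => ep mu *: (Gm b be al mu * _))]S3_132.
have -> : S3 (fun mu al be => ep mu *: (Gm b al be mu * X be al mu)) =
    S3 (fun mu nu rho => (2^-1 * ep mu * ep nu) *: ('d_rho (h b mu nu) * X rho mu nu)).
  (* Two of the three terms of [Gm] cancel, because X is symmetric in its lower indices: one is [U],
     the other is [U] with mu and al exchanged. *)
  pose U mu al be : A := (2^-1 * ep mu * ep al) *: ('d_mu (h b al be) * X be al mu).
  transitivity (S3 (fun mu al be => (2^-1 * ep mu * ep al) *: ('d_be (h b mu al) * X be mu al))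
    + (S3 U - S3 (fun mu al be => U al mu be))); last by rewrite [S3 U]S3_213 subrr addr0.
  rewrite -!S3E; apply: S3_eq => mu al be.
  rewrite /U /Gm (symX be mu al) (hC b mu be) (hC b mu al) (hC b al be).
  by rewrite !(mulrDl, mulNr, =^~ scalerAl, scalerDr, scalerN); lin.
have -> : S3 (fun mu nu rho => 'd_rho (phi b mu nu) * X rho mu nu + phi b mu nu * 'd_rho (X rho mu nu))
  = S2 (fun mu rho => (2^-1 * ep mu) *: ('d_rho (tr b) * X rho mu mu))
   - S3 (fun mu nu rho => (ep mu * ep nu) *: ('d_rho (h b mu nu) * X rho mu nu))
   + S3 (fun mu nu rho => phi b mu nu * 'd_rho (X rho mu nu)).
  rewrite S3D; congr (_ + _).
  rewrite -S3N -big_split; apply: eq_bigr => mu _ /=.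
  have -> : \sum_rho (2^-1 * ep mu) *: ('d_rho (tr b) * X rho mu mu) =
      \sum_nu dl mu nu *: \sum_rho (2^-1 * ep mu) *: ('d_rho (tr b) * X rho mu nu).
    by rewrite sum_dl.
  rewrite -big_split; apply: eq_bigr => nu _ /=; rewrite scaler_sumr -big_split.
  apply: eq_bigr => rho _ /=; rewrite /phi !pderE etaE mulrBl -!scalerAl; lin.
rewrite !S2E.
have -> : S3 (fun i j k => (2^-1 * ep i * ep j) *: ('d_k (h b i j) * X k i j)) =
    2^-1 *: S3 (fun i j k => (ep i * ep j) *: ('d_k (h b i j) * X k i j)).
  by rewrite -S3Z; apply: S3_eq => i j k; rewrite -scalerA -scalerA; lin.
by lin.
Qed.

End LinearizedGravity.

(** * The Euler-Lagrange equations of the free action *)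

Section EulerLagrange.
Variables (R : realType) (n N : nat).
Local Notation A := (locfun R n N).
Local Notation I := 'I_n.
Local Notation "'d_ mu" := (@pder R n N mu) (at level 8, mu at level 2, format "''d_' mu").
Local Notation h := (hf R).
Local Notation ep := (ep R).
Local Notation dl := (dl R).
Local Notation tr := (@tr R n N).
Local Notation dv := (@dv R n N).
Local Notation k0 := ([ffun=> 0%N] : {ffun I -> nat}).

Lemma pder_hf mu a al be : 'd_mu (h a al be) = var (Fh a al be, jet_incr mu k0) :> A.
Proof. exact: pder_var. Qed.

Lemma jet_incr_eq (mu nu : I) : (jet_incr mu k0 == jet_incr nu k0) = (mu == nu).
Proof.
apply/eqP/eqP => [/ffunP/(_ mu)|->//]; rewrite !ffunE eqxx.
by case: eqP.
Qed.
Lemma jet_incr_neq0 (mu : I) : (jet_incr mu k0 == k0) = false.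
Proof. by apply/eqP => /ffunP/(_ mu); rewrite !ffunE eqxx. Qed.

Variables (c : 'I_N) (al be : I).
Local Notation D kap := (@dh R n N c al be kap).

Definition symd (mu nu : I) : R :=
  2^-1 * (dl mu al * dl nu be + dl mu be * dl nu al).

Lemma dh0 kap : D kap 0 = 0.
Proof. by have := dh_scale c al be kap 0 (0 : A); rewrite !scale0r. Qed.
Lemma dhN kap x : D kap (- x) = - D kap x.
Proof. by rewrite -scaleN1r dh_scale scaleN1r. Qed.
Lemma dh_sum kap (J : Type) (s : seq J) (P : pred J) (F : J -> A) :
  D kap (\sum_(i <- s | P i) F i) = \sum_(i <- s | P i) D kap (F i).
Proof. by apply: (big_morph _ (dh_add c al be kap)); apply: dh0. Qed.

Lemma dh_incr mu rho b s t : D (jet_incr mu k0) ('d_rho (h b s t)) =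
  ((b == c)%:R * dl rho mu * symd s t)%:A.
Proof.
rewrite pder_hf dh_var /dh_jet /= jet_incr_eq /symd /dl.
by case: (b == c); case: (rho == mu); rewrite /= ?(mul0r, mul1r, scale0r) // -!natrM !mulnb.
Qed.
Lemma dh_none rho b s t : D k0 ('d_rho (h b s t)) = 0.
Proof. by rewrite pder_hf dh_var /dh_jet /= jet_incr_neq0 andbF. Qed.

Lemma dh_incr_dv mu b nu : D (jet_incr mu k0) (dv b nu) =
  ((b == c)%:R * ep mu * symd mu nu)%:A.
Proof.
rewrite dvD dh_sum -[RHS](sum_dl (fun rho => ((b == c)%:R * ep rho * symd rho nu)%:A)).
by apply: eq_bigr => rho _; rewrite dh_scale dh_incr (dlC _ mu); lin.
Qed.
Lemma dh_incr_tr mu b nu : D (jet_incr mu k0) ('d_nu (tr b)) =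
  ((b == c)%:R * dl nu mu * Defs.eta R n al be)%:A.
Proof.
rewrite trD pder_sum dh_sum.
transitivity (\sum_rho dl al rho *: ((b == c)%:R * dl nu mu * (ep rho * dl rho be))%:A : A);
  last by rewrite sum_dl etaE.
apply: eq_bigr => rho _; rewrite pder_scale dh_scale dh_incr /symd (dlC R al rho); lin.
Qed.
Lemma dh_none_dv b nu : D k0 (dv b nu) = 0.
Proof. by rewrite dvD dh_sum big1 // => rho _; rewrite dh_scale dh_none scaler0. Qed.
Lemma dh_none_tr b nu : D k0 ('d_nu (tr b)) = 0.
Proof.
by rewrite trD pder_sum dh_sum big1 // => rho _; rewrite pder_scale dh_scale dh_none scaler0.
Qed.

Definition lagr2 (a b : 'I_N) : A :=
  - 2^-1 *: (\sum_mu \sum_nu \sum_rho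
     (ep mu * ep nu * ep rho) *: ('d_mu (h a nu rho) * 'd_mu (h b nu rho)))
  + \sum_nu ep nu *: (dv a nu * dv b nu)
  - \sum_nu ep nu *: ('d_nu (tr a) * dv b nu)
  + 2^-1 *: (\sum_mu ep mu *: ('d_mu (tr a) * 'd_mu (tr b))).

Lemma lagrangian0E k : lagrangian0 n k = \sum_a \sum_b k a b *: lagr2 a b.
Proof.
do 2 apply: eq_bigr => ? _; congr (_ *: (_ *: _ + _ - _ + _ *: _)).
- do 3 apply: eq_bigr => ? _.
  by rewrite raiseE hupE pder_scale -!scalerAr !scalerA mulrA.
- by apply: eq_bigr => nu _; rewrite raiseE !divhE -scalerAr.
- by apply: eq_bigr => nu _; rewrite raiseE !divhE trhE -scalerAr.
- by apply: eq_bigr => nu _; rewrite raiseE !trhE -scalerAr.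
Qed.

Lemma dh_none_lagr k : D k0 (lagrangian0 n k) = 0.
Proof.
rewrite lagrangian0E dh_sum big1 // => a _; rewrite dh_sum big1 // => b _.
rewrite dh_scale /lagr2 !(dh_add, dhN, dh_scale) !dh_sum.
rewrite !big1 ?(scaler0, addr0, subr0) // => mu _;
  rewrite ?dh_scale ?dh_mul ?dh_none_tr ?dh_none_dv ?mul0r ?mulr0 ?addr0 ?scaler0 //.
rewrite dh_sum big1 // => nu _; rewrite dh_sum big1 // => rho _.
by rewrite dh_scale dh_mul !dh_none mul0r mulr0 addr0 scaler0.
Qed.

(* The conjugate momentum of h_{al be} along mu, per unit of k *)
Definition momentum (b : 'I_N) mu : A :=
  - (ep mu * ep al * ep be) *: 'd_mu (h b al be)
  + (dl mu al * ep mu * ep be) *: dv b be + (dl mu be * ep mu * ep al) *: dv b al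
  - (Defs.eta R n al be * ep mu) *: dv b mu
  - (2^-1 * dl mu al * ep mu * ep be) *: 'd_be (tr b)
  - (2^-1 * dl mu be * ep mu * ep al) *: 'd_al (tr b)
  + (Defs.eta R n al be * ep mu) *: 'd_mu (tr b).

Lemma sum_symd (V : lmodType R) mu (F : I -> V) :
  \sum_nu symd mu nu *: F nu = 2^-1 *: (dl mu al *: F be + dl mu be *: F al).
Proof.
rewrite -!sum_dl !scaler_sumr -big_split scaler_sumr; apply: eq_bigr => nu _ /=.
by rewrite /symd (dlC R be) (dlC R al); lin.
Qed.

(** The cross term of [lagr2] is not symmetric in a and b. Each half is therefore written as half of
    [momentum] plus a correction; the corrections have opposite signs and cancel in [dh_incr_lagr]
    by symmetry of k. *)
Lemma dh_incr_lagr2 mu a b : D (jet_incr mu k0) (lagr2 a b) =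
  (a == c)%:R *: (2^-1 *: momentum b mu
     + 4^-1 *: ((dl mu al * ep mu * ep be) *: 'd_be (tr b) + (dl mu be * ep mu * ep al) *: 'd_al (tr b))
     - 2^-1 *: ((Defs.eta R n al be * ep mu) *: dv b mu))
  + (b == c)%:R *: (2^-1 *: momentum a mu
     - 4^-1 *: ((dl mu al * ep mu * ep be) *: 'd_be (tr a) + (dl mu be * ep mu * ep al) *: 'd_al (tr a))
     + 2^-1 *: ((Defs.eta R n al be * ep mu) *: dv a mu)).
Proof.
have e1 : D (jet_incr mu k0) (\sum_mu \sum_nu \sum_rho
     (ep mu * ep nu * ep rho) *: ('d_mu (h a nu rho) * 'd_mu (h b nu rho))) =
  (a == c)%:R *: ((ep mu * ep al * ep be) *: 'd_mu (h b al be)) +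
  (b == c)%:R *: ((ep mu * ep al * ep be) *: 'd_mu (h a al be)).
  have e x : (ep mu * ep al * ep be) *: 'd_mu (h x al be) =
     \sum_nu \sum_rho symd nu rho *: ((ep mu * ep nu * ep rho) *: 'd_mu (h x nu rho)).
    transitivity (\sum_nu 2^-1 *: (dl nu al *: ((ep mu * ep nu * ep be) *: 'd_mu (h x nu be)) +
       dl nu be *: ((ep mu * ep nu * ep al) *: 'd_mu (h x nu al)))); last first.
      by apply: eq_bigr => nu _; rewrite sum_symd.
    rewrite -scaler_sumr big_split /=.
    under eq_bigr => nu _ do rewrite dlC.
    under [X in _ + X]eq_bigr => nu _ do rewrite dlC.
    by rewrite !sum_dl (hC R x be al); lin.
  rewrite !e dh_sum.
  rewrite -[RHS](sum_dl (fun rh => (a == c)%:R *: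
     (\sum_nu \sum_rho symd nu rho *: ((ep rh * ep nu * ep rho) *: 'd_rh (h b nu rho))) +
     (b == c)%:R *: (\sum_nu \sum_rho symd nu rho *: ((ep rh * ep nu * ep rho) *: 'd_rh (h a nu rho))))).
  apply: eq_bigr => rh _; rewrite dh_sum !scaler_sumr -big_split scaler_sumr.
  apply: eq_bigr => nu _; rewrite dh_sum /= !scaler_sumr -big_split scaler_sumr.
  apply: eq_bigr => rho _; rewrite dh_scale dh_mul !dh_incr mulr_algl mulr_algr (dlC R mu) /=.
  by lin.
have e2 : D (jet_incr mu k0) (\sum_nu ep nu *: (dv a nu * dv b nu)) =
  (a == c)%:R *: (2^-1 *: ((dl mu al * ep mu * ep be) *: dv b be + (dl mu be * ep mu * ep al) *: dv b al)) +
  (b == c)%:R *: (2^-1 *: ((dl mu al * ep mu * ep be) *: dv a be + (dl mu be * ep mu * ep al) *: dv a al)).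
  have e x : 2^-1 *: ((dl mu al * ep mu * ep be) *: dv x be + (dl mu be * ep mu * ep al) *: dv x al) =
     \sum_nu symd mu nu *: ((ep mu * ep nu) *: dv x nu).
    by rewrite sum_symd; lin.
  rewrite !e dh_sum !scaler_sumr -big_split; apply: eq_bigr => nu _ /=.
  by rewrite dh_scale dh_mul !dh_incr_dv mulr_algl mulr_algr; lin.
have e3 : D (jet_incr mu k0) (\sum_nu ep nu *: ('d_nu (tr a) * dv b nu)) =
  (a == c)%:R *: ((Defs.eta R n al be * ep mu) *: dv b mu) +
  (b == c)%:R *: (2^-1 *: ((dl mu al * ep mu * ep be) *: 'd_be (tr a) + (dl mu be * ep mu * ep al) *: 'd_al (tr a))).
  have -> : 2^-1 *: ((dl mu al * ep mu * ep be) *: 'd_be (tr a) + (dl mu be * ep mu * ep al) *: 'd_al (tr a)) =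
     \sum_nu symd mu nu *: ((ep mu * ep nu) *: 'd_nu (tr a)).
    by rewrite sum_symd; lin.
  rewrite -[X in _ *: X + _](sum_dl (fun nu => (Defs.eta R n al be * ep nu) *: dv b nu)).
  rewrite dh_sum !scaler_sumr -big_split; apply: eq_bigr => nu _ /=.
  rewrite dh_scale dh_mul !dh_incr_dv !dh_incr_tr mulr_algl mulr_algr (dlC R mu); lin.
have e4 : D (jet_incr mu k0) (\sum_nu ep nu *: ('d_nu (tr a) * 'd_nu (tr b))) =
  (a == c)%:R *: ((Defs.eta R n al be * ep mu) *: 'd_mu (tr b)) +
  (b == c)%:R *: ((Defs.eta R n al be * ep mu) *: 'd_mu (tr a)).
  rewrite -[X in _ *: X + _](sum_dl (fun nu => (Defs.eta R n al be * ep nu) *: 'd_nu (tr b))).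
  rewrite -[X in _ + _ *: X](sum_dl (fun nu => (Defs.eta R n al be * ep nu) *: 'd_nu (tr a))).
  rewrite dh_sum !scaler_sumr -big_split; apply: eq_bigr => nu _ /=.
  by rewrite dh_scale dh_mul !dh_incr_tr mulr_algl mulr_algr (dlC R mu); lin.
rewrite /lagr2 !(dh_add, dhN, dh_scale) e1 e2 e3 e4 /momentum.
by lin.
Qed.

Lemma sum_dlN (V : lmodType R) (F : 'I_N -> V) a : \sum_b (b == a)%:R *: F b = F a.
Proof.
rewrite (bigD1 a) //= eqxx scale1r big1 ?addr0 // => b /negPf ->.
by rewrite scale0r.
Qed.

Lemma dh_incr_lagr (k : 'M[R]_N) mu : k^T = k ->
  D (jet_incr mu k0) (lagrangian0 n k) = \sum_b k c b *: momentum b mu.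
Proof.
move=> ks; have kC a b : k a b = k b a by rewrite -{1}ks mxE.
pose P b : A := 4^-1 *: ((dl mu al * ep mu * ep be) *: 'd_be (tr b) + (dl mu be * ep mu * ep al) *: 'd_al (tr b))
     - 2^-1 *: ((Defs.eta R n al be * ep mu) *: dv b mu).
transitivity (\sum_b k c b *: (2^-1 *: momentum b mu + P b)
  + \sum_a k a c *: (2^-1 *: momentum a mu - P a)).
  rewrite -[X in X + _](sum_dlN (fun a => \sum_b k a b *: (2^-1 *: momentum b mu + P b))).
  rewrite lagrangian0E dh_sum -big_split; apply: eq_bigr => a _ /=.
  rewrite dh_sum -[X in _ + X](sum_dlN (fun b => k a b *: (2^-1 *: momentum a mu - P a))).
  rewrite scaler_sumr -big_split; apply: eq_bigr => b _ /=.
  by rewrite dh_scale dh_incr_lagr2 /P; lin.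
rewrite -big_split; apply: eq_bigr => b _ /=; rewrite (kC b c); lin.
Qed.

Lemma RsE b : Rs R n b = \sum_mu ep mu *: 'd_mu (dv b mu) - box (tr b).
Proof.
have boxtr : box (tr b) = \sum_mu ep mu *: box (h b mu mu) :> A.
  rewrite /box trD; under eq_bigr => mu _ do rewrite !pder_sum scaler_sumr.
  rewrite exchange_big; apply: eq_bigr => nu _ /=; rewrite scaler_sumr.
  by apply: eq_bigr => mu _; rewrite !pder_scale; lin.
transitivity (\sum_mu (ep mu *: 'd_mu (dv b mu) - 2^-1 *: (ep mu *: box (h b mu mu))
   - 2^-1 *: (ep mu *: 'd_mu ('d_mu (tr b))))).
  apply: eq_bigr => mu _; rewrite ricGm; lin.
rewrite !big_split !sumrN -!scaler_sumr -boxtr /= -/(box (tr b)); lin.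
Qed.

(** Each summand is -2 times the linearized Einstein tensor with raised indices. The overall factor
    2 in [def_a0] comes from here. *)
Lemma euler_lagrangian (k : 'M[R]_N) : k^T = k ->
  euler (lagrangian0 n k) c al be = \sum_b k c b *:
    (Defs.eta R n al be *: Rs R n b - (2 * ep al * ep be) *: ric (Gm R b) al be).
Proof.
move=> ks; rewrite /euler dh_none_lagr sub0r.
under eq_bigr => mu _ do rewrite (dh_incr_lagr _ ks) pder_sum.
rewrite exchange_big -sumrN; apply: eq_bigr => b _ /=.
under eq_bigr => mu _ do rewrite pder_scale.
rewrite -scaler_sumr -scalerN; congr (_ *: _).
rewrite ricGm RsE.
transitivity (- ((- (ep al * ep be)) *: \sum_mu ep mu *: 'd_mu ('d_mu (h b al be))
 + (ep al * ep be) *: 'd_al (dv b be) + (ep al * ep be) *: 'd_be (dv b al)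
 - Defs.eta R n al be *: \sum_mu ep mu *: 'd_mu (dv b mu)
 - (2^-1 * ep al * ep be) *: 'd_al ('d_be (tr b)) - (2^-1 * ep al * ep be) *: 'd_be ('d_al (tr b))
 + Defs.eta R n al be *: \sum_mu ep mu *: 'd_mu ('d_mu (tr b)))).
  congr (- _).
  rewrite -[(ep al * ep be) *: 'd_al (dv b be)](sum_dl (fun mu => (ep mu * ep be) *: 'd_mu (dv b be))).
  rewrite -[(ep al * ep be) *: 'd_be (dv b al)](sum_dl (fun mu => (ep al * ep mu) *: 'd_mu (dv b al))).
  rewrite -[(2^-1 * ep al * ep be) *: 'd_al _](sum_dl (fun mu => (2^-1 * ep mu * ep be) *: 'd_mu ('d_be (tr b)))).
  rewrite -[(2^-1 * ep al * ep be) *: 'd_be _](sum_dl (fun mu => (2^-1 * ep al * ep mu) *: 'd_mu ('d_al (tr b)))).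
  rewrite !scaler_sumr -!sumrN -!big_split; apply: eq_bigr => mu _ /=.
  by rewrite /momentum !pderE (dlC R al) (dlC R be); lin.
by rewrite (pderC be al (tr b)) -!/(box _); lin.
Qed.

End EulerLagrange.

(** * The linearized Bianchi identity *)

Section Noether.
Variables (R : realType) (n N : nat).
Local Notation A := (locfun R n N).
Local Notation I := 'I_n.
Local Notation "'d_ mu" := (@pder R n N mu) (at level 8, mu at level 2, format "''d_' mu").

Lemma noether (k : 'M[R]_N) c (be : I) : k^T = k ->
  \sum_al 'd_al (euler (lagrangian0 n k) c al be) = 0.
Proof.
move=> ks; under eq_bigr => al _ do rewrite (euler_lagrangian _ _ _ ks) pder_sum.
rewrite exchange_big big1 // => b _ /=.
under eq_bigr => al _ do rewrite pder_scale pderD pderN !pder_scale.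
rewrite -scaler_sumr (_ : \sum_al _ = 0) ?scaler0 //.
have boxd mu (x : A) : box ('d_mu x) = 'd_mu (box x).
  rewrite /box pder_sum; apply: eq_bigr => rho _.
  by rewrite pder_scale (pderC mu rho) (pderC mu rho).
rewrite big_split /= sumrN.
have -> : \sum_i Defs.eta R n i be *: 'd_i (Rs R n b) = ep R be *: 'd_be (Rs R n b).
  rewrite -[RHS](sum_dl (fun i => ep R i *: 'd_i (Rs R n b))).
  by apply: eq_bigr => i _; rewrite etaE (dlC R i); lin.
transitivity (ep R be *: 'd_be (Rs R n b) - ep R be *:
  (\sum_al ep R al *: 'd_al ('d_al (dv R b be)) + \sum_al ep R al *: 'd_al ('d_be (dv R b al))
   - \sum_al ep R al *: 'd_al (box (hf R b al be)) - \sum_al ep R al *: 'd_al ('d_al ('d_be (tr R n b))))).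
  congr (_ - _); rewrite -!sumrN -!big_split scaler_sumr /=; apply: eq_bigr => al _ /=.
  by rewrite ricGm pder_scale !pderD !pderN; lin.
rewrite -!/(box _) boxd RsE pderD pderN pder_sum.
have -> : box (dv R b be) = \sum_al ep R al *: 'd_al (box (hf R b al be)).
  rewrite /box dvD; under eq_bigr => rho _ do rewrite !pder_sum scaler_sumr.
  rewrite exchange_big; apply: eq_bigr => al _ /=; rewrite pder_sum scaler_sumr.
  apply: eq_bigr => rho _; rewrite !pder_scale (pderC rho al) (pderC rho al); lin.
have -> : \sum_al ep R al *: 'd_al ('d_be (dv R b al)) = \sum_i 'd_be (ep R i *: 'd_i (dv R b i)).
  by apply: eq_bigr => i _; rewrite pder_scale pderC.
by lin.
Qed.
End Noether.

(** * The cubic vertex *)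

Section CubicVertex.
Variables (R : realType) (n N : nat).
Local Notation A := (locfun R n N).
Local Notation I := 'I_n.
Local Notation "'d_ mu" := (@pder R n N mu) (at level 8, mu at level 2, format "''d_' mu").
Local Notation h := (hf R).
Local Notation C := (Cf R).
Local Notation hs := (hsf R).
Local Notation ep := (ep R).
Local Notation tr := (@tr R n N).
Local Notation phi := (@phi R n N).
Local Notation Gm := (@Gm R n N).

Definition total_div (x : A) := exists b : I -> A, x = \sum_mu 'd_mu (b mu).

Lemma total_div0 : total_div 0.
Proof. by exists (fun=> 0); rewrite big1 // => mu _; rewrite pder0. Qed.
Lemma total_divD x y : total_div x -> total_div y -> total_div (x + y).
Proof.
move=> [b ->] [c ->]; exists (fun mu => b mu + c mu); rewrite -big_split.
by apply: eq_bigr => mu _; rewrite pder_add.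
Qed.
Lemma total_divZ c x : total_div x -> total_div (c *: x).
Proof.
move=> [b ->]; exists (fun mu => c *: b mu); rewrite scaler_sumr.
by apply: eq_bigr => mu _; rewrite pder_scale.
Qed.
Lemma total_div_sum (J : Type) (s : seq J) (F : J -> A) :
  (forall i, total_div (F i)) -> total_div (\sum_(i <- s) F i).
Proof. by move=> hF; apply: big_ind => //; [apply: total_div0 | apply: total_divD]. Qed.

Lemma gamma_zero : gamma (0 : A) = 0.
Proof. by have := gamma_scale 0 (0 : A); rewrite !scale0r. Qed.
Lemma gammaN (x : A) : gamma (- x) = - gamma x.
Proof. by rewrite -scaleN1r gamma_scale scaleN1r. Qed.
Lemma gamma_sum (J : Type) (s : seq J) (P : pred J) (F : J -> A) :
  gamma (\sum_(i <- s | P i) F i) = \sum_(i <- s | P i) gamma (F i).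
Proof. exact: (big_morph _ (@gamma_add R n N) gamma_zero). Qed.
Definition gammaE := (gamma_add, gammaN, gamma_scale, gamma_pder, gamma_sum).

Lemma gamma_mul_odd (x y : A) : has_parity true x -> gamma x = 0 ->
  gamma (x * y) = - (x * gamma y).
Proof. by move=> px gx; rewrite gamma_mul gx mul0r add0r px scaleN1r mulNr. Qed.
Lemma gamma_mul_even (x y : A) : has_parity false x ->
  gamma (x * y) = gamma x * y + x * gamma y.
Proof. by move=> px; rewrite gamma_mul px scale1r. Qed.

Definition xi : 'I_N -> I -> A := locked_with lock_key (fun b mu => ep mu *: C b mu).
Lemma xiE b mu : xi b mu = ep mu *: C b mu.
Proof. by rewrite /xi unlock. Qed.

Lemma C_parity b mu : has_parity true (C b mu : A).
Proof. exact: var_parity. Qed.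
Lemma xi_parity b mu : has_parity true (xi b mu).
Proof. by rewrite xiE; exact/has_parity_scale/C_parity. Qed.
Lemma hs_parity b mu nu : has_parity true (hs b mu nu : A).
Proof. exact: var_parity. Qed.
Lemma gamma_xi b mu : gamma (xi b mu) = 0.
Proof. by rewrite xiE gamma_scale gamma_Cf scaler0. Qed.
Lemma C_xi b mu : C b mu = ep mu *: xi b mu :> A.
Proof. by rewrite xiE scalerA ep2 scale1r. Qed.
Lemma gamma_h b mu nu : gamma (h b mu nu) =
  ep nu *: 'd_mu (xi b nu) + ep mu *: 'd_nu (xi b mu).
Proof. by rewrite gamma_hf !C_xi !pder_scale. Qed.

Lemma gamma_lieU b X mu nu : gamma (lieU (xi b) X mu nu) =
  - lieU (xi b) (fun mu nu => gamma (X mu nu)) mu nu.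
Proof.
have g0 rho sig (y : A) : gamma ('d_rho (xi b sig) * y) = - ('d_rho (xi b sig) * gamma y).
  by apply: gamma_mul_odd; [apply/pder_parity/xi_parity | rewrite gamma_pder gamma_xi pder0].
have g1 rho (y : A) : gamma (xi b rho * y) = - (xi b rho * gamma y).
  by apply: gamma_mul_odd; [apply/xi_parity | rewrite gamma_xi].
rewrite /lieU gamma_sum -sumrN; apply: eq_bigr => rho _.
by rewrite !gammaE !g0 !g1 gamma_pder; lin.
Qed.

Definition dxi b : A := \sum_rho 'd_rho (xi b rho).

(* The Lie derivative of the Minkowski metric density along xi *)
Definition Lmet b mu nu : A := Defs.eta R n mu nu *: dxi b
  - ep mu *: 'd_mu (xi b nu) - ep nu *: 'd_nu (xi b mu).

Lemma lieU_const b (g : I -> I -> R) mu nu :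
  lieU (xi b) (fun mu nu => (g mu nu)%:A) mu nu =
  g mu nu *: dxi b - \sum_rho g rho nu *: 'd_rho (xi b mu) - \sum_rho g mu rho *: 'd_rho (xi b nu).
Proof.
rewrite /dxi scaler_sumr -!sumrN -!big_split; apply: eq_bigr => rho _ /=.
by rewrite pder_cst mulr0 !mulr_algr; lin.
Qed.

Lemma LmetE b mu nu : lieU (xi b) (fun mu nu => (Defs.eta R n mu nu)%:A) mu nu = Lmet b mu nu.
Proof.
rewrite lieU_const /Lmet.
rewrite -(sum_dl (fun rho => ep nu *: 'd_rho (xi b mu)) nu).
rewrite -(sum_dl (fun rho => ep mu *: 'd_rho (xi b nu)) mu).
rewrite -addrA -opprD addrC -[X in _ = X]addrA -opprD [in RHS]addrC.
congr (- _ + _); rewrite addrC; congr (_ + _); apply: eq_bigr => rho _.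
  by rewrite etaE; lin.
by rewrite etaE (dlC R rho) /dl; case: eqP => [->|_]; rewrite ?mulr0 ?scale0r // mulr1 scale1r.
Qed.

Lemma gamma_tr b : gamma (tr b) = 2 *: dxi b.
Proof.
rewrite trD gamma_sum scaler_sumr; apply: eq_bigr => mu _.
by rewrite gamma_scale gamma_h scalerDr !scalerA !ep2; lin.
Qed.

Lemma gamma_phi b mu nu : gamma (phi b mu nu) = Lmet b mu nu.
Proof.
rewrite phiE !gammaE gamma_tr gamma_h /Lmet.
rewrite [X in _ - X](_ : _ = (ep nu * ep nu * ep mu) *: 'd_mu (xi b nu)
  + (ep mu * ep mu * ep nu) *: 'd_nu (xi b mu)); last by lin.
by rewrite !ep2; lin.
Qed.

Lemma LmetC b mu nu : Lmet b mu nu = Lmet b nu mu.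
Proof. by rewrite -!gamma_phi phiC. Qed.

(** At lowest order a connection transforms by its inhomogeneous term alone. *)
Lemma gamma_Gm b al mu nu : gamma (Gm b al mu nu) = hess (xi b) al mu nu.
Proof.
rewrite GmE /hess !gammaE !gamma_h !pderE.
rewrite (pderC nu mu) (pderC al nu) (pderC al mu).
transitivity ((ep al * ep al) *: 'd_mu ('d_nu (xi b al))); first by lin.
by rewrite ep2 scale1r.
Qed.

Lemma gamma_bb b c mu nu : gamma (bb (Gm b) (Gm c) mu nu) =
  bb (hess (xi b)) (Gm c) mu nu + bb (Gm b) (hess (xi c)) mu nu.
Proof.
rewrite /bb gamma_sum -big_split; apply: eq_bigr => al _ /=.
rewrite gamma_sum -big_split; apply: eq_bigr => be _ /=.
by rewrite !gammaE !(gamma_mul_even _ (Gm_parity _ _ _ _ _)) !gamma_Gm; lin.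
Qed.

(* First-order general covariance of the Palatini action phi.R(G) + ..., where G solves its
   own linearized equation of motion (phi_ric). *)
Lemma vertex_invariance (la : 'I_N -> 'I_N -> 'I_N -> R) :
  (forall p q r, la p q r = la p r q) ->
  total_div (\sum_p \sum_q \sum_r la p q r *: \sum_mu \sum_nu
    (lieU (xi p) (phi q) mu nu * ric (Gm r) mu nu
     + Lmet p mu nu * bb (Gm q) (Gm r) mu nu
     + phi q mu nu * (bb (hess (xi p)) (Gm r) mu nu + bb (Gm r) (hess (xi p)) mu nu))).
Proof.
move=> las; apply: total_div_sum => p.
have Gc r := @Gm_central R n N r.
pose K q r mu nu := bb (Gm q) (lieG (xi p) (Gm r)) mu nu.
pose K' q r mu nu := bb (lieG (xi p) (Gm r)) (Gm q) mu nu.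
pose V q r := \sum_mu \sum_nu
    (lieU (xi p) (phi q) mu nu * ric (Gm r) mu nu
     + Lmet p mu nu * bb (Gm q) (Gm r) mu nu
     + phi q mu nu * (bb (hess (xi p)) (Gm r) mu nu + bb (Gm r) (hess (xi p)) mu nu)).
pose W q r := \sum_mu \sum_nu Lmet p mu nu * bb (Gm q) (Gm r) mu nu.
pose E q r := \sum_mu \sum_nu Defs.eta R n mu nu *: (K q r mu nu + K' q r mu nu).
(* Integration by parts moves the Lie derivative from [phi] onto the Ricci tensor. There the [hess]
   terms of [ric_lieG] cancel those of [V], and [phi_ric], taken along [lieG (xi p) (Gm r)], trades
   the rest for [E]. *)
have step1 q r : total_div (V q r - W q r - E q r).
  have sL al mu nu : lieG (xi p) (Gm r) al mu nu = lieG (xi p) (Gm r) al nu mu.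
    by apply: eq_bigr => rho _; rewrite !(GmC R r _ mu) (GmC R r _ rho nu); lin.
  have h1 := lie_density (xi p) (ric (Gm r)) (@phi_central R n N q).
  have h2 := phi_ric q sL.
  rewrite [V q r - _ - _](_ : _ = \sum_mu \sum_nu (lieU (xi p) (phi q) mu nu * ric (Gm r) mu nu +
    phi q mu nu * lieL (xi p) (ric (Gm r)) mu nu) + (-1) *:
    \sum_mu \sum_nu (phi q mu nu * ric (lieG (xi p) (Gm r)) mu nu +
           Defs.eta R n mu nu *: (K q r mu nu + K' q r mu nu))).
    rewrite h1 h2; apply: total_divD; first by eexists.
    by apply: total_divZ; eexists.
  rewrite scaleN1r -!sumrN -!big_split; apply: eq_bigr => mu _ /=.
  rewrite -!sumrN -!big_split; apply: eq_bigr => nu _ /=.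
  rewrite (ric_lieG (xi p) mu nu (Gc r) (@GmC R n N r)) !(mulrDr, mulrN); lin.
(* What remains is the Lie derivative of the scalar density formed from the Minkowski metric and
   [bb (Gm q) (Gm r)]. One of its two Leibniz terms occurs with q and r exchanged, which [las]
   repairs. *)
have step2 : total_div (\sum_q \sum_r la p q r *: (W q r + E q r)).
  have -> : \sum_q \sum_r la p q r *: (W q r + E q r) =
     \sum_q \sum_r la p q r *: \sum_mu \sum_nu
       (lieU (xi p) (fun mu nu => (Defs.eta R n mu nu)%:A) mu nu * bb (Gm q) (Gm r) mu nu
        + (Defs.eta R n mu nu)%:A * lieL (xi p) (bb (Gm q) (Gm r)) mu nu).
    pose E1 q r := \sum_mu \sum_nu Defs.eta R n mu nu *: K q r mu nu.
    pose E2 q r := \sum_mu \sum_nu Defs.eta R n mu nu *: K' q r mu nu.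
    transitivity (\sum_q \sum_r la p q r *: (W q r + E1 q r) + \sum_q \sum_r la p q r *: E2 r q).
      rewrite [X in _ + X]exchange_big -big_split; apply: eq_bigr => q _ /=.
      rewrite -big_split; apply: eq_bigr => r _ /=; rewrite (las p r q).
      rewrite -scalerDr -addrA; congr (_ *: (_ + _)).
      rewrite -big_split; apply: eq_bigr => mu _ /=.
      by rewrite -big_split; apply: eq_bigr => nu _ /=; rewrite scalerDr.
    rewrite -big_split; apply: eq_bigr => q _ /=.
    rewrite -big_split; apply: eq_bigr => r _ /=; rewrite -scalerDr; congr (_ *: _).
    rewrite -!big_split; apply: eq_bigr => mu _ /=.
    rewrite -!big_split; apply: eq_bigr => nu _ /=.
    by rewrite LmetE mulr_algl lieL_bb // /K /K'; lin.
  apply: total_div_sum => q; apply: total_div_sum => r; apply: total_divZ.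
  rewrite lie_density; first by eexists.
  by move=> mu nu y; rewrite mulr_algl mulr_algr.
rewrite [X in total_div X](_ : _ = \sum_q \sum_r la p q r *: (V q r - W q r - E q r)
  + \sum_q \sum_r la p q r *: (W q r + E q r)).
  apply: total_divD => //.
  by apply: total_div_sum => q; apply: total_div_sum => r; apply: total_divZ.
rewrite -big_split; apply: eq_bigr => q _ /=; rewrite -big_split; apply: eq_bigr => r _ /=.
by rewrite -/(V q r); lin.
Qed.
End CubicVertex.

(** * The first-order deformation *)

Section FirstOrderDeformation.
Variables (R : realType) (n N : nat).
Local Notation A := (locfun R n N).
Local Notation "'d_ mu" := (@pder R n N mu) (at level 8, mu at level 2, format "''d_' mu").
Local Notation h := (hf R).
Local Notation C := (Cf R).
Local Notation hs := (hsf R).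
Local Notation ep := (ep R).
Local Notation phi := (@phi R n N).
Local Notation Gm := (@Gm R n N).
Local Notation xi := (@xi R n N).
Local Notation eta := (Defs.eta R n).

Variables (k : 'M[R]_N) (a : 'I_N -> 'I_N -> 'I_N -> R).

(** The product of the internal algebra extended to vectors of local functions. When the algebra is
    commutative, odd vectors anticommute under it. *)
Definition contr i (u v : 'I_N -> A) : A := \sum_b \sum_c a i b c *: (u b * v c).

Lemma contrDr i u v w : contr i u (fun c => v c + w c) = contr i u v + contr i u w.
Proof.
rewrite -big_split; apply: eq_bigr => b _; rewrite -big_split; apply: eq_bigr => c _ /=.
by rewrite mulrDr scalerDr.
Qed.
Lemma contrZr i c u v : contr i u (fun b => c *: v b) = c *: contr i u v.
Proof.
rewrite scaler_sumr; apply: eq_bigr => b _; rewrite scaler_sumr; apply: eq_bigr => d _ /=.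
by rewrite -scalerAr; lin.
Qed.
Lemma contrNr i u v : contr i u (fun b => - v b) = - contr i u v.
Proof.
rewrite -sumrN; apply: eq_bigr => b _; rewrite -sumrN; apply: eq_bigr => d _ /=.
by rewrite mulrN scalerN.
Qed.
Lemma contr_sumr i u (J : finType) (v : J -> 'I_N -> A) :
  contr i u (fun c => \sum_j v j c) = \sum_j contr i u (v j).
Proof.
rewrite [RHS]exchange_big; apply: eq_bigr => b _; rewrite [RHS]exchange_big.
by apply: eq_bigr => c _; rewrite mulr_sumr scaler_sumr.
Qed.
Lemma contr_suml i u (J : finType) (v : J -> 'I_N -> A) :
  contr i (fun c => \sum_j v j c) u = \sum_j contr i (v j) u.
Proof.
rewrite [RHS]exchange_big; apply: eq_bigr => b _; rewrite [RHS]exchange_big.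
by apply: eq_bigr => c _; rewrite mulr_suml scaler_sumr.
Qed.
Lemma pder_contr i mu u v : 'd_mu (contr i u v) =
  contr i (fun b => 'd_mu (u b)) v + contr i u (fun b => 'd_mu (v b)).
Proof.
rewrite pder_sum -big_split; apply: eq_bigr => b _; rewrite pder_sum -big_split.
by apply: eq_bigr => c _ /=; rewrite !pderE scalerDr.
Qed.
Definition contrE := (contrDr, contrZr, contrNr).

Lemma odd_anticomm (x y : A) : has_parity true x -> has_parity true y -> x * y = - (y * x).
Proof. by move=> px py; rewrite (mul_comm px py) scaleN1r. Qed.

Hypothesis asym : forall i b c, a i b c = a i c b.

Lemma contr_odd i (u v : 'I_N -> A) :
  (forall b, has_parity true (u b)) -> (forall b, has_parity true (v b)) ->
  contr i u v = - contr i v u.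
Proof.
move=> pu pv; rewrite /contr exchange_big -sumrN; apply: eq_bigr => b _ /=.
by rewrite -sumrN; apply: eq_bigr => c _; rewrite asym (odd_anticomm (pu c) (pv b)) scalerN.
Qed.
Lemma contr_self i (u : 'I_N -> A) : (forall b, has_parity true (u b)) -> contr i u u = 0.
Proof.
move=> pu; have h0 : contr i u u + contr i u u = 0 by rewrite {1}(contr_odd i pu pu) addNr.
have h2 : 2 *: contr i u u = 0 by rewrite -h0; lin.
by apply: (scalerI (a := 2 : R)); rewrite ?scaler0 // pnatr_eq0.
Qed.

Definition Fup i mu nu : A := \sum_b \sum_c a i b c *: lieU (xi b) (phi c) mu nu.
(* The coefficient of h^*_i in a1; it inverts the trace reversal h |-> phi, whence
   the division by n - 2. *)
Definition Tlow i mu nu : A :=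
  (ep mu * ep nu) *: ((n%:R - 2)^-1 *: (eta mu nu *: \sum_rho ep rho *: Fup i rho rho)
                     - Fup i mu nu).
Lemma TlowE i mu nu : Tlow i mu nu = (ep mu * ep nu) *:
  ((n%:R - 2)^-1 *: (eta mu nu *: \sum_rho ep rho *: Fup i rho rho) - Fup i mu nu).
Proof. by []. Qed.
(** For an odd vector field, its derivative along itself is half of its bracket with itself. [Zlow]
    and [Zup] are this half bracket with values in the internal algebra. *)
Definition Zlow i nu : A := \sum_al contr i (fun b => xi b al) (fun c => 'd_al (C c nu)).
Definition Zup i nu : A := \sum_al contr i (fun b => xi b al) (fun c => 'd_al (xi c nu)).

Lemma Zlow_up i nu : Zlow i nu = ep nu *: Zup i nu.
Proof.
rewrite /Zlow /Zup scaler_sumr; apply: eq_bigr => al _; rewrite -contrZr.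
by congr contr; apply: funext => c; rewrite C_xi pder_scale.
Qed.

(** By [gamma_lieU] and [gamma_phi] the left-hand side is minus an iterated Lie derivative of the
    Minkowski density. For one odd vector field the square of the Lie derivative is the Lie
    derivative along half the self-bracket; commutativity of the algebra carries this over to
    internal indices, with [Zup] as the half bracket. *)
Lemma gamma_Fup i mu nu : gamma (Fup i mu nu) =
  - (eta mu nu *: (\sum_rho 'd_rho (Zup i rho)) - ep mu *: 'd_mu (Zup i nu)
    - ep nu *: 'd_nu (Zup i mu)).
Proof.
have pxi mu' nu' b : has_parity true ('d_mu' (xi b nu')) by apply/pder_parity/xi_parity.
have pdxi b : has_parity true (@dxi R n N b) by apply: has_parity_sum => ?; exact: pxi.
pose X r m := fun b => 'd_r (xi b m).
have dZ m r : 'd_m (Zup i r) = \sum_al contr i (X m al) (X al r) +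
   \sum_al contr i (fun b => xi b al) (fun c => 'd_al ('d_m (xi c r))).
  rewrite pder_sum -big_split; apply: eq_bigr => al _; rewrite pder_contr; congr (_ + contr _ _ _).
  by apply: funext => c; rewrite pderC.
have -> : gamma (Fup i mu nu) = - \sum_rho (contr i (fun b => xi b rho) (fun c => 'd_rho (Lmet R c mu nu))
   + contr i (X rho rho) (fun c => Lmet R c mu nu) - contr i (X rho mu) (fun c => Lmet R c rho nu)
   - contr i (X rho nu) (fun c => Lmet R c mu rho)).
  rewrite gamma_sum /contr.
  under [in RHS]eq_bigr => rho _ do rewrite -!sumrN -!big_split.
  rewrite [in RHS]exchange_big -sumrN; apply: eq_bigr => b _ /=.
  under [in RHS]eq_bigr => rho _ do rewrite -!sumrN -!big_split.
  rewrite [in RHS]exchange_big -sumrN gamma_sum; apply: eq_bigr => c _ /=.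
  rewrite gamma_scale gamma_lieU scalerN; congr (- _); rewrite scaler_sumr.
  apply: eq_bigr => rho _; rewrite !gamma_phi /X; lin.
congr (- _).
have e1 : \sum_rho contr i (fun b => xi b rho) (fun c => 'd_rho (Lmet R c mu nu)) =
  eta mu nu *: (\sum_rho 'd_rho (Zup i rho)) -
  ep mu *: \sum_al contr i (fun b => xi b al) (fun c => 'd_al ('d_mu (xi c nu))) -
  ep nu *: \sum_al contr i (fun b => xi b al) (fun c => 'd_al ('d_nu (xi c mu))).
  have -> : \sum_rho 'd_rho (Zup i rho) =
    \sum_rho contr i (fun b => xi b rho) (fun c => 'd_rho (@dxi R n N c)).
    under eq_bigr => rho _ do rewrite dZ.
    rewrite big_split /= (_ : \sum_i0 \sum_al _ = 0) ?add0r.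
      rewrite exchange_big; apply: eq_bigr => al _ /=.
      by rewrite -contr_sumr; congr contr; apply: funext => c; rewrite /dxi pder_sum.
    set S := \sum__ _; have SN : S = - S.
      rewrite {1}/S exchange_big -sumrN; apply: eq_bigr => al _; rewrite -sumrN.
      by apply: eq_bigr => be _; rewrite (contr_odd i (pxi _ _) (pxi _ _)).
    have h2 : 2 *: S = 0.
      have -> : 2 *: S = S + S by lin.
      by rewrite {1}SN addNr.
    by apply: (scalerI (a := 2 : R)); rewrite ?scaler0 // pnatr_eq0.
  rewrite !scaler_sumr -!sumrN -!big_split; apply: eq_bigr => rho _ /=.
  by rewrite /Lmet -!contrE; congr contr; apply: funext => c; rewrite !pderE.
have e2 : \sum_rho contr i (X rho rho) (fun c => Lmet R c mu nu) =
  - ep mu *: contr i (@dxi R n N) (X mu nu) - ep nu *: contr i (@dxi R n N) (X nu mu).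
  rewrite -contr_suml -/(@dxi R n N) /Lmet !contrE contr_self // /X; by lin.
have e3 m r : \sum_rho contr i (X rho m) (fun c => Lmet R c rho r) =
  - ep r *: contr i (@dxi R n N) (X r m)
  - \sum_rho ep rho *: contr i (X rho m) (X rho r)
  + ep r *: \sum_rho contr i (X r rho) (X rho m).
  rewrite (_ : - ep r *: contr i _ _ = ep r *: contr i (X r m) (@dxi R n N)); last first.
    by rewrite (contr_odd i pdxi (pxi r m)) /X; lin.
  rewrite -[ep r *: contr i (X r m) (@dxi R n N)](sum_dl (fun rho => ep rho *: contr i (X rho m) (@dxi R n N)) r).
  rewrite scaler_sumr -!sumrN -!big_split; apply: eq_bigr => rho _ /=.
  by rewrite /Lmet !contrE etaE (dlC R rho) (contr_odd i (pxi r rho) (pxi _ _)) /X; lin.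
rewrite !big_split /= !sumrN e1 e2 e3.
have -> : \sum_i0 contr i (X i0 nu) (fun c => Lmet R c mu i0) =
   \sum_i0 contr i (X i0 nu) (fun c => Lmet R c i0 mu).
  apply: eq_bigr => rho _; congr contr; apply: funext => c.
  exact: LmetC.
rewrite e3 !dZ.
have -> : \sum_rho ep rho *: contr i (X rho nu) (X rho mu) =
   - \sum_rho ep rho *: contr i (X rho mu) (X rho nu).
  by rewrite -sumrN; apply: eq_bigr => rho _; rewrite (contr_odd i (pxi _ _) (pxi _ _)) scalerN.
by lin.
Qed.

(** By [gamma_Fup] the trace of [gamma (Fup i)] is 2 - n times the divergence of [Zup i]. The
    coefficient (n - 2)^-1 thus removes the term in [eta] and leaves a pure gauge transformation
    with parameter [Zlow i]. *)
Lemma gamma_Tlow i mu nu : n%:R - 2 != 0 :> R ->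
  gamma (Tlow i mu nu) = - ('d_mu (Zlow i nu) + 'd_nu (Zlow i mu)).
Proof.
move=> n2; have s1 : \sum_(rho < n) ep rho * ep rho = n%:R :> R.
  by under eq_bigr => rho _ do rewrite ep2; rewrite sumr_const card_ord.
pose D := \sum_rho 'd_rho (Zup i rho).
have -> : gamma (Tlow i mu nu) = (ep mu * ep nu) *:
   ((n%:R - 2)^-1 *: (eta mu nu *: ((2 - n%:R) *: D)) - gamma (Fup i mu nu)).
  rewrite !gammaE; congr (_ *: (_ *: (_ *: _) - _)).
  rewrite -s1 scalerBl scaler_suml /D scaler_sumr -sumrN -big_split; apply: eq_bigr => rho _ /=.
  rewrite gamma_scale gamma_Fup etaE dlxx -/D.
  transitivity ((2 * (ep rho * ep rho)) *: 'd_rho (Zup i rho) - (ep rho * ep rho) *: D);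
    first by lin.
  by rewrite ep2 mulr1.
rewrite gamma_Fup -/D !Zlow_up !pder_scale.
transitivity (((ep mu * ep nu) * ((n%:R - 2)^-1 * (eta mu nu * (2 - n%:R)) + eta mu nu)) *: D
  - ((ep mu * ep mu * ep nu) *: 'd_mu (Zup i nu) + (ep nu * ep nu * ep mu) *: 'd_nu (Zup i mu))).
  by lin.
rewrite !ep2 !mul1r [X in X *: D](_ : _ = 0) ?scale0r ?add0r //.
by field.
Qed.

Definition DH i be : A := \sum_ga 'd_ga (hs i ga be).

Definition a1_main : A := \sum_i \sum_mu \sum_nu hs i mu nu * Tlow i mu nu.
(** After integration by parts, [gamma a1_main] pairs [DH] with xi^al d_al C_be, whereas [delta_a2]
    pairs it with xi^al d_be C_al. The two derivatives of C add up to [gamma] of h_{al be}, whence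
    this correction; its factor 2 in [def_a1] is that of [delta] on C^*. The second equation does
    not see it, by [noether]. *)
Definition a1_extra : A := \sum_i \sum_b \sum_c \sum_al \sum_be
  a i b c *: (DH i be * xi b al * h c al be).
Definition def_a1 : A := a1_main + 2 *: a1_extra.

Lemma DH_parity i be : has_parity true (DH i be).
Proof. by apply: has_parity_sum => ga; apply/pder_parity/hs_parity. Qed.
Lemma gamma_DH i be : gamma (DH i be) = 0.
Proof. by rewrite gamma_sum big1 // => ga _; rewrite gamma_pder gamma_hsf pder0. Qed.

Lemma delta_zero : delta k (0 : A) = 0.
Proof. by have := delta_scale k 0 (0 : A); rewrite !scale0r. Qed.
Lemma deltaN (x : A) : delta k (- x) = - delta k x.
Proof. by rewrite -scaleN1r delta_scale scaleN1r. Qed.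
Lemma delta_sum (J : Type) (s : seq J) (P : pred J) (F : J -> A) :
  delta k (\sum_(i <- s | P i) F i) = \sum_(i <- s | P i) delta k (F i).
Proof. exact: (big_morph _ (@delta_add R n N k) delta_zero). Qed.
Definition deltaE := (delta_add, deltaN, delta_scale, delta_pder, delta_sum).
Lemma delta_mul0 (x y : A) : delta k y = 0 -> delta k (x * y) = delta k x * y.
Proof. by move=> y0; rewrite delta_mul y0 mulr0 addr0. Qed.

Lemma delta_xi b mu : delta k (xi b mu) = 0.
Proof. by rewrite xiE delta_scale delta_Cf scaler0. Qed.

Lemma delta_a2 : delta k (a2 n a) = \sum_i \sum_be
  (- 2) *: (DH i be * \sum_al contr i (fun b => xi b al) (fun c => 'd_be (C c al))).
Proof.
rewrite delta_sum; apply: eq_bigr => i _.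
pose u b c al be := a i b c *: (DH i be * (xi b al * 'd_be (C c al))).
transitivity (\sum_b \sum_c \sum_al \sum_be (- 2) *: u b c al be).
  rewrite delta_sum; apply: eq_bigr => b _; rewrite delta_sum; apply: eq_bigr => c _.
  rewrite delta_sum; apply: eq_bigr => al _; rewrite delta_sum; apply: eq_bigr => be _.
  rewrite delta_scale -mulrA raiseE -xiE delta_mul.
  rewrite (delta_mul0 (xi b al)) ?delta_pder ?delta_Cf ?pder0 //.
  rewrite delta_xi mul0r mulr0 addr0 delta_Csf -/(DH i be) /u -scalerAl; lin.
have -> : \sum_be -2 *: (DH i be * \sum_al contr i (fun b => xi b al) (fun c => 'd_be (C c al)))
  = \sum_be \sum_b \sum_c \sum_al (- 2) *: u b c al be.
  apply: eq_bigr => be _; rewrite mulr_sumr scaler_sumr.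
  under eq_bigr => al _ do rewrite /contr mulr_sumr scaler_sumr.
  rewrite exchange_big; apply: eq_bigr => b _ /=.
  under eq_bigr => al _ do rewrite mulr_sumr scaler_sumr.
  rewrite exchange_big; apply: eq_bigr => c _ /=; apply: eq_bigr => al _.
  by rewrite -scalerAr.
rewrite [RHS]exchange_big; apply: eq_bigr => b _ /=.
rewrite [RHS]exchange_big; apply: eq_bigr => c _ /=.
by rewrite [RHS]exchange_big.
Qed.

Lemma gamma_a1_extra : gamma a1_extra = \sum_i \sum_be DH i be *
  \sum_al (contr i (fun b => xi b al) (fun c => 'd_be (C c al)) +
           contr i (fun b => xi b al) (fun c => 'd_al (C c be))).
Proof.
rewrite gamma_sum; apply: eq_bigr => i _.
pose u b c al be := a i b c *: (DH i be * (xi b al * ('d_be (C c al) + 'd_al (C c be)))).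
transitivity (\sum_b \sum_c \sum_al \sum_be u b c al be).
  rewrite gamma_sum; apply: eq_bigr => b _; rewrite gamma_sum; apply: eq_bigr => c _.
  rewrite gamma_sum; apply: eq_bigr => al _; rewrite gamma_sum; apply: eq_bigr => be _.
  rewrite gamma_scale -mulrA (gamma_mul_odd _ (DH_parity i be) (gamma_DH i be)).
  by rewrite (gamma_mul_odd _ (xi_parity _ b al) (gamma_xi _ b al)) gamma_hf mulrN opprK addrC.
have -> : \sum_be DH i be *
  \sum_al (contr i (fun b => xi b al) (fun c => 'd_be (C c al)) +
           contr i (fun b => xi b al) (fun c => 'd_al (C c be)))
  = \sum_be \sum_b \sum_c \sum_al u b c al be.
  apply: eq_bigr => be _; rewrite mulr_sumr.
  under eq_bigr => al _ do rewrite -contrDr /contr mulr_sumr.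
  rewrite exchange_big; apply: eq_bigr => b _ /=.
  under eq_bigr => al _ do rewrite mulr_sumr.
  rewrite exchange_big; apply: eq_bigr => c _ /=; apply: eq_bigr => al _.
  by rewrite -scalerAr.
rewrite [RHS]exchange_big; apply: eq_bigr => b _ /=.
rewrite [RHS]exchange_big; apply: eq_bigr => c _ /=.
by rewrite [RHS]exchange_big.
Qed.

Lemma hsC i mu nu : hs i mu nu = hs i nu mu :> A.
Proof. by case: (var_sym R i mu nu [ffun=> 0%N]). Qed.

Lemma first_descent : n%:R - 2 != 0 :> R ->
  total_div (delta k (a2 n a) + gamma def_a1).
Proof.
move=> n2; rewrite (_ : _ + _ = \sum_i 2 *: \sum_mu 'd_mu (\sum_nu hs i mu nu * Zlow i nu)).
  by apply: total_div_sum => i; apply: total_divZ; eexists.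
have gm : gamma a1_main = \sum_i 2 *: \sum_mu \sum_nu hs i mu nu * 'd_mu (Zlow i nu).
  rewrite gamma_sum; apply: eq_bigr => i _.
  transitivity (S2 (fun mu nu => hs i mu nu * 'd_mu (Zlow i nu) + hs i mu nu * 'd_nu (Zlow i mu))).
    rewrite gamma_sum; apply: eq_bigr => mu _; rewrite gamma_sum; apply: eq_bigr => nu _.
    rewrite (gamma_mul_odd _ (hs_parity _ i mu nu)) ?gamma_hsf // gamma_Tlow //.
    by rewrite mulrN opprK mulrDr.
  rewrite S2D [X in _ + X]S2C.
  have -> : S2 (fun nu mu => hs i mu nu * 'd_nu (Zlow i mu)) =
            S2 (fun mu nu => hs i mu nu * 'd_mu (Zlow i nu)).
    by apply: S2_eq => mu nu; rewrite hsC.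
  rewrite -/(S2 _); lin.
rewrite /def_a1 gamma_add gamma_scale delta_a2 gamma_a1_extra gm scaler_sumr -!big_split.
apply: eq_bigr => i _ /=.
have -> : \sum_mu 'd_mu (\sum_nu hs i mu nu * Zlow i nu) =
   \sum_nu DH i nu * Zlow i nu + \sum_mu \sum_nu hs i mu nu * 'd_mu (Zlow i nu).
  transitivity (S2 (fun mu nu => 'd_mu (hs i mu nu) * Zlow i nu + hs i mu nu * 'd_mu (Zlow i nu))).
    by apply: eq_bigr => mu _; rewrite pder_sum; apply: eq_bigr => nu _; rewrite pder_mul.
  rewrite S2D S2C -!/(S2 _); congr (_ + _); apply: eq_bigr => nu _.
  by rewrite /DH mulr_suml.
set Y := \sum_be DH i be * \sum_al (_ + _); set X := \sum_be -2 *: _.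
have e : \sum_nu DH i nu * Zlow i nu = Y + 2^-1 *: X.
  rewrite /X /Y scaler_sumr -big_split; apply: eq_bigr => be _ /=.
  by rewrite big_split mulrDr -/(Zlow i be) /=; lin.
by rewrite e; lin.
Qed.
End FirstOrderDeformation.

(** * The second descent equation *)

Section SecondDescent.
Variables (R : realType) (n N : nat).
Local Notation A := (locfun R n N).
Local Notation I := 'I_n.
Local Notation ep := (ep R).
Local Notation phi := (@phi R n N).
Local Notation Gm := (@Gm R n N).
Local Notation xi := (@xi R n N).
Local Notation eta := (Defs.eta R n).
Variables (k : 'M[R]_N) (a : 'I_N -> 'I_N -> 'I_N -> R).
Local Notation Tlow := (@Tlow R n N a).
Local Notation Fup := (@Fup R n N a).
Local Notation a1_main := (@a1_main R n N a).
Local Notation a1_extra := (@a1_extra R n N a).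
Local Notation def_a1 := (@def_a1 R n N a).

Definition def_a0 : A := 2 *: \sum_p \sum_q \sum_r lower k a p q r *:
  \sum_mu \sum_nu phi p mu nu * bb (Gm q) (Gm r) mu nu.

Hypotheses (ks : k^T = k) (n2 : n%:R - 2 != 0 :> R).

Lemma delta_h b mu nu : delta k (hf R b mu nu : A) = 0.
Proof. exact: delta_hf. Qed.
Lemma delta_phi b mu nu : delta k (phi b mu nu) = 0.
Proof.
rewrite phiE trD !deltaE delta_h (big1 _ (fun _ => true)) ?scaler0 ?subr0 // => rho _.
by rewrite delta_scale delta_h scaler0.
Qed.
Lemma delta_Fup i mu nu : delta k (Fup i mu nu) = 0.
Proof.
have dx (x y : A) : delta k x = 0 -> delta k y = 0 -> delta k (x * y) = 0.
  by move=> x0 y0; rewrite delta_mul0 // x0 mul0r.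
rewrite delta_sum big1 // => b _; rewrite delta_sum big1 // => c _.
rewrite delta_scale /lieU delta_sum big1 ?scaler0 // => rho _.
by rewrite !deltaE !dx ?delta_pder ?delta_xi ?delta_phi ?pder0 // !(addr0, subr0).
Qed.
Lemma delta_Tlow i mu nu : delta k (Tlow i mu nu) = 0.
Proof.
rewrite TlowE delta_scale delta_add deltaN !delta_scale delta_Fup delta_sum big1 ?scaler0 ?subr0 ?scaler0 // => rho _.
by rewrite delta_scale delta_Fup scaler0.
Qed.

Lemma delta_a1_extra : delta k a1_extra = 0.
Proof.
rewrite delta_sum big1 // => i _; rewrite delta_sum big1 // => b _; rewrite delta_sum big1 // => c _.
rewrite delta_sum big1 // => al _; rewrite delta_sum big1 // => be _.
rewrite delta_scale delta_mul0 ?delta_h // delta_mul0 ?delta_xi //.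
rewrite delta_sum (_ : \sum_ga _ = 0) ?mul0r ?scaler0 //.
rewrite -[RHS](noether i be ks); apply: eq_bigr => ga _.
by rewrite delta_pder delta_hsf.
Qed.

(** This identity dictates the form of [Tlow]: the antifields produce Einstein tensors under
    [delta], and pairing them with a trace-reversed F amounts to pairing Ricci tensors with F
    itself. *)
Lemma trace_reverse (X F : I -> I -> A) :
  \sum_mu \sum_nu (eta mu nu *: (\sum_rho ep rho *: X rho rho) - (2 * ep mu * ep nu) *: X mu nu)
    * ((ep mu * ep nu) *: ((n%:R - 2)^-1 *: (eta mu nu *: \sum_rho ep rho *: F rho rho) - F mu nu))
  = 2 *: \sum_mu \sum_nu X mu nu * F mu nu.
Proof.
set trX := \sum_rho _ *: X _ _; set trF := \sum_rho _ *: F _ _.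
have s1 : \sum_(rho < n) ep rho * ep rho = n%:R :> R.
  by under eq_bigr => rho _ do rewrite ep2; rewrite sumr_const card_ord.
(* Zero is added as three multiples of the product of traces, to match the three trace terms of the
   expanded left-hand side. *)
have -> : 2 *: (\sum_mu \sum_nu X mu nu * F mu nu) = 2 *: (\sum_mu \sum_nu X mu nu * F mu nu)
  + ((n%:R - 2)^-1 * n%:R) *: (trX * trF) - trX * trF - (2 * (n%:R - 2)^-1) *: (trX * trF).
  transitivity (2 *: (\sum_mu \sum_nu X mu nu * F mu nu) +
    (((n%:R - 2)^-1 * n%:R) - 1 - 2 * (n%:R - 2)^-1) *: (trX * trF)); last by lin.
  by rewrite [X in X *: (trX * _)](_ : _ = 0) ?scale0r ?addr0 //; field.
have -> : ((n%:R - 2)^-1 * n%:R) *: (trX * trF) =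
    \sum_(mu < n) \sum_(nu < n) dl R mu nu *: ((n%:R - 2)^-1 *: (trX * trF)).
  under eq_bigr => mu _ do rewrite sum_dl.
  by rewrite sumr_const card_ord -scaler_nat; lin.
have e1 : trX * trF = \sum_mu \sum_nu dl R mu nu *: (ep nu *: (trX * F mu nu)).
  by rewrite mulr_sumr; apply: eq_bigr => mu _; rewrite sum_dl -scalerAr.
have e2 : trX * trF = \sum_mu \sum_nu dl R mu nu *: (ep nu *: (X mu nu * trF)).
  by rewrite mulr_suml; apply: eq_bigr => mu _; rewrite sum_dl -scalerAl.
rewrite {2}e1 {2}e2.
rewrite -!/(S2 _) -!S2E; apply: S2_eq => mu nu.
rewrite !(mulrBl, mulrBr, =^~ scalerAl, =^~ scalerAr) etaE.
have [<-|/negPf mn] := eqVneq mu nu.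
  by rewrite dlxx; case: (ep_pm R mu) => ->; lin.
have -> : dl R mu nu = 0 by rewrite /dl mn.
case: (ep_pm R mu) => ->; case: (ep_pm R nu) => ->; lin.
Qed.

Hypotheses (laC12 : forall p q r, lower k a p q r = lower k a q p r)
           (laC23 : forall p q r, lower k a p q r = lower k a p r q).

Lemma ric_central b mu nu : central (ric (Gm b) mu nu).
Proof.
apply: even_central; apply: has_parity_add.
  by apply: has_parity_sum => al; apply/pder_parity/Gm_parity.
by apply/has_parity_opp/pder_parity/has_parity_sum => al; apply: Gm_parity.
Qed.

Lemma delta_a1_main : delta k a1_main = 2 *: \sum_p \sum_q \sum_r
  lower k a p q r *: \sum_mu \sum_nu lieU (xi p) (phi q) mu nu * ric (Gm r) mu nu.
Proof.
pose X d b c := \sum_mu \sum_nu ric (Gm d) mu nu * lieU (xi b) (phi c) mu nu.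
have -> : delta k a1_main = \sum_i \sum_d k i d *: (2 *: \sum_b \sum_c a i b c *: X d b c).
  rewrite delta_sum; apply: eq_bigr => i _.
  transitivity (\sum_d k i d *: (2 *: \sum_mu \sum_nu ric (Gm d) mu nu * Fup i mu nu)).
    transitivity (\sum_mu \sum_nu \sum_d k i d *: ((eta mu nu *: Rs R n d -
       (2 * ep mu * ep nu) *: ric (Gm d) mu nu) * Tlow i mu nu)).
      rewrite delta_sum; apply: eq_bigr => mu _; rewrite delta_sum; apply: eq_bigr => nu _.
      rewrite delta_mul0 ?delta_Tlow // delta_hsf euler_lagrangian // mulr_suml.
      by apply: eq_bigr => d _; rewrite -scalerAl.
    under eq_bigr => mu _ do rewrite exchange_big.
    rewrite exchange_big; apply: eq_bigr => d _ /=; rewrite -trace_reverse scaler_sumr.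
    by apply: eq_bigr => mu _; rewrite scaler_sumr.
  apply: eq_bigr => d _; congr (_ *: (_ *: _)).
  transitivity (\sum_mu \sum_nu \sum_b \sum_c
     a i b c *: (ric (Gm d) mu nu * lieU (xi b) (phi c) mu nu)).
    apply: eq_bigr => mu _; apply: eq_bigr => nu _; rewrite mulr_sumr.
    apply: eq_bigr => b _; rewrite mulr_sumr; apply: eq_bigr => c _.
    by rewrite -scalerAr.
  under eq_bigr => mu _ do rewrite exchange_big.
  rewrite exchange_big; apply: eq_bigr => b _ /=.
  under eq_bigr => mu _ do rewrite exchange_big.
  rewrite exchange_big; apply: eq_bigr => c _ /=.
  by rewrite scaler_sumr; apply: eq_bigr => mu _; rewrite scaler_sumr.
rewrite exchange_big /=.
have -> : \sum_p \sum_q \sum_r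
  lower k a p q r *: \sum_mu \sum_nu lieU (xi p) (phi q) mu nu * ric (Gm r) mu nu =
  \sum_d \sum_b \sum_c lower k a d b c *: X d b c.
  rewrite -!/(S3 _) [RHS]S3_213 [RHS]S3_132; apply: S3_eq => p q r.
  congr (_ *: _); first by rewrite laC23 laC12.
  by do 2 apply: eq_bigr => ? _; rewrite ric_central.
rewrite scaler_sumr; apply: eq_bigr => d _.
transitivity (\sum_i \sum_b \sum_c (2 * k d i * a i b c) *: X d b c).
  apply: eq_bigr => i _; rewrite -{1}ks mxE !scaler_sumr; apply: eq_bigr => b _.
  by rewrite !scaler_sumr; apply: eq_bigr => c _; lin.
rewrite exchange_big scaler_sumr; apply: eq_bigr => b _ /=.
rewrite exchange_big scaler_sumr; apply: eq_bigr => c _ /=.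
rewrite -scaler_suml scalerA /lower mulr_sumr; congr (_ *: _).
by apply: eq_bigr => i _; rewrite mulrA.
Qed.

(** Total symmetry of the lowered constants is used to rename the internal indices so that the ghost
    always carries the first one, the shape required by [vertex_invariance]. *)
Lemma gamma_def_a0 : gamma def_a0 = 2 *: \sum_p \sum_q \sum_r lower k a p q r *:
  \sum_mu \sum_nu (Lmet R p mu nu * bb (Gm q) (Gm r) mu nu
   + phi q mu nu * (bb (hess (xi p)) (Gm r) mu nu + bb (Gm r) (hess (xi p)) mu nu)).
Proof.
rewrite gamma_scale; congr (_ *: _).
pose X (p q r : 'I_N) : A := \sum_mu \sum_nu Lmet R p mu nu * bb (Gm q) (Gm r) mu nu.
pose Y p q r := \sum_mu \sum_nu phi p mu nu * bb (hess (xi q)) (Gm r) mu nu.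
pose Z p q r := \sum_mu \sum_nu phi p mu nu * bb (Gm q) (hess (xi r)) mu nu.
transitivity (S3 (fun p q r => lower k a p q r *: X p q r + lower k a p q r *: Y p q r
   + lower k a p q r *: Z p q r)).
  rewrite gamma_sum; apply: eq_bigr => p _; rewrite gamma_sum; apply: eq_bigr => q _.
  rewrite gamma_sum; apply: eq_bigr => r _; rewrite gamma_scale -!scalerDr; congr (_ *: _).
  rewrite gamma_sum -!big_split; apply: eq_bigr => mu _ /=.
  rewrite gamma_sum -!big_split; apply: eq_bigr => nu _ /=.
  by rewrite (gamma_mul_even _ (phi_parity _ _ _ _)) gamma_phi gamma_bb mulrDr addrA.
transitivity (S3 (fun p q r => lower k a p q r *: X p q r + lower k a p q r *: Y q p r
   + lower k a p q r *: Z q r p)).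
  rewrite !S3D; congr (_ + _ + _).
    by rewrite [LHS]S3_213; apply: S3_eq => p q r; rewrite laC12.
  rewrite [LHS]S3_132 [LHS]S3_213; apply: S3_eq => p q r.
  by rewrite laC23 laC12.
apply: S3_eq => p q r; rewrite -!scalerDr; congr (_ *: _).
rewrite -!big_split; apply: eq_bigr => mu _ /=.
rewrite -!big_split; apply: eq_bigr => nu _ /=.
by rewrite mulrDr addrA.
Qed.

Lemma second_descent : total_div (delta k def_a1 + gamma def_a0).
Proof.
rewrite delta_add delta_scale delta_a1_extra scaler0 addr0 delta_a1_main gamma_def_a0.
rewrite -scalerDr; apply: total_divZ.
rewrite [X in total_div X](_ : _ = \sum_p \sum_q \sum_r lower k a p q r *: \sum_mu \sum_nu
    (lieU (xi p) (phi q) mu nu * ric (Gm r) mu nu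
     + Lmet R p mu nu * bb (Gm q) (Gm r) mu nu
     + phi q mu nu * (bb (hess (xi p)) (Gm r) mu nu + bb (Gm r) (hess (xi p)) mu nu))).
  exact: vertex_invariance.
rewrite -!/(S3 _) -S3D; apply: S3_eq => p q r; rewrite -scalerDr; congr (_ *: _).
rewrite -!big_split; apply: eq_bigr => mu _ /=.
by rewrite -!big_split; apply: eq_bigr => nu _ /=; rewrite addrA.
Qed.

End SecondDescent.

(** * Lorentz invariance *)

Section LorentzCovariance.
Variables (R : realType) (n N : nat).
Local Notation A := (locfun R n N).
Local Notation I := 'I_n.
Local Notation "'d_ mu" := (@pder R n N mu) (at level 8, mu at level 2, format "''d_' mu").
Local Notation ep := (ep R).
Local Notation eta := (Defs.eta R n).
Local Notation phi := (@phi R n N).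
Local Notation Gm := (@Gm R n N).
Local Notation xi := (@xi R n N).

Variable L : 'M[R]_n.
Hypothesis Lpo : proper_orthochronous L.
Local Notation lor := (@lorentz R n N L).

Definition Lo (i j : I) : R := L i j.
(** For a Lorentz matrix this is the contragredient one ([invLT]); in this form, raising and
    lowering indices by signs visibly commutes with the action. *)
Definition Up (i j : I) : R := ep i * L i j * ep j.

Definition dual (J : finType) (K K' : J -> J -> R) :=
  forall i j, \sum_l K l i * K' l j = (i == j)%:R.

Lemma etaD : eta = diag_mx (\row_i ep i).
Proof.
apply/matrixP => i j; rewrite etaE !mxE /dl; case: eqP => [->|_]; by rewrite ?mulr1 ?mulr1n ?mulr0 ?mulr0n.
Qed.
Lemma eta2 : eta *m eta = 1%:M.
Proof.
apply/matrixP => i j; rewrite {1}etaD mul_diag_mx mxE etaE [(\row__ _) _ _]mxE mulrA ep2 mul1r mxE.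
by rewrite /dl; case: eqP.
Qed.
Lemma UpE : (\matrix_(i, j) Up i j) = eta *m L *m eta.
Proof.
apply/matrixP => i j; rewrite {1}etaD mul_diag_mx etaD mul_mx_diag !mxE.
by rewrite /Up /ep /Defs.eta !mxE.
Qed.
Lemma invL : invmx L = eta *m L^T *m eta.
Proof.
case: Lpo => h1 h2 _.
have h : L *m (eta *m L^T *m eta) = 1%:M by rewrite !mulmxA h1 eta2.
have Lu : L \in unitmx by rewrite unitmxE h2 unitr1.
by have := congr1 (mulmx (invmx L)) h; rewrite mulmx1 (mulmxA (invmx L) L) (mulVmx Lu) mul1mx => <-.
Qed.
Lemma eta_tr : eta^T = eta.
Proof. by rewrite etaD tr_diag_mx. Qed.
Lemma invLT : (invmx L)^T = \matrix_(i, j) Up i j.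
Proof. by rewrite invL UpE !trmx_mul trmxK !eta_tr mulmxA. Qed.
Lemma dual_ul : dual Up Lo.
Proof.
case: Lpo => h1 h2 _ i j.
have Lu : L \in unitmx by rewrite unitmxE h2 unitr1.
have := congr1 (fun X : 'M_n => X i j) (mulVmx Lu); rewrite !mxE => <-.
apply: eq_bigr => l _; congr (_ * _).
have := congr1 (fun X : 'M_n => X l i) invLT; rewrite !mxE => ->; by [].
Qed.
Lemma dual_lu : dual Lo Up.
Proof.
move=> i j; rewrite eq_sym -dual_ul; apply: eq_bigr => l _; exact: mulrC.
Qed.
Lemma Lo_eta i j : \sum_a \sum_b Lo i a * Lo j b * eta a b = eta i j.
Proof.
case: Lpo => h1 _ _; rewrite -[in RHS]h1 mxE exchange_big; apply: eq_bigr => b _ /=.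
rewrite !mxE mulr_suml; apply: eq_bigr => a _; rewrite /Lo; ring.
Qed.
Lemma Up_eta i j : \sum_a \sum_b Up i a * Up j b * eta a b = eta i j.
Proof.
have -> : eta i j = ep i * ep j * eta i j.
  by rewrite etaE /dl; case: eqP => [<-|_]; rewrite ?mulr0 // ep2 mul1r.
rewrite -[in RHS](Lo_eta i j) mulr_sumr; apply: eq_bigr => a _.
rewrite mulr_sumr; apply: eq_bigr => b _.
rewrite /Up /Lo etaE /dl; case: eqP => [<-|_]; last by rewrite !mulr0.
rewrite -[in RHS](mul1r (ep a)) -(ep2 R a); ring.
Qed.

Lemma lor0 : lor 0 = 0.
Proof. by have := lorentz_scale L 0 (0 : A); rewrite !scale0r. Qed.
Lemma lor_sum (J : Type) (s : seq J) (P : pred J) (F : J -> A) :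
  lor (\sum_(i <- s | P i) F i) = \sum_(i <- s | P i) lor (F i).
Proof. exact: (big_morph _ (@lorentz_add R n N L) lor0). Qed.

Lemma lorentz_pderC mu nu (x : A) :
  lorentz_pder L mu (lorentz_pder L nu x) = lorentz_pder L nu (lorentz_pder L mu x).
Proof.
rewrite /lorentz_pder; under eq_bigr => r _ do rewrite pder_sum scaler_sumr.
rewrite exchange_big; apply: eq_bigr => s _ /=; rewrite pder_sum scaler_sumr.
by apply: eq_bigr => r _; rewrite !pder_scale (pderC r s); lin.
Qed.
Lemma lor_pder mu x : lor ('d_mu x) = \sum_nu Lo mu nu *: 'd_nu (lor x).
Proof.
rewrite -/(lorentz_pder L mu (lor x)).
pattern x; move: x; apply: loc_elim => [c|v|x y hx hy|x y hx hy].
- rewrite pder_cst lor0 /lorentz_pder big1 // => nu _.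
  have -> : lor c%:A = c%:A by exact: (subst_cst (lorentz_comm L) (lorentz_sym L)).
  by rewrite pder_cst scaler0.
- rewrite pder_var !lorentz_var /lorentz_jet /= iterD_incr //; exact: lorentz_pderC.
- rewrite pder_add !lorentz_add hx hy /lorentz_pder -big_split; apply: eq_bigr => nu _.
  by rewrite pder_add scalerDr.
- rewrite pder_mul lorentz_add !lorentz_mul hx hy /lorentz_pder mulr_suml mulr_sumr -big_split.
  by apply: eq_bigr => nu _ /=; rewrite pder_mul -scalerAl -scalerAr scalerDr.
Qed.

Definition cov1 (J : finType) (K : J -> J -> R) (X : J -> A) :=
  forall i, lor (X i) = \sum_a K i a *: X a.
Definition cov2 (J J' : finType) (K : J -> J -> R) (K' : J' -> J' -> R)
    (X : J -> J' -> A) :=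
  forall i j, lor (X i j) = \sum_a \sum_b (K i a * K' j b) *: X a b.
Definition cov3 (J J' J'' : finType) (K : J -> J -> R) (K' : J' -> J' -> R)
    (K'' : J'' -> J'' -> R) (X : J -> J' -> J'' -> A) :=
  forall i j l, lor (X i j l) =
    \sum_a \sum_b \sum_c (K i a * K' j b * K'' l c) *: X a b c.
(** Index tuples are treated as single indices over a product type, and [k1] pads a missing index
    with the unit type. In this way the rank-two contraction lemmas serve tensors of every rank. *)
Definition kron (J J' : finType) (K : J -> J -> R) (K' : J' -> J' -> R) (p q : J * J') :=
  K p.1 q.1 * K' p.2 q.2.
Definition k1 (i j : unit) : R := 1.

Lemma dual_kron (J J' : finType) (K K1 : J -> J -> R) (K' K1' : J' -> J' -> R) :
  dual K K1 -> dual K' K1' -> dual (kron K K') (kron K1 K1').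
Proof.
move=> d1 d2 [i i'] [j j']; rewrite /kron /= xpair_eqE.
rewrite -(pair_bigA _ (fun l l' => K l i * K' l' i' * (K1 l j * K1' l' j'))) /=.
under eq_bigr => l _.
  under eq_bigr => l' _ do rewrite mulrACA.
  rewrite -mulr_sumr d2; over.
by rewrite -mulr_suml d1 -natrM mulnb.
Qed.

Lemma sum_unit (F : unit -> A) : \sum_i F i = F tt.
Proof. by rewrite (bigD1 tt) //= big1 ?addr0 // => -[]. Qed.

Section Tensors.
Variables (J J1 J2 : finType) (K K' : J -> J -> R) (K1 : J1 -> J1 -> R) (K2 : J2 -> J2 -> R).

Lemma cov2_1 X : cov1 K X <-> cov2 K k1 (fun i _ => X i).
Proof.
split=> h i => [j|].
  by rewrite h; apply: eq_bigr => a _; rewrite sum_unit mulr1.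
by rewrite (h i tt); apply: eq_bigr => a _; rewrite sum_unit mulr1.
Qed.
Lemma cov2_1' X : cov1 K X <-> cov2 k1 K (fun _ i => X i).
Proof.
split=> h i => [j|].
  by rewrite h sum_unit; apply: eq_bigr => a _; rewrite mul1r.
by rewrite (h tt i) sum_unit; apply: eq_bigr => a _; rewrite mul1r.
Qed.
Lemma cov2C X : cov2 K K1 X -> cov2 K1 K (fun i j => X j i).
Proof.
move=> h i j; rewrite h exchange_big; apply: eq_bigr => a _; apply: eq_bigr => b _.
by rewrite mulrC.
Qed.
Lemma cov2D X Y : cov2 K K1 X -> cov2 K K1 Y -> cov2 K K1 (fun i j => X i j + Y i j).
Proof.
move=> hX hY i j; rewrite lorentz_add hX hY -big_split; apply: eq_bigr => a _.
by rewrite -big_split; apply: eq_bigr => b _; rewrite scalerDr.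
Qed.
Lemma cov2Z c X : cov2 K K1 X -> cov2 K K1 (fun i j => c *: X i j).
Proof.
move=> hX i j; rewrite lorentz_scale hX scaler_sumr; apply: eq_bigr => a _.
by rewrite scaler_sumr; apply: eq_bigr => b _; rewrite !scalerA mulrC.
Qed.
Lemma cov2N X : cov2 K K1 X -> cov2 K K1 (fun i j => - X i j).
Proof.
by move=> /(cov2Z (-1)) h i j; rewrite -scaleN1r h; do 2 apply: eq_bigr => ? _;
  rewrite scaleN1r.
Qed.
Lemma cov2_sum (T : Type) (s : seq T) (X : T -> J -> J1 -> A) :
  (forall t, cov2 K K1 (X t)) -> cov2 K K1 (fun i j => \sum_(t <- s) X t i j).
Proof.
move=> h i j; rewrite lor_sum; under eq_bigr => t _ do rewrite h.
rewrite exchange_big; apply: eq_bigr => a _; rewrite exchange_big; apply: eq_bigr => b _ /=.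
by rewrite scaler_sumr.
Qed.
Lemma cov2_inv (x : A) X : lor x = x -> cov2 K K1 X -> cov2 K K1 (fun i j => x * X i j).
Proof.
move=> hx hX i j; rewrite lorentz_mul hx hX mulr_sumr; apply: eq_bigr => a _.
by rewrite mulr_sumr; apply: eq_bigr => b _; rewrite scalerAr.
Qed.
Lemma cov3_2 (X : J -> J1 -> J2 -> A) : cov3 K K1 K2 X ->
  cov2 K (kron K1 K2) (fun i p => X i p.1 p.2).
Proof.
move=> h i [j l]; rewrite h; apply: eq_bigr => a _ /=; rewrite pair_bigA /=.
by apply: eq_bigr => p _; rewrite /kron mulrA.
Qed.
Lemma cov3_2' (X : J -> J1 -> J2 -> A) : cov3 K K1 K2 X ->
  cov2 (kron K K1) K2 (fun p i => X p.1 p.2 i).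
Proof. by move=> h [i j] l; rewrite h pair_bigA /=. Qed.
Lemma cov2_3 (X : J -> J1 -> J2 -> A) : cov2 K (kron K1 K2) (fun i p => X i p.1 p.2) ->
  cov3 K K1 K2 X.
Proof.
move=> h i j l; rewrite (h i (j, l)); apply: eq_bigr => a _ /=; rewrite pair_bigA /=.
by apply: eq_bigr => p _; rewrite /kron mulrA.
Qed.
Lemma cov2_pair X : cov2 K K1 X <-> cov1 (kron K K1) (fun p => X p.1 p.2).
Proof.
by split=> h; [move=> [i j] | move=> i j]; rewrite ?h ?(h (i, j)) pair_bigA.
Qed.

Hypothesis KK : dual K K'.

Lemma contract (X Y : J -> A) :
  \sum_j (\sum_a K j a *: X a) * (\sum_b K' j b *: Y b) = \sum_a X a * Y a.
Proof.
transitivity (\sum_j \sum_a \sum_b (K j a * K' j b) *: (X a * Y b)).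
  apply: eq_bigr => j _; rewrite mulr_suml; apply: eq_bigr => a _; rewrite mulr_sumr.
  by apply: eq_bigr => b _; rewrite -scalerAl -scalerAr scalerA.
rewrite exchange_big; apply: eq_bigr => a _ /=; rewrite exchange_big /=.
transitivity (\sum_b (a == b)%:R *: (X a * Y b)).
  by apply: eq_bigr => b _; rewrite -KK scaler_suml.
rewrite (bigD1 a) //= eqxx scale1r big1 ?addr0 // => b /negPf.
by rewrite eq_sym => ->; rewrite scale0r.
Qed.

Lemma cdot X Y : cov2 K K1 X -> cov2 K' K2 Y ->
  cov2 K1 K2 (fun i j => \sum_l X l i * Y l j).
Proof.
move=> hX hY i j; rewrite lor_sum.
transitivity (\sum_b \sum_d (K1 i b * K2 j d) *: \sum_l
    ((\sum_a K l a *: X a b) * (\sum_c K' l c *: Y c d))); last first.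
  by do 2 apply: eq_bigr => ? _; rewrite contract.
under [RHS]eq_bigr => b _ do under eq_bigr => d _ do rewrite scaler_sumr.
under [RHS]eq_bigr => b _ do rewrite exchange_big.
rewrite [RHS]exchange_big; apply: eq_bigr => l _ /=; rewrite lorentz_mul hX hY.
rewrite exchange_big [X in _ * X]exchange_big /= mulr_suml; apply: eq_bigr => b _ /=.
rewrite mulr_sumr; apply: eq_bigr => d _.
under eq_bigr => a _ do rewrite mulrC -scalerA.
under [X in _ * X]eq_bigr => a _ do rewrite mulrC -scalerA.
by rewrite -!scaler_sumr -scalerAl -scalerAr scalerA.
Qed.

Lemma full_contract X Y : cov1 K X -> cov1 K' Y -> lor (\sum_l X l * Y l) = \sum_l X l * Y l.
Proof.
move=> hX hY; rewrite lor_sum -[RHS]contract; apply: eq_bigr => l _.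
by rewrite lorentz_mul hX hY.
Qed.

Lemma ctrace X : cov3 K K' K2 X -> cov1 K2 (fun i => \sum_l X l l i).
Proof.
move=> hX i; rewrite lor_sum.
transitivity (\sum_c K2 i c *: \sum_l \sum_a \sum_b (K l a * K' l b) *: X a b c).
  under [RHS]eq_bigr => c _ do rewrite scaler_sumr.
  rewrite [RHS]exchange_big; apply: eq_bigr => l _ /=; rewrite hX.
  under [RHS]eq_bigr => c _ do rewrite scaler_sumr.
  rewrite [RHS]exchange_big; apply: eq_bigr => a _ /=.
  under [RHS]eq_bigr => c _ do rewrite scaler_sumr.
  rewrite [RHS]exchange_big; apply: eq_bigr => b _ /=.
  by apply: eq_bigr => c _; rewrite scalerA mulrC.
apply: eq_bigr => c _; congr (_ *: _).
rewrite exchange_big; apply: eq_bigr => a _ /=; rewrite exchange_big /=.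
transitivity (\sum_b (a == b)%:R *: X a b c).
  by apply: eq_bigr => b _; rewrite -KK scaler_suml.
rewrite (bigD1 a) //= eqxx scale1r big1 ?addr0 // => b /negPf.
by rewrite eq_sym => ->; rewrite scale0r.
Qed.

Lemma ctrace0 X : cov2 K K' X -> lor (\sum_l X l l) = \sum_l X l l.
Proof.
move=> hX; rewrite lor_sum.
transitivity (\sum_l \sum_a \sum_b (K l a * K' l b) *: X a b).
  by apply: eq_bigr => l _; rewrite hX.
rewrite exchange_big; apply: eq_bigr => a _ /=; rewrite exchange_big /=.
transitivity (\sum_b (a == b)%:R *: X a b).
  by apply: eq_bigr => b _; rewrite -KK scaler_suml.
rewrite (bigD1 a) //= eqxx scale1r big1 ?addr0 // => b /negPf.
by rewrite eq_sym => ->; rewrite scale0r.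
Qed.
End Tensors.

Lemma cov_pder2 (J : finType) (K : J -> J -> R) X : cov1 K X ->
  cov2 Lo K (fun mu j => 'd_mu (X j)).
Proof.
move=> h mu j; rewrite lor_pder h; apply: eq_bigr => nu _.
by rewrite pder_sum scaler_sumr; apply: eq_bigr => b _; rewrite pder_scale scalerA.
Qed.
Lemma cov_pder3 (J J' : finType) (K : J -> J -> R) (K' : J' -> J' -> R) X : cov2 K K' X ->
  cov3 Lo K K' (fun mu i j => 'd_mu (X i j)).
Proof. by move=> h; apply: cov2_3; apply: cov_pder2; apply/cov2_pair. Qed.

Lemma cov_raise (J : finType) (K : J -> J -> R) X : cov2 Lo K X ->
  cov2 Up K (fun i j => ep i *: X i j).
Proof.
move=> h i j; rewrite lorentz_scale h scaler_sumr; apply: eq_bigr => a _.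
rewrite scaler_sumr; apply: eq_bigr => b _; rewrite !scalerA; congr (_ *: _).
rewrite /Up /Lo -mulrA -[RHS]mulrA [ep a * _]mulrC !mulrA -[RHS]mulrA ep2 mulr1; ring.
Qed.
Lemma cov_lower (J : finType) (K : J -> J -> R) X : cov2 Up K X ->
  cov2 Lo K (fun i j => ep i *: X i j).
Proof.
move=> h i j; rewrite lorentz_scale h scaler_sumr; apply: eq_bigr => a _.
rewrite scaler_sumr; apply: eq_bigr => b _; rewrite !scalerA; congr (_ *: _).
rewrite /Up /Lo !mulrA ep2 mul1r; ring.
Qed.

Lemma cov_h b : cov2 Lo Lo (hf R b).
Proof. by move=> mu nu; rewrite lorentz_var /lorentz_jet iterD0. Qed.
Lemma cov_C b : cov1 Lo (Cf R b).
Proof. by move=> mu; rewrite lorentz_var /lorentz_jet iterD0. Qed.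
Lemma cov_hs b : cov2 Up Up (hsf R b).
Proof.
move=> mu nu; rewrite lorentz_var /lorentz_jet iterD0 /= invLT.
by do 2 apply: eq_bigr => ? _; rewrite !mxE.
Qed.

Lemma cov_xi b : cov1 Up (xi b).
Proof.
rewrite (_ : xi b = fun mu => ep mu *: Cf R b mu); last by apply: funext => mu; rewrite xiE.
by apply/cov2_1; apply: cov_raise; apply/cov2_1/cov_C.
Qed.

Lemma lor_tr b : lor (tr R n b) = tr R n b.
Proof. by rewrite trD; apply: (ctrace0 (X := fun i j => ep i *: hf R b i j) dual_ul); apply: cov_raise; apply: cov_h. Qed.

Lemma cov_eta x : lor x = x -> cov2 Up Up (fun mu nu => eta mu nu *: x).
Proof.
move=> hx i j; rewrite lorentz_scale hx -[in LHS]Up_eta scaler_suml; apply: eq_bigr => a _.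
by rewrite scaler_suml; apply: eq_bigr => b _; rewrite scalerA.
Qed.

Lemma cov_phi b : cov2 Up Up (phi b).
Proof.
have -> : phi b = fun mu nu => 2^-1 *: (eta mu nu *: tr R n b) - ep mu *: (ep nu *: hf R b mu nu).
  by apply: funext => mu; apply: funext => nu; rewrite phiE; lin.
apply: cov2D; first exact/cov2Z/cov_eta/lor_tr.
apply: cov2N; apply: (cov_raise (X := fun mu nu => ep nu *: hf R b mu nu)).
by apply: cov2C; apply: cov_raise; apply: cov2C; apply: cov_h.
Qed.

Lemma cov_Gm b : cov3 Up Lo Lo (Gm b).
Proof.
apply: cov2_3.
have -> : (fun i (p : I * I) => Gm b i p.1 p.2) = fun i p => ep i *: (2^-1 *: (('d_p.1 (hf R b i p.2)
   + 'd_p.2 (hf R b i p.1)) - 'd_i (hf R b p.1 p.2))).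
  by apply: funext => i; apply: funext => p; rewrite GmE; lin.
apply: cov_raise; apply: cov2Z.
have hd : cov3 Lo Lo Lo (fun mu nu rho => 'd_mu (hf R b nu rho)).
  exact/cov_pder3/cov_h.
have perm (X : I -> I -> I -> A) : cov3 Lo Lo Lo X -> cov3 Lo Lo Lo (fun i j l => X j i l).
  move=> h i j l; rewrite h exchange_big; do 2 apply: eq_bigr => ? _.
  by apply: eq_bigr => ? _; congr (_ *: _); ring.
have perm' (X : I -> I -> I -> A) : cov3 Lo Lo Lo X -> cov3 Lo Lo Lo (fun i j l => X i l j).
  move=> h i j l; rewrite h; apply: eq_bigr => ? _; rewrite exchange_big /=.
  by do 2 apply: eq_bigr => ? _; congr (_ *: _); ring.
apply: cov2D; first apply: cov2D.
- exact: (cov3_2 (perm _ hd)).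
- exact: (cov3_2 (perm' _ (perm _ hd))).
- exact/cov2N/(cov3_2 hd).
Qed.

Lemma cov_bb b c : cov2 Lo Lo (bb (Gm b) (Gm c)).
Proof.
have -> : bb (Gm b) (Gm c) = fun mu nu => \sum_al Gm b al mu nu * (\sum_be Gm c be be al)
   - \sum_p Gm b p.1 p.2 mu * Gm c p.2 p.1 nu.
  apply: funext => mu; apply: funext => nu; rewrite -(pair_bigA _ (fun i j => Gm b i j mu * Gm c j i nu)).
  rewrite -sumrN -big_split; apply: eq_bigr => al _ /=.
  by rewrite mulr_sumr -sumrN -big_split.
have ht : cov1 Lo (fun al => \sum_be Gm c be be al) by apply: (ctrace dual_ul); apply: cov_Gm.
apply: cov2D.
  apply/cov2_pair/(cov2_1 _ _).2.
  apply: (cdot (X := fun i (p : I * I) => Gm b i p.1 p.2) dual_ul); last exact/cov2_1.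
  exact/cov3_2/cov_Gm.
apply: cov2N; apply: (cdot (X := fun (p : I * I) i => Gm b p.1 p.2 i)
  (Y := fun (p : I * I) i => Gm c p.2 p.1 i) (dual_kron dual_ul dual_lu)).
  exact/cov3_2'/cov_Gm.
apply: (cov3_2' (X := fun i j l => Gm c j i l)) => i j l.
rewrite cov_Gm exchange_big; do 3 apply: eq_bigr => ? _; congr (_ *: _); ring.
Qed.

Lemma lor_contract2 (X Y : I -> I -> A) : cov2 Up Up X -> cov2 Lo Lo Y ->
  lor (\sum_mu \sum_nu X mu nu * Y mu nu) = \sum_mu \sum_nu X mu nu * Y mu nu.
Proof.
move=> hX hY; rewrite pair_bigA; apply: (full_contract (dual_kron dual_ul dual_ul)); exact/cov2_pair.
Qed.

Lemma lor_a0 k a : lor (def_a0 n k a) = def_a0 n k a.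
Proof.
rewrite /def_a0 lorentz_scale; congr (_ *: _).
rewrite lor_sum; apply: eq_bigr => p _; rewrite lor_sum; apply: eq_bigr => q _.
rewrite lor_sum; apply: eq_bigr => r _; rewrite lorentz_scale; congr (_ *: _).
by apply: lor_contract2; [apply: cov_phi | apply: cov_bb].
Qed.

Lemma cov_lieU b c : cov2 Up Up (lieU (xi b) (phi c)).
Proof.
have -> : lieU (xi b) (phi c) = fun mu nu => (\sum_rho xi b rho * 'd_rho (phi c mu nu))
   + (\sum_rho 'd_rho (xi b rho)) * phi c mu nu - \sum_rho 'd_rho (xi b mu) * phi c rho nu
   - \sum_rho 'd_rho (xi b nu) * phi c rho mu.
  apply: funext => mu; apply: funext => nu; rewrite mulr_suml -!sumrN -!big_split.
  by apply: eq_bigr => rho _ /=; rewrite (phiC _ c mu rho).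
have hxi := cov_pder2 (cov_xi b).
have h3 : cov2 Up Up (fun mu nu => \sum_rho 'd_rho (xi b mu) * phi c rho nu).
  exact: (cdot (X := fun r m => 'd_r (xi b m)) dual_lu hxi (cov_phi c)).
apply: cov2D; last exact/cov2N/(cov2C h3).
apply: cov2D; last exact/cov2N.
apply: cov2D; last first.
  by apply: cov2_inv; [apply: (ctrace0 dual_lu hxi) | apply: cov_phi].
apply/cov2_pair/(cov2_1' _ _).2.
apply: (cdot (X := fun i _ => xi b i) (Y := fun i (p : I * I) => 'd_i (phi c p.1 p.2)) dual_ul).
  exact/cov2_1/cov_xi.
by apply: (cov3_2 (X := fun i m r => 'd_i (phi c m r))); apply/cov_pder3/cov_phi.
Qed.

Lemma cov_Tlow a i : cov2 Lo Lo (@Tlow R n N a i).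
Proof.
pose F := @Fup R n N a i.
have hF : cov2 Up Up F.
  by apply: cov2_sum => b; apply: cov2_sum => c; apply/cov2Z/cov_lieU.
have hT : lor (\sum_rho ep rho *: F rho rho) = \sum_rho ep rho *: F rho rho.
  by apply: (ctrace0 (X := fun i j => ep i *: F i j) dual_lu); apply: cov_lower.
have -> : @Tlow R n N a i = fun mu nu => ep mu *: (ep nu *:
   ((n%:R - 2)^-1 *: (eta mu nu *: \sum_rho ep rho *: F rho rho) - F mu nu)).
  by apply: funext => mu; apply: funext => nu; rewrite scalerA.
apply: (cov_lower (X := fun mu nu => ep nu *: _)); apply: cov2C; apply: cov_lower; apply: cov2C.
by apply: cov2D; [apply/cov2Z/cov_eta | apply: cov2N].
Qed.

Lemma lor_a1 a : lor (@def_a1 R n N a) = def_a1 n a.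
Proof.
rewrite /def_a1 lorentz_add lorentz_scale; congr (_ + _ *: _).
  rewrite lor_sum; apply: eq_bigr => i _.
  by apply: lor_contract2; [apply: cov_hs | apply: cov_Tlow].
rewrite lor_sum; apply: eq_bigr => i _; rewrite lor_sum; apply: eq_bigr => b _.
rewrite lor_sum; apply: eq_bigr => c _.
rewrite [X in lor X](_ : _ = a i b c *: \sum_be DH R i be * \sum_al xi b al * hf R c al be); last first.
  rewrite exchange_big scaler_sumr; apply: eq_bigr => be _ /=.
  by rewrite mulr_sumr scaler_sumr; apply: eq_bigr => al _; rewrite mulrA.
rewrite [RHS](_ : _ = a i b c *: \sum_be DH R i be * \sum_al xi b al * hf R c al be); last first.
  rewrite exchange_big scaler_sumr; apply: eq_bigr => be _ /=.
  by rewrite mulr_sumr scaler_sumr; apply: eq_bigr => al _; rewrite mulrA.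
rewrite lorentz_scale; congr (_ *: _).
apply: (full_contract dual_ul).
  by apply: (ctrace (X := fun m r j => 'd_m (hsf R i r j)) dual_lu); apply/cov_pder3/cov_hs.
apply/(cov2_1' _ _).2.
by apply: (cdot (X := fun i _ => xi b i) dual_ul); [exact/cov2_1/cov_xi | exact: cov_h].
Qed.

End LorentzCovariance.

(** * Gradings *)

Section Gradings.
Variables (R : realType) (n N : nat).
Local Notation A := (locfun R n N).
Local Notation "'d_ mu" := (@pder R n N mu) (at level 8, mu at level 2, format "''d_' mu").

Lemma spanned_ind (P : pred (seq (jet n N))) (Q : A -> Prop) :
  Q 0 -> (forall x y, Q x -> Q y -> Q (x + y)) ->
  (forall c w, P w -> Q (c *: \prod_(v <- w) var v)) ->
  forall x, spanned_by P x -> Q x.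
Proof.
move=> Q0 QD QM x [s [hs ->]]; elim: s hs => [_|[c w] s IH /= /andP[Pw Ps]].
  by rewrite big_nil.
by rewrite big_cons; apply: QD; [apply: QM | apply: IH].
Qed.

(** The three gradings are imposed on the same monomials, so that one product rule and one
    derivative rule serve all of them. *)
Definition graded (m : nat) (g : int) (d : nat) : A -> Prop := spanned_by (fun w =>
  [&& (\sum_(v <- w) antifield v)%N == m, \sum_(v <- w) ghost v == g
    & (\sum_(v <- w) nderiv v <= d)%N]).

Lemma graded0 m g d : graded m g d 0.
Proof. by exists [::]; rewrite big_nil. Qed.
Lemma gradedD m g d x y : graded m g d x -> graded m g d y -> graded m g d (x + y).
Proof.
move=> [s [hs ->]] [t [ht ->]]; exists (s ++ t); rewrite all_cat hs ht.
by rewrite big_cat.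
Qed.
Lemma gradedZ m g d c x : graded m g d x -> graded m g d (c *: x).
Proof.
move=> [s [hs ->]]; exists [seq (c * t.1, t.2) | t <- s]; split; first by rewrite all_map.
by rewrite big_map scaler_sumr; apply: eq_bigr => t _; rewrite scalerA.
Qed.
Lemma gradedN m g d x : graded m g d x -> graded m g d (- x).
Proof. by rewrite -scaleN1r; apply: gradedZ. Qed.
Lemma graded_sum m g d (J : Type) (s : seq J) (F : J -> A) :
  (forall i, graded m g d (F i)) -> graded m g d (\sum_(i <- s) F i).
Proof. by move=> h; apply: big_ind => //; [apply: graded0 | apply: gradedD]. Qed.
Lemma graded_monom m g d w :
  [&& (\sum_(v <- w) antifield v)%N == m, \sum_(v <- w) ghost v == g
    & (\sum_(v <- w) nderiv v <= d)%N] -> graded m g d (\prod_(v <- w) var v).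
Proof. by move=> h; exists [:: (1, w)]; rewrite /= h big_seq1 scale1r. Qed.

Lemma gradedM m g d m' g' d' x y : graded m g d x -> graded m' g' d' y ->
  graded (m + m') (g + g') (d + d') (x * y).
Proof.
move=> hx hy; move: x hx; apply: spanned_ind => [|x x' hx hx'|c w /and3P[/eqP h1 /eqP h2 h3]].
- by rewrite mul0r; apply: graded0.
- by rewrite mulrDl; apply: gradedD.
move: y hy; apply: spanned_ind => [|y y' hy hy'|c' w' /and3P[/eqP h4 /eqP h5 h6]].
- by rewrite mulr0; apply: graded0.
- by rewrite mulrDr; apply: gradedD.
rewrite -scalerAl -scalerAr; do 2 apply: gradedZ; rewrite -big_cat; apply: graded_monom.
by rewrite !big_cat /= h1 h2 h4 h5 !eqxx leq_add.
Qed.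

Lemma nderiv_incr (v : jet n N) mu : nderiv (v.1, jet_incr mu v.2) = (nderiv v).+1.
Proof.
rewrite /nderiv /=; under eq_bigr => i _ do rewrite ffunE.
rewrite big_split /= -addn1; congr addn.
by rewrite (bigD1 mu) //= eqxx big1 ?addn0 // => i /negPf ->.
Qed.

Lemma graded_pder m g d x mu : graded m g d x -> graded m g d.+1 ('d_mu x).
Proof.
move: x; apply: spanned_ind => [|x y hx hy|c w].
- by rewrite pder0; apply: graded0.
- by rewrite pder_add; apply: gradedD.
rewrite pder_scale => hw; apply: gradedZ; move: hw.
elim: w m g d => [|v w IH] m g d; first by have := @pder_cst R n N mu 1; rewrite !big_nil scale1r => -> _; apply: graded0.
rewrite !big_cons => /and3P[/eqP <- /eqP <- hd].
rewrite pder_mul pder_var; apply: gradedD.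
  rewrite (_ : _ * _ = \prod_(u <- (v.1, jet_incr mu v.2) :: w) var u); last by rewrite big_cons.
  apply: graded_monom.
  by rewrite !big_cons /= nderiv_incr !eqxx addSn ltnS.
rewrite (_ : d.+1 = nderiv v + (d - nderiv v).+1)%N; last first.
  by rewrite addnS subnKC // (leq_trans _ hd) // leq_addr.
apply: gradedM.
  rewrite (_ : var v = \prod_(u <- [:: v]) var u); last by rewrite big_seq1.
  by apply: graded_monom; rewrite !big_seq1 !eqxx leqnn.
by apply: IH; rewrite !eqxx /= leq_subRL // (leq_trans _ hd) // leq_addr.
Qed.

Lemma graded_field phi : graded (antifield ((phi, [ffun=> 0%N]) : jet n N))
  (ghost ((phi, [ffun=> 0%N]) : jet n N)) 0 (var (phi, [ffun=> 0%N])).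
Proof.
rewrite (_ : var _ = \prod_(u <- [:: (phi, [ffun=> 0%N]) : jet n N]) var u); last by rewrite big_seq1.
apply: graded_monom; rewrite !big_seq1 !eqxx /= /nderiv big1 // => i _.
by rewrite ffunE.
Qed.

Lemma graded_h b mu nu : graded 0 0 0 (hf R b mu nu).
Proof. exact: (graded_field (Fh b mu nu)). Qed.
Lemma graded_hs b mu nu : graded 1 (- 1) 0 (hsf R b mu nu).
Proof. exact: (graded_field (Fhs b mu nu)). Qed.
Lemma graded_xi b mu : graded 0 1 0 (xi R b mu).
Proof. by rewrite xiE; apply: gradedZ; exact: (graded_field (FC b mu)). Qed.
Lemma graded_phi b mu nu : graded 0 0 0 (phi R b mu nu).
Proof.
apply: gradedD; last exact/gradedN/gradedZ/graded_h.
apply: gradedZ; rewrite trD; apply: graded_sum => r; exact/gradedZ/graded_h.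
Qed.
Lemma graded_Gm b al mu nu : graded 0 0 1 (Gm R b al mu nu).
Proof.
by apply: gradedZ; apply: gradedD; [apply: gradedD|apply: gradedN]; apply/graded_pder/graded_h.
Qed.

Lemma graded_a0 (k : 'M[R]_N) a : graded 0 0 2 (def_a0 n k a).
Proof.
apply: gradedZ; do 3 apply: graded_sum => ?; apply: gradedZ; do 2 apply: graded_sum => ?.
apply: (@gradedM 0 0 0 0 0 2); first exact: graded_phi.
do 2 apply: graded_sum => ?; apply: gradedD; last apply: gradedN.
all: by apply: (@gradedM 0 0 1 0 0 1); apply: graded_Gm.
Qed.

Lemma graded_lieU b c mu nu : graded 0 1 1 (lieU (xi R b) (phi R c) mu nu).
Proof.
have h1 r s x : graded 0 0 0 x -> graded 0 1 1 ('d_r (xi R b s) * x).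
  by move=> hx; apply: (@gradedM 0 1 1 0 0 0) => //; apply/graded_pder/graded_xi.
apply: graded_sum => rho; apply: gradedD; first apply: gradedD; first apply: gradedD.
- by apply: (@gradedM 0 1 0 0 0 1); [apply: graded_xi | apply/graded_pder/graded_phi].
- exact/h1/graded_phi.
- exact/gradedN/h1/graded_phi.
- exact/gradedN/h1/graded_phi.
Qed.

Lemma graded_a1 a : graded 1 0 1 (@def_a1 R n N a).
Proof.
have hF i mu nu : graded 0 1 1 (@Fup R n N a i mu nu).
  by do 2 apply: graded_sum => ?; apply/gradedZ/graded_lieU.
apply: gradedD.
  do 3 apply: graded_sum => ?; apply: (@gradedM 1 (- 1) 0 0 1 1); first exact: graded_hs.
  apply: gradedZ; apply: gradedD; last exact: gradedN.
  by do 2 apply: gradedZ; apply: graded_sum => r; apply: gradedZ.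
apply: gradedZ; do 5 apply: graded_sum => ?; apply: gradedZ.
apply: (@gradedM 1 0 1 0 0 0); last exact: graded_h.
apply: (@gradedM 1 (- 1) 1 0 1 0); last exact: graded_xi.
by apply: graded_sum => ?; apply/graded_pder/graded_hs.
Qed.

Lemma spanned_by_sub (P Q : pred (seq (jet n N))) (x : A) : (forall w, P w -> Q w) ->
  spanned_by P x -> spanned_by Q x.
Proof.
by move=> PQ [s [hs e]]; exists s; split => //; apply: sub_all hs => t; apply: PQ.
Qed.

Lemma graded_antifield m g d x : graded m g d x -> antifield_number m x.
Proof. by apply: spanned_by_sub => w /and3P[]. Qed.
Lemma graded_ghost m g d x : graded m g d x -> ghost_number g x.
Proof. by apply: spanned_by_sub => w /and3P[]. Qed.
Lemma graded_nderiv m g d x : graded m g d x -> at_most_derivatives d x.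
Proof. by apply: spanned_by_sub => w /and3P[]. Qed.

End Gradings.

(** * Evaluation on field configurations *)

Section ConstantTerm.
Variables (R : realType) (n N : nat).
Local Notation A := (locfun R n N).
Local Notation "'d_ mu" := (@pder R n N mu) (at level 8, mu at level 2, format "''d_' mu").

(** Evaluation at the zero configuration. After directional derivatives have been applied, it
    extracts the corresponding Taylor coefficient. *)
Definition cst (x : A) : R := cst_part (repr x).

Lemma cst_pi e : cst (\pi_(locfun R n N)%qT e) = cst_part e.
Proof. exact/cst_part_eqv/repr_eqv. Qed.
Lemma cstD x y : cst (x + y) = cst x + cst y.
Proof. by elim/loc_ind: x => x; elim/loc_ind: y => y; rewrite -piD !cst_pi. Qed.
Lemma cstM x y : cst (x * y) = cst x * cst y.
Proof. by elim/loc_ind: x => x; elim/loc_ind: y => y; rewrite -piM !cst_pi. Qed.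
Lemma cst_cst c : cst c%:A = c.
Proof. by rewrite -[in LHS]piC cst_pi. Qed.
Lemma cst_var v : cst (var v) = 0.
Proof. exact: cst_pi. Qed.
Lemma cstZ c x : cst (c *: x) = c * cst x.
Proof. by rewrite -mulr_algl cstM cst_cst. Qed.
Lemma cst1 : cst 1 = 1.
Proof. by rewrite -[1 in LHS]scale1r cst_cst. Qed.
Lemma cst0 : cst 0 = 0.
Proof. by rewrite -(scale0r (0 : A)) cstZ mul0r. Qed.
Lemma cstN x : cst (- x) = - cst x.
Proof. by rewrite -scaleN1r cstZ mulN1r. Qed.
Lemma cst_sum (J : Type) (s : seq J) (P : pred J) (F : J -> A) :
  cst (\sum_(i <- s | P i) F i) = \sum_(i <- s | P i) cst (F i).
Proof. exact: (big_morph _ cstD cst0). Qed.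

Lemma cst_pder mu x : cst ('d_mu x) = 0.
Proof.
pattern x; move: x; apply: loc_elim => [c|v|x y hx hy|x y hx hy].
- by rewrite pder_cst cst0.
- by rewrite pder_var cst_var.
- by rewrite pder_add cstD hx hy addr0.
- by rewrite pder_mul cstD !cstM hx hy mul0r mulr0 addr0.
Qed.

(** Hence the functionals below see [gamma] and [delta] only through their commutators with
    directional derivatives. *)
Lemma cst_prolong g : (forall phi, has_parity (odd_field phi (+) true) (g phi)) ->
  (forall a mu nu, g (Fh a mu nu) = g (Fh a nu mu) /\ g (Fhs a mu nu) = g (Fhs a nu mu)) ->
  (forall phi, cst (g phi) = 0) -> forall x : A, cst (prolong true g x) = 0.
Proof.
move=> gp gs g0; apply: loc_elim => [c|v|x y hx hy|x y hx hy].
- by rewrite (prolong_cst gp gs) cst0.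
- by rewrite (prolong_var gp gs); apply: (iterD_ind (P := fun y => cst y = 0)) => // mu y _; apply: cst_pder.
- by rewrite (prolong_add gp gs) cstD hx hy addr0.
- by rewrite (prolong_mul gp gs) cstD !cstM hx hy mul0r mulr0 addr0.
Qed.

Lemma cst_gamma x : cst (gamma x) = 0.
Proof.
apply: (cst_prolong (@gamma0_par R n N) (@gamma0_sym R n N)) => phi.
by case: phi => *; rewrite ?cst0 // /gamma0 cstD !cst_pder addr0.
Qed.

Lemma cst_ric b mu nu : cst (ric (Gm R b) mu nu) = 0.
Proof.
rewrite /ric cstD cstN cst_pder cst_sum big1 ?subr0 // => al _; exact: cst_pder.
Qed.
Lemma cst_delta (k : 'M[R]_N) x : k^T = k -> cst (delta k x) = 0.
Proof.
move=> ks; apply: (cst_prolong (@delta0_par R n N k) (@delta0_sym R n N k)) => phi.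
case: phi => *; rewrite ?cst0 // /delta0.
  rewrite euler_lagrangian // cst_sum big1 // => b _.
  rewrite cstZ cstD cstN !cstZ cst_ric cst_sum big1 ?mulr0 ?subr0 ?mulr0 // => mu _.
  by rewrite cstZ cst_ric mulr0.
by rewrite cstZ cst_sum big1 ?mulr0 // => be _; apply: cst_pder.
Qed.
End ConstantTerm.

(* A field configuration assigns to each jet variable its value at the origin,
   and D s f is the derivative in the direction of the configuration f, of
   parity s. *)
Section Configurations.
Variables (R : realType) (n N : nat).
Local Notation A := (locfun R n N).
Local Notation I := 'I_n.
Local Notation jt := (jet n N).
Local Notation "'d_ mu" := (@pder R n N mu) (at level 8, mu at level 2, format "''d_' mu").

Definition conf (s : bool) (f : jt -> R) :=
  (forall v, odd_field v.1 != s -> f v = 0) /\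
  forall a mu nu kap, f (Fh a mu nu, kap) = f (Fh a nu mu, kap) /\
    f (Fhs a mu nu, kap) = f (Fhs a nu mu, kap).

Definition D (s : bool) (f : jt -> R) : A -> A := der s (fun v => (f v)%:A).
Definition shift (mu : I) (f : jt -> R) : jt -> R := fun v => f (v.1, jet_incr mu v.2).

Lemma conf_shift s mu f : conf s f -> conf s (shift mu f).
Proof. by case=> h1 h2; split=> [v hv|a r t kap]; [apply: h1 | apply: h2]. Qed.
Lemma conf_lin s (J : finType) (c : J -> R) f : (forall j, conf s (f j)) ->
  conf s (fun v => \sum_j c j * f j v).
Proof.
move=> h; split=> [v hv|a r t kap].
  by rewrite big1 // => j _; rewrite (h j).1 // mulr0.
by split; apply: eq_bigr => j _; case: ((h j).2 a r t kap) => h1 h2; rewrite ?h1 ?h2.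
Qed.

Section OneConf.
Variables (s : bool) (f : jt -> R).
Hypothesis cf : conf s f.

Lemma D_fpar v : has_parity (odd_field v.1 (+) s) ((f v)%:A : A).
Proof.
rewrite /has_parity parity_cst; have [e|ne] := eqVneq (odd_field v.1) s.
  by rewrite e addbb /sgn expr0 scale1r.
by rewrite cf.1 // scale0r scaler0.
Qed.
Lemma D_fsym : symmetric_jets (fun v => (f v)%:A : A).
Proof. by move=> a mu nu kap; case: (cf.2 a mu nu kap) => -> ->. Qed.

Lemma D_var v : D s f (var v) = (f v)%:A.
Proof. exact: (der_var D_fpar D_fsym). Qed.
Lemma D_cst c : D s f c%:A = 0.
Proof. exact: (der_cst D_fpar D_fsym). Qed.
Lemma D_add x y : D s f (x + y) = D s f x + D s f y.
Proof. exact: (der_add D_fpar D_fsym). Qed.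
Lemma D_scale c x : D s f (c *: x) = c *: D s f x.
Proof. exact: (der_scale D_fpar D_fsym). Qed.
Lemma D_mul x y : D s f (x * y) = D s f x * y + iter s (@parity R n N) x * D s f y.
Proof. exact: (der_mul D_fpar D_fsym). Qed.
Lemma D_0 : D s f 0 = 0.
Proof. by have := D_scale 0 (0 : A); rewrite !scale0r. Qed.
Lemma D_N x : D s f (- x) = - D s f x.
Proof. by rewrite -scaleN1r D_scale scaleN1r. Qed.
Lemma D_sum (J : Type) (r : seq J) (P : pred J) (F : J -> A) :
  D s f (\sum_(i <- r | P i) F i) = \sum_(i <- r | P i) D s f (F i).
Proof. exact: (big_morph _ D_add D_0). Qed.
Lemma D_parity x : parity (D s f x) = sgn R s *: D s f (parity x).
Proof. exact: (parity_der D_fpar D_fsym). Qed.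

End OneConf.

(** The jets of f at the origin are constants for the total derivative, although f depends on the
    point. The commutator is therefore the derivative in the direction of the differentiated
    configuration. *)
Lemma D_pder s f mu x : conf s f -> D s f ('d_mu x) = 'd_mu (D s f x) + D s (shift mu f) x.
Proof.
move=> cf; have cs := conf_shift mu cf.
pattern x; move: x; apply: loc_elim => [c|v|x y hx hy|x y hx hy].
- by rewrite pder_cst D_0 // !D_cst // pder0 addr0.
- by rewrite pder_var !D_var // pder_cst add0r.
- by rewrite pder_add !D_add // hx hy pder_add; lin.
- rewrite pder_mul !(D_mul, D_add) // hx hy !pder_add !pder_mul.
  have -> : 'd_mu (iter s (@parity R n N) x) = iter s (@parity R n N) ('d_mu x).
    by case: (s) => //=; rewrite parity_pder.
  by rewrite !(mulrDl, mulrDr); lin.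
Qed.

(** The graded commutator of two derivations is a derivation, hence determined on jet variables.
    [gamma] and [delta] are linear there, so it has scalar values and is again a directional
    derivative, along the image of f. *)
Lemma D_prolong s f (g : field n N -> A) (g' : jt -> R) x :
  (forall phi, has_parity (odd_field phi (+) true) (g phi)) ->
  (forall a mu nu, g (Fh a mu nu) = g (Fh a nu mu) /\ g (Fhs a mu nu) = g (Fhs a nu mu)) ->
  conf s f -> conf (~~ s) g' ->
  (forall v, D s f (prolong true g (var v)) = (g' v)%:A) ->
  D s f (prolong true g x) = sgn R s *: prolong true g (D s f x) + D (~~ s) g' x.
Proof.
move=> gp gs cf cg hv; set G := prolong true g.
have GM := prolong_mul gp gs; have GD := prolong_add gp gs; have GC := prolong_cst gp gs.
pattern x; move: x; apply: loc_elim => [c|v|x y hx hy|x y hx hy].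
- rewrite /G GC D_0 // !D_cst // addr0.
  by have := GC 0; rewrite scale0r => ->; rewrite scaler0.
- by rewrite hv !D_var // /G GC scaler0 add0r.
- by rewrite /G GD !D_add // GD -/G hx hy scalerDr; lin.
- rewrite /G GM !(D_add cf, D_mul cf, D_mul cg, GD, GM) -/G /= hx hy D_parity //.
  have par z : parity (G z) = - G (parity z).
    by rewrite /G (parity_der (prolong_fpar gp) (prolong_fsym gs)) scaleN1r.
  case: (s) => /=; rewrite ?par ?parityK /sgn ?expr1 ?expr0 ?scale1r ?scaleN1r !(mulrDl, mulrDr, mulNr, mulrN); lin.
Qed.

Lemma D_comm s t f g x : conf s f -> conf t g ->
  D s f (D t g x) = sgn R (s && t) *: D t g (D s f x).
Proof.
move=> cf cg; pattern x; move: x; apply: loc_elim => [c|v|x y hx hy|x y hx hy].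
- by rewrite !D_cst // !D_0 // scaler0.
- by rewrite !D_var // !D_cst // scaler0.
- by rewrite !D_add // hx hy scalerDr.
- rewrite !(D_add cf, D_add cg, D_mul cf, D_mul cg) hx hy.
  have pp z : parity (D t g z) = sgn R t *: D t g (parity z) by apply: D_parity.
  have pq z : parity (D s f z) = sgn R s *: D s f (parity z) by apply: D_parity.
  by case: (s) (t) pp pq => [] [] /= pp pq; rewrite ?pp ?pq /sgn ?expr1 ?expr0 ?scale1r ?scaleN1r;
    rewrite -?scalerAl -?scalerAr; lin.
Qed.

Lemma D_lin s (J : finType) (c : J -> R) f x : (forall j, conf s (f j)) ->
  D s (fun v => \sum_j c j * f j v) x = \sum_j c j *: D s (f j) x.
Proof.
move=> cf; have cl := conf_lin c cf.
pattern x; move: x; apply: loc_elim => [d|v|x y hx hy|x y hx hy].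
- by rewrite D_cst // big1 // => j _; rewrite D_cst // scaler0.
- by rewrite D_var // scaler_suml; apply: eq_bigr => j _; rewrite D_var // scalerA.
- by rewrite D_add // hx hy -big_split; apply: eq_bigr => j _ /=; rewrite D_add // scalerDr.
- rewrite D_mul // hx hy mulr_suml mulr_sumr -big_split; apply: eq_bigr => j _ /=.
  by rewrite D_mul // scalerDr -scalerAl -scalerAr.
Qed.

Lemma D_ext s f g : f =1 g -> D s f = D s g.
Proof. by move=> /funext ->. Qed.
Lemma D_zero s f x : f =1 (fun=> 0) -> D s f x = 0.
Proof.
move=> f0; have c0 : conf s f by split=> [v|a r t kap]; rewrite ?f0.
have := @D_lin s void (fun=> 0) (fun=> f) x (fun=> c0).
rewrite big_pred0 => [<-|[]]; congr (D _ _ x); apply: funext => v.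
by rewrite f0 big_pred0 => [|[]].
Qed.

Definition addk (k1 k2 : {ffun I -> nat}) : {ffun I -> nat} := [ffun mu => (k1 mu + k2 mu)%N].

(** Degree at most one in the jets, expressed without monomials. On such functions the first term of
    [D_pder] vanishes, and total derivatives merely shift the configuration. *)
Definition linear_loc (y : A) := forall s f, conf s f -> exists c, D s f y = c%:A.

Lemma linear_loc_var v : linear_loc (var v).
Proof. by move=> s f cf; exists (f v); rewrite D_var. Qed.
Lemma linear_loc_add x y : linear_loc x -> linear_loc y -> linear_loc (x + y).
Proof.
move=> hx hy s f cf; have [c ec] := hx s f cf; have [d ed] := hy s f cf.
by exists (c + d); rewrite D_add // ec ed scalerDl.
Qed.
Lemma linear_loc_scale c x : linear_loc x -> linear_loc (c *: x).
Proof.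
move=> hx s f cf; have [d ed] := hx s f cf.
by exists (c * d); rewrite D_scale // ed scalerA.
Qed.
Lemma linear_loc_opp x : linear_loc x -> linear_loc (- x).
Proof. by rewrite -scaleN1r; apply: linear_loc_scale. Qed.
Lemma linear_loc_0 : linear_loc 0.
Proof. by move=> s f cf; exists 0; rewrite D_0 // scale0r. Qed.
Lemma linear_loc_sum (J : Type) (r : seq J) (F : J -> A) :
  (forall j, linear_loc (F j)) -> linear_loc (\sum_(j <- r) F j).
Proof. by move=> h; apply: big_ind => //; [apply: linear_loc_0 | apply: linear_loc_add]. Qed.
Lemma linear_loc_pder mu x : linear_loc x -> linear_loc ('d_mu x).
Proof.
move=> hx s f cf; have [c ec] := hx s f cf; have [d ed] := hx s _ (conf_shift mu cf).
by exists d; rewrite D_pder // ec ed pder_cst add0r.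
Qed.
Lemma D_pder_lin s f mu x : conf s f -> linear_loc x ->
  D s f ('d_mu x) = D s (shift mu f) x.
Proof. by move=> cf hx; rewrite D_pder //; have [c ->] := hx s f cf; rewrite pder_cst add0r. Qed.

Definition shiftk (kap : {ffun I -> nat}) (f : jt -> R) : jt -> R :=
  fun v => f (v.1, addk v.2 kap).

Lemma D_iterD s f kap x : conf s f -> linear_loc x ->
  D s f (Defs.iterD (@pder R n N) kap x) = D s (shiftk kap f) x.
Proof.
move=> cf hx; rewrite /Defs.iterD.
have lin_iter mu m y : linear_loc y -> linear_loc (iter m 'd_mu y).
  by move=> hy; elim: m => //= m; apply: linear_loc_pder.
have lin_fold l : linear_loc (foldr (fun mu y => iter (kap mu) 'd_mu y) x l).
  by elim: l => //= mu l IH; apply: lin_iter.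
have D_it mu m g y : conf s g -> linear_loc y ->
    D s g (iter m 'd_mu y) = D s (iter m (shift mu) g) y /\ conf s (iter m (shift mu) g).
  move=> cg hy; elim: m g cg => //= m IH g cg; rewrite D_pder_lin //; last exact: lin_iter.
  have [-> h2] := IH _ (conf_shift mu cg); rewrite -iterSr; split => //.
  by rewrite /= in h2 *; rewrite -iterS iterSr.
have D_fold l g : conf s g -> D s g (foldr (fun mu y => iter (kap mu) 'd_mu y) x l)
    = D s (foldl (fun g mu => iter (kap mu) (shift mu) g) g l) x.
  elim: l g => //= mu l IH g cg.
  by have [-> h2] := D_it mu (kap mu) g _ cg (lin_fold l); apply: IH.
rewrite D_fold //; apply: (congr1 (fun g => D s g x)); apply: funext => v.
have it mu m g u : iter m (shift mu) g u = g (u.1, [ffun nu => (u.2 nu + m * (nu == mu))%N]).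
  elim: m u => [|m IH] u /=.
    by case: u => p q; congr (g (_, _)); apply/ffunP => nu; rewrite ffunE mul0n addn0.
  rewrite /shift IH /=; congr (g (_, _)); apply/ffunP => nu; rewrite !ffunE mulSn; lia.
have fl l g u : foldl (fun g mu => iter (kap mu) (shift mu) g) g l u =
    g (u.1, [ffun nu => (u.2 nu + kap nu * count_mem nu l)%N]).
  elim: l g => [|mu l IH] g /=.
    by case: u => p q; congr (g (_, _)); apply/ffunP => nu; rewrite ffunE muln0 addn0.
  rewrite IH it /=; congr (g (_, _)); apply/ffunP => nu; rewrite !ffunE.
  by rewrite eq_sym; case: eqP => [->|_]; lia.
rewrite fl /shiftk /addk; congr (f (_, _)); apply/ffunP => nu; rewrite !ffunE.
by rewrite count_uniq_mem ?enum_uniq // mem_enum muln1.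
Qed.
End Configurations.

(** * Multi-indices of order one and two *)

Section JetIndices.
Variable n : nat.
Local Notation I := 'I_n.
Definition k0 : {ffun I -> nat} := [ffun=> 0%N].
Definition e1 (mu : I) := jet_incr mu k0.
Definition e2 (mu nu : I) := jet_incr mu (e1 nu).

Lemma jet_incrC (mu nu : I) kap : jet_incr mu (jet_incr nu kap) = jet_incr nu (jet_incr mu kap).
Proof. by apply/ffunP => r; rewrite !ffunE addnAC. Qed.
Lemma jet_incr_inj (mu : I) : injective (jet_incr mu).
Proof. by move=> k l /ffunP h; apply/ffunP => r; have := h r; rewrite !ffunE => /addIn. Qed.
Lemma jet_incr_k0 (mu : I) kap : (jet_incr mu kap == k0) = false.
Proof. by apply/eqP => /ffunP/(_ mu); rewrite !ffunE eqxx addn1. Qed.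
Lemma jet_incr_e1 (mu nu : I) kap : (jet_incr mu kap == e1 nu) = (mu == nu) && (kap == k0).
Proof.
have [->|mn] := eqVneq mu nu; first by rewrite (inj_eq (@jet_incr_inj nu)).
apply/eqP => /ffunP/(_ mu); rewrite !ffunE eqxx (negPf mn); lia.
Qed.
Lemma jet_incr_e2 (rho mu nu : I) kap : (jet_incr rho kap == e2 mu nu) =
  ((rho == mu) && (kap == e1 nu)) || ((rho == nu) && (kap == e1 mu)).
Proof.
have [->|rm] := eqVneq rho mu.
  rewrite (inj_eq (@jet_incr_inj mu)) /=; have [->|] := eqVneq mu nu; first by rewrite orbb.
  by rewrite orbF.
have [->|rn] /= := eqVneq rho nu.
  by rewrite /e2 /e1 jet_incrC (inj_eq (@jet_incr_inj nu)).
apply/eqP => /ffunP/(_ rho); rewrite !ffunE eqxx (negPf rm) (negPf rn); lia.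
Qed.
Lemma e1_inj (mu nu : I) : (e1 mu == e1 nu) = (mu == nu).
Proof. by rewrite jet_incr_e1 eqxx andbT. Qed.
Lemma e1_e2 (rho mu nu : I) : (e1 rho == e2 mu nu) = false.
Proof. by rewrite jet_incr_e2 ![k0 == _]eq_sym !jet_incr_k0 !andbF. Qed.
End JetIndices.

Lemma sum_only (R : realType) (J : finType) (j0 : J) (F : J -> R) :
  (forall j, j != j0 -> F j = 0) -> \sum_j F j = F j0.
Proof. by move=> h; rewrite (bigD1 j0) //= big1 ?addr0. Qed.

Lemma sum_dlR (R : realType) (J : finType) (i : J) (F : J -> R) :
  \sum_j (i == j)%:R * F j = F i.
Proof.
rewrite (sum_only (j0 := i)) ?eqxx ?mul1r // => j /negPf.
by rewrite eq_sym => ->; rewrite mul0r.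
Qed.

(** * Polynomial configurations and integration by parts *)

Section PolynomialConfigurations.
Variables (R : realType) (n N : nat).
Local Notation A := (locfun R n N).
Local Notation I := 'I_n.
Local Notation jt := (jet n N).
Local Notation "'d_ mu" := (@pder R n N mu) (at level 8, mu at level 2, format "''d_' mu").
Local Notation k0 := (k0 n).
Local Notation D := (@D R n N).

Definition fconf (s : bool) (g : field n N -> R) :=
  (forall p, odd_field p != s -> g p = 0) /\
  forall a mu nu, g (Fh a mu nu) = g (Fh a nu mu) /\ g (Fhs a mu nu) = g (Fhs a nu mu).

(* The configurations g x^kap / kap!, g, g x^mu and g x^mu x^nu *)
Definition Pk (g : field n N -> R) (kap : {ffun I -> nat}) : jt -> R :=
  fun v => g v.1 * (v.2 == kap)%:R.
Definition K0 g := Pk g k0.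
Definition K1 g mu := Pk g (e1 mu).
Definition K2 g mu nu : jt -> R := fun v => (1 + (mu == nu)%:R) * Pk g (e2 mu nu) v.

Lemma conf_Pk s g kap : fconf s g -> conf s (Pk g kap).
Proof.
case=> h1 h2; split=> [v hv|a r t l]; first by rewrite /Pk h1 ?mul0r.
by rewrite /Pk /=; case: (h2 a r t) => -> ->.
Qed.
Lemma conf_scale s c (f : jt -> R) : conf s f -> conf s (fun v => c * f v).
Proof.
case=> h1 h2; split=> [v hv|a r t l]; first by rewrite h1 ?mulr0.
by case: (h2 a r t l) => -> ->.
Qed.
Lemma conf_add s (f g : jt -> R) : conf s f -> conf s g -> conf s (fun v => f v + g v).
Proof.
case=> h1 h2 [h3 h4]; split=> [v hv|a r t l]; first by rewrite h1 // h3 // addr0.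
by case: (h2 a r t l) => -> ->; case: (h4 a r t l) => -> ->.
Qed.
Lemma conf_zero s : conf s (fun _ : jt => 0 : R).
Proof. by split. Qed.
Lemma conf_K2 s g mu nu : fconf s g -> conf s (K2 g mu nu).
Proof. by move=> h; apply/conf_scale/conf_Pk. Qed.

Lemma D_scalef s c (f : jt -> R) x : conf s f -> D s (fun v => c * f v) x = c *: D s f x.
Proof.
move=> cf; have := @D_lin R n N s unit (fun=> c) (fun=> f) x (fun=> cf).
rewrite big_const card_unit /= addr0 => <-; apply: (congr1 (fun f => D s f x)).
by apply: funext => v; rewrite big_const card_unit /= addr0.
Qed.
Lemma D_addf s (f g : jt -> R) x : conf s f -> conf s g ->
  D s (fun v => f v + g v) x = D s f x + D s g x.
Proof.
move=> cf cg; have := @D_lin R n N s bool (fun=> 1) (fun b => if b then f else g) x.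
rewrite big_bool /= !scale1r => <-; last by case.
by apply: (congr1 (fun f => D s f x)); apply: funext => v; rewrite big_bool /= !mul1r.
Qed.

Lemma shift_K0 rho g : shift rho (K0 g) =1 fun=> 0.
Proof. by move=> v; rewrite /shift /K0 /Pk jet_incr_k0 mulr0. Qed.
Lemma shift_K1 rho g mu : shift rho (K1 g mu) =1 fun v => (rho == mu)%:R * K0 g v.
Proof.
by move=> v; rewrite /shift /K0 /K1 /Pk jet_incr_e1 -mulnb natrM mulrCA.
Qed.
Lemma shift_K2 rho g mu nu : shift rho (K2 g mu nu) =1
  fun v => (rho == mu)%:R * K1 g nu v + (rho == nu)%:R * K1 g mu v.
Proof.
move=> v; rewrite /shift /K2 /K1 /Pk jet_incr_e2.
have [->|rm] := eqVneq rho mu.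
  by have [<-|mn] := eqVneq mu nu; rewrite /= ?orbb ?orbF; ring.
have [rn|rn] := eqVneq rho nu; last by rewrite /=; ring.
by rewrite -rn [mu == rho]eq_sym (negPf rm) /=; ring.
Qed.

Lemma D_K0_pder s g rho x : fconf s g -> D s (K0 g) ('d_rho x) = 'd_rho (D s (K0 g) x).
Proof.
move=> hg; rewrite D_pder; last exact: conf_Pk.
by rewrite (D_zero s _ (shift_K0 rho g)) addr0.
Qed.
Lemma D_K1_pder s g mu rho x : fconf s g ->
  D s (K1 g mu) ('d_rho x) = 'd_rho (D s (K1 g mu) x) + (rho == mu)%:R *: D s (K0 g) x.
Proof.
move=> hg; rewrite D_pder; last exact: conf_Pk.
by rewrite (D_ext s (shift_K1 rho g mu)) D_scalef //; apply: conf_Pk.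
Qed.
Lemma D_K2_pder s g mu nu rho x : fconf s g ->
  D s (K2 g mu nu) ('d_rho x) = 'd_rho (D s (K2 g mu nu) x)
   + ((rho == mu)%:R *: D s (K1 g nu) x + (rho == nu)%:R *: D s (K1 g mu) x).
Proof.
move=> hg; rewrite D_pder; last exact: conf_K2.
rewrite (D_ext s (shift_K2 rho g mu nu)) D_addf ?D_scalef //;
  by try apply: conf_scale; apply: conf_Pk.
Qed.

Definition Lam s u (B : A -> A) (B1 : I -> A -> A) (B2 : I -> I -> A -> A) (x : A) : R :=
  cst (D s (K0 u) (B x)) - \sum_mu cst (D s (K1 u mu) (B1 mu x))
  + 2^-1 * \sum_mu \sum_nu cst (D s (K2 u mu nu) (B2 mu nu x)).

(* Pairing with a polynomial of degree at most 2 the test distribution u delta(x):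
   integration by parts moves the derivatives of u onto B. *)
Lemma Lam_pder s u B B1 B2 rho x : fconf s u ->
  (forall rho x, B ('d_rho x) = 'd_rho (B x) + B1 rho x) ->
  (forall mu rho x, B1 mu ('d_rho x) = 'd_rho (B1 mu x) + B2 mu rho x) ->
  (forall mu nu rho x, B2 mu nu ('d_rho x) = 'd_rho (B2 mu nu x)) ->
  (forall mu nu x, B2 mu nu x = B2 nu mu x) ->
  Lam s u B B1 B2 ('d_rho x) = 0.
Proof.
move=> hu hB hB1 hB2 hS; have c0 := conf_Pk k0 hu; have c1 mu := conf_Pk (e1 mu) hu.
have c2 mu nu := conf_K2 mu nu hu.
pose S := \sum_mu cst (D s (K1 u mu) (B2 mu rho x)).
rewrite /Lam hB (D_add c0) D_K0_pder // cstD cst_pder add0r.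
have -> : \sum_mu cst (D s (K1 u mu) (B1 mu ('d_rho x))) = cst (D s (K0 u) (B1 rho x)) + S.
  rewrite -(sum_dlR rho (fun mu => cst (D s (K0 u) (B1 mu x)))) -big_split.
  apply: eq_bigr => mu _ /=.
  by rewrite hB1 (D_add (c1 mu)) D_K1_pder // !cstD cst_pder cstZ add0r.
have -> : \sum_mu \sum_nu cst (D s (K2 u mu nu) (B2 mu nu ('d_rho x))) = S + S.
  rewrite -[X in X + _](sum_dlR rho (fun=> S)) -big_split; apply: eq_bigr => mu _ /=.
  rewrite -[X in _ + X](sum_dlR rho (fun nu => cst (D s (K1 u mu) (B2 mu nu x)))).
  rewrite /S mulr_sumr -big_split; apply: eq_bigr => nu _ /=.
  rewrite hB2 D_K2_pder // !cstD cst_pder !cstZ add0r; congr (_ + _).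
  by case: (eqVneq rho mu) => [->|]; rewrite ?mul0r // hS.
by field.
Qed.
End PolynomialConfigurations.

(** * Directional derivatives of gauge variations *)

Section Differentials.
Variables (R : realType) (n N : nat).
Local Notation A := (locfun R n N).
Local Notation I := 'I_n.
Local Notation jt := (jet n N).
Local Notation "'d_ mu" := (@pder R n N mu) (at level 8, mu at level 2, format "''d_' mu").
Local Notation k0 := (k0 n).
Local Notation D := (@D R n N).
Local Notation ep := (ep R).

Lemma conf_shiftk s kap (f : jt -> R) : conf s f -> conf s (shiftk kap f).
Proof. by case=> h1 h2; split=> [v hv|a r t l]; [apply: h1 | apply: h2]. Qed.
Lemma iterD_zero kap : Defs.iterD (@pder R n N) kap 0 = 0.
Proof. by apply: (iterD_ind (P := fun y => y = 0)) => // mu y ->; apply: pder0. Qed.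
Lemma addk_e1 (mu : I) kap : addk (e1 mu) kap = jet_incr mu kap.
Proof. by apply/ffunP => r; rewrite !ffunE add0n addnC. Qed.
Lemma pderE_var mu phi : 'd_mu (var (phi, k0)) = var (phi, e1 mu).
Proof. exact: pder_var. Qed.

(** The metric perturbation generated by the ghost part of f used as gauge parameter; it vanishes
    when that part satisfies the Killing equation. *)
Definition gam (f : jt -> R) : jt -> R := fun v =>
  match v.1 with
  | Fh b mu nu => f (FC b nu, jet_incr mu v.2) + f (FC b mu, jet_incr nu v.2)
  | _ => 0
  end.

Lemma conf_gam s f : conf s f -> conf (~~ s) (gam f).
Proof.
case=> h1 h2; split=> [[[b mu nu|b mu|b mu nu|b mu] kap] //|a r t l]; rewrite /gam /=.
  by case: s h1 => //= h1 _; rewrite !h1 ?addr0.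
by rewrite addrC.
Qed.

Lemma D_gamma s f x : conf s f ->
  D s f (gamma x) = sgn R s *: gamma (D s f x) + D (~~ s) (gam f) x.
Proof.
move=> cf; apply: (D_prolong _ (@gamma0_par R n N) (@gamma0_sym R n N) cf (conf_gam cf)).
move=> [phi kap]; rewrite (prolong_var (@gamma0_par R n N) (@gamma0_sym R n N)) /=.
have cz := conf_shiftk kap cf.
case: phi => [b mu nu|b mu|b mu nu|b mu]; rewrite /gam /= ?iterD_zero ?(D_0 cf) ?scale0r //.
rewrite /gamma0 /Cf !pderE_var D_iterD //; last by apply: linear_loc_add; apply: linear_loc_var.
by rewrite (D_add cz) !(D_var cz) -scalerDl /shiftk /= !addk_e1.
Qed.

Lemma D_gamma0 s f x : conf s f -> gam f =1 (fun=> 0) ->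
  D s f (gamma x) = sgn R s *: gamma (D s f x).
Proof. by move=> cf g0; rewrite D_gamma // (D_zero (~~ s) x g0) addr0. Qed.

Definition onC (f : jt -> R) := forall v, (if v.1 is FC _ _ then false else true) -> f v = 0.
Definition onHs (f : jt -> R) := forall v, (if v.1 is Fhs _ _ _ then false else true) -> f v = 0.
Definition onH (f : jt -> R) := forall v, (if v.1 is Fh _ _ _ then false else true) -> f v = 0.

Lemma gam_onHs f : onHs f -> gam f =1 (fun=> 0).
Proof. by move=> h [[b mu nu|b mu|b mu nu|b mu] kap]; rewrite /gam //= !h // addr0. Qed.
Lemma gam_onH f : onH f -> gam f =1 (fun=> 0).
Proof. by move=> h [[b mu nu|b mu|b mu nu|b mu] kap]; rewrite /gam //= !h // addr0. Qed.
Lemma gam_shift mu f : gam (shift mu f) =1 shift mu (gam f).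
Proof.
by move=> [[b r t|b r|b r t|b r] kap]; rewrite /gam /shift //= !(jet_incrC mu).
Qed.

(** With u on h^* and f, g on ghosts, this is the coefficient of h^* C C. Odd derivations
    anticommute, so it is antisymmetric in f and g. *)
Definition lam u f g (x : A) : R := cst (D true u (D true f (D true g x))).

Lemma lam_gamma0 u f g x : conf true u -> conf true f -> conf true g ->
  gam u =1 (fun=> 0) -> gam f =1 (fun=> 0) -> gam g =1 (fun=> 0) -> lam u f g (gamma x) = 0.
Proof.
move=> cu cf cg u0 f0 g0; rewrite /lam (D_gamma0 x cg g0) D_scale // (D_gamma0 _ cf f0).
rewrite !(D_scale cu) (D_gamma0 _ cu u0) !cstZ cst_gamma; ring.
Qed.

(** Commuting [gamma] outwards replaces one ghost slot at a time by its gauge variation. Only f has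
    one here, so a coefficient of h^* C C in [gamma x] becomes a coefficient of h^* h C in x. *)
Lemma lam_gamma u f g x : conf true u -> conf true f -> conf true g ->
  gam u =1 (fun=> 0) -> gam g =1 (fun=> 0) ->
  lam u f g (gamma x) = - cst (D true u (D false (gam f) (D true g x))).
Proof.
move=> cu cf cg u0 g0; rewrite /lam (D_gamma0 x cg g0) D_scale // (D_gamma _ cf).
rewrite (D_scale cu) (D_add cu) (D_scale cu) (D_gamma0 _ cu u0) !cstZ cstD !cstZ cst_gamma /=.
rewrite /sgn expr1; ring.
Qed.

Lemma lam_triple u f g X Y Z ux fy fz gy gz : conf true u -> conf true f -> conf true g ->
  has_parity true X -> has_parity true Y ->
  D true u X = ux%:A -> D true f X = 0 -> D true g X = 0 ->
  D true f Y = fy%:A -> D true f Z = fz%:A -> D true g Y = gy%:A -> D true g Z = gz%:A ->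
  lam u f g (X * (Y * Z)) = ux * (gy * fz - fy * gz).
Proof.
move=> cu cf cg pX pY uX fX gX fY fZ gY gZ; rewrite /lam.
have -> : D true g (X * (Y * Z)) = (- gy) *: (X * Z) + gz *: (X * Y).
  rewrite !(D_mul cg) gX mul0r add0r gY gZ /= pX pY.
  by rewrite mulr_algl mulr_algr mulrDr -!scalerAl -!scalerAr /sgn expr1; lin.
have fXY W c : D true f W = c%:A -> D true f (X * W) = (- c) *: X.
  move=> fW; rewrite (D_mul cf) fX mul0r add0r fW /= pX mulr_algr /sgn expr1; lin.
rewrite (D_add cf) !(D_scale cf) (fXY _ _ fZ) (fXY _ _ fY) (D_add cu) !(D_scale cu) uX.
by rewrite cstD !cstZ cst1; ring.
Qed.

Lemma D_C f b mu : conf true f -> D true f (Cf R b mu) = (f (FC b mu, k0))%:A.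
Proof. by move=> cf; rewrite /Cf D_var. Qed.

Lemma lam_lin u f g : conf true u -> conf true f -> conf true g ->
  (forall x y, lam u f g (x + y) = lam u f g x + lam u f g y) /\
  (forall c x, lam u f g (c *: x) = c * lam u f g x).
Proof.
move=> cu cf cg; split=> [x y|c x].
  by rewrite /lam (D_add cg) (D_add cf) (D_add cu) cstD.
by rewrite /lam (D_scale cg) (D_scale cf) (D_scale cu) cstZ.
Qed.

Definition dhs (u : jt -> R) i be := \sum_ga u (Fhs i ga be, e1 ga).

Lemma lam_a2 (k : 'M[R]_N) a u f g : conf true u -> conf true f -> conf true g ->
  onHs u -> onC f -> onC g ->
  lam u f g (delta k (a2 n a)) = \sum_i \sum_be \sum_al \sum_b \sum_c
    (- 2 * a i b c) * (dhs u i be * (ep al *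
      (g (FC b al, k0) * f (FC c al, e1 be) - f (FC b al, k0) * g (FC c al, e1 be)))).
Proof.
move=> cu cf cg hu hf hg; have [lD lZ] := lam_lin cu cf cg.
have l0 : lam u f g 0 = 0 by rewrite -(scale0r (0 : A)) lZ mul0r.
have lS (J : finType) (F : J -> A) : lam u f g (\sum_j F j) = \sum_j lam u f g (F j).
  exact: (big_morph _ lD l0).
rewrite delta_a2 lS; apply: eq_bigr => i _; rewrite lS; apply: eq_bigr => be _.
rewrite mulr_sumr scaler_sumr lS; apply: eq_bigr => al _.
rewrite /contr mulr_sumr scaler_sumr lS; apply: eq_bigr => b _.
rewrite mulr_sumr scaler_sumr lS; apply: eq_bigr => c _.
rewrite -scalerAr scalerA lZ; congr (_ * _).
have dH w : conf true w -> D true w (DH R i be) = (dhs w i be)%:A.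
  move=> cw; rewrite (D_sum cw) scaler_suml; apply: eq_bigr => ga _.
  by rewrite /hsf pderE_var D_var.
have dx w : conf true w -> D true w (xi R b al) = (ep al * w (FC b al, k0))%:A.
  by move=> cw; rewrite xiE (D_scale cw) D_C // scalerA.
have dC w : conf true w -> D true w ('d_be (Cf R c al)) = (w (FC c al, e1 be))%:A.
  by move=> cw; rewrite /Cf pderE_var D_var.
have hz w : onC w -> dhs w i be = 0 by move=> hw; apply: big1 => ga _; apply: hw.
rewrite (lam_triple cu cf cg (DH_parity _ _ _) (xi_parity _ _ _) (dH _ cu) _ _
  (dx _ cf) (dC _ cf) (dx _ cg) (dC _ cg)); first by ring.
  by rewrite dH // hz // scale0r.
by rewrite dH // hz // scale0r.
Qed.
End Differentials.

(** * Necessity *)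

Ltac bring := rewrite /= ?mulr0n ?mulr1n; ring.

(** * The first equation: commutativity, and the translation part of a1 *)

Section FirstEquation.
Variables (R : realType) (n N : nat).
Local Notation A := (locfun R n N).
Local Notation I := 'I_n.
Local Notation jt := (jet n N).
Local Notation "'d_ mu" := (@pder R n N mu) (at level 8, mu at level 2, format "''d_' mu").
Local Notation k0 := (k0 n).
Local Notation D := (@D R n N).
Local Notation ep := (ep R).
Variables (k : 'M[R]_N) (a : 'I_N -> 'I_N -> 'I_N -> R) (a1 : A) (b1 : I -> A).
Hypothesis eq1 : delta k (a2 n a) + gamma a1 = \sum_mu 'd_mu (b1 mu).
Variables (i0 i1 i2 : I).
Hypotheses (e01 : (i0 == i1) = false) (e02 : (i0 == i2) = false) (e12 : (i1 == i2) = false).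

Lemma e10 : (i1 == i0) = false. Proof. by rewrite eq_sym. Qed.
Lemma e20 : (i2 == i0) = false. Proof. by rewrite eq_sym. Qed.
Lemma e21 : (i2 == i1) = false. Proof. by rewrite eq_sym. Qed.
Definition eij := (eqxx, e01, e02, e12, e10, e20, e21).

Definition gC b mu (p : field n N) : R :=
  if p is FC b' mu' then (b' == b)%:R * (mu' == mu)%:R else 0.
Definition sym12 (mu nu : I) : R :=
  ((mu == i1) && (nu == i2) || (mu == i2) && (nu == i1))%:R.
Definition gH b (p : field n N) : R :=
  if p is Fh b' mu nu then (b' == b)%:R * sym12 mu nu else 0.
Definition gU b (p : field n N) : R :=
  if p is Fhs b' mu nu then (b' == b)%:R * sym12 mu nu else 0.
Definition gU11 b (p : field n N) : R :=
  if p is Fhs b' mu nu then (b' == b)%:R * ((mu == i1) && (nu == i1))%:R else 0.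

Lemma sym12E mu nu : sym12 mu nu =
  ((mu == i1) && (nu == i2) || (mu == i2) && (nu == i1))%:R.
Proof. by []. Qed.
Lemma gHE b c mu nu : gH b (Fh c mu nu) = (c == b)%:R * sym12 mu nu.
Proof. by []. Qed.
Lemma sym12C mu nu : sym12 mu nu = sym12 nu mu.
Proof. by rewrite /sym12 orbC ![(nu == _) && _]andbC. Qed.
Lemma gC_conf b mu : fconf true (gC b mu).
Proof. by split=> [[]|]. Qed.
Lemma gH_conf b : fconf false (gH b).
Proof. by split=> [[]|c mu nu] //=; rewrite /gH sym12C. Qed.
Lemma gU_conf b : fconf true (gU b).
Proof. by split=> [[]|c mu nu] //=; rewrite /gU sym12C. Qed.
Lemma gU11_conf b : fconf true (gU11 b).
Proof. by split=> [[]|c mu nu] //=; rewrite /gU11 andbC. Qed.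

Lemma dhs_K0 u i be : dhs (K0 u : jt -> R) i be = 0.
Proof. by apply: big1 => ga _; rewrite /K0 /Pk /= jet_incr_k0 mulr0. Qed.
Lemma dhs_K2 u mu nu i be : dhs (K2 u mu nu : jt -> R) i be = 0.
Proof. by apply: big1 => ga _; rewrite /K2 /Pk /= e1_e2 !mulr0. Qed.
Lemma dhs_K1 u mu i be : dhs (K1 u mu : jt -> R) i be = u (Fhs i mu be).
Proof.
rewrite -(sum_dlR mu (fun mu => u (Fhs i mu be))); apply: eq_bigr => ga _.
by rewrite /K1 /Pk /= e1_inj eq_sym mulrC.
Qed.

Lemma onHs_Pk u kap : (forall p, (if p is Fhs _ _ _ then false else true) -> u p = 0) ->
  onHs (Pk u kap : jt -> R).
Proof. by move=> h v hv; rewrite /Pk h ?mul0r. Qed.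
Lemma onHs_K2 u mu nu : (forall p, (if p is Fhs _ _ _ then false else true) -> u p = 0) ->
  onHs (K2 u mu nu : jt -> R).
Proof. by move=> h v hv; rewrite /K2 onHs_Pk ?mulr0. Qed.
Lemma onC_Pk b mu kap : onC (Pk (gC b mu) kap : jt -> R).
Proof. by move=> [[]] *; rewrite /Pk //= mul0r. Qed.

Lemma lam_a2_0 u f g : conf true u -> conf true f -> conf true g -> onHs u -> onC f -> onC g ->
  (forall i be, dhs u i be = 0) -> lam u f g (delta k (a2 n a)) = 0.
Proof.
move=> cu cf cg hu hf hg u0; rewrite lam_a2 // big1 // => i _; rewrite big1 // => be _.
by do 3 (rewrite big1 // => ? _); rewrite u0 mul0r mulr0.
Qed.

Lemma functional_div (L : A -> R) : (forall x y, L (x + y) = L x + L y) ->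
  (forall rho x, L ('d_rho x) = 0) -> L (delta k (a2 n a)) = - L (gamma a1).
Proof.
move=> LD Lp; have L0 : L 0 = 0 by apply: (addrI (L 0)); rewrite -LD !addr0.
by apply/eqP; rewrite -addr_eq0 -LD eq1 (big_morph _ LD L0) big1.
Qed.

(** The covector field x^{i2} e_{i1} - x^{i1} e_{i2}; its gradient is antisymmetric, so it is
    Killing whatever the signature. *)
Definition rot b : jt -> R := fun v => K1 (gC b i1) i2 v + (- 1) * K1 (gC b i2) i1 v.

Lemma conf_rot b : conf true (rot b).
Proof. by apply: conf_add; [|apply: conf_scale]; apply/conf_Pk/gC_conf. Qed.
Lemma onC_rot b : onC (rot b).
Proof. by move=> v hv; rewrite /rot /K1 !onC_Pk // mulr0 addr0. Qed.
Lemma onC_shift mu f : onC f -> onC (shift mu f : jt -> R).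
Proof. by move=> h v hv; apply: h. Qed.
Lemma shift2_rot rho mu b : shift rho (shift mu (rot b)) =1 fun=> 0.
Proof.
by move=> v; rewrite /shift /rot /K1 /Pk /= !jet_incr_e1 !jet_incr_k0 !andbF; bring.
Qed.
Lemma gam_rot b : gam (rot b) =1 fun=> 0.
Proof.
move=> [[c mu nu|c mu|c mu nu|c mu] kap] //; rewrite /gam /rot /K1 /Pk /= !jet_incr_e1 -!mulnb !natrM.
bring.
Qed.

(** For the rotation xi, the covector xi^al d_be xi_al is the gradient of half the norm of xi. With
    both ghosts equal to this rotation in the internal directions p and q, antisymmetry of the ghost
    slots leaves the commutator of the algebra times a second derivative of that norm, read off by
    the (i1, i1) component of the test antifield. *)
Lemma algebra_commutative i p q : a i p q = a i q p.
Proof.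
pose u := gU11 i; pose f := rot p; pose g := rot q.
have cu : fconf true u := gU11_conf i.
have cf : conf true f := conf_rot p; have cg : conf true g := conf_rot q.
have s2f r mu : shift r (shift mu f) =1 fun=> 0 := shift2_rot r mu p.
have s2g r mu : shift r (shift mu g) =1 fun=> 0 := shift2_rot r mu q.
have csf mu := conf_shift mu cf; have csg mu := conf_shift mu cg.
have c0 := conf_Pk k0 cu; have c1 mu := conf_Pk (e1 mu) cu; have c2 mu nu := conf_K2 mu nu cu.
have hu : forall p, (if p is Fhs _ _ _ then false else true) -> u p = 0 by case.
(* An instance of [Lam], in which the derivatives of the product of both ghosts are expanded by the
   Leibniz rule; second derivatives of a rotation vanish. *)
pose L x := lam (K0 u) f g x
  - \sum_mu (lam (K1 u mu) (shift mu f) g x + lam (K1 u mu) f (shift mu g) x)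
  + 2^-1 * \sum_mu \sum_nu (lam (K2 u mu nu) (shift mu f) (shift nu g) x
                            + lam (K2 u mu nu) (shift nu f) (shift mu g) x).
have LD x y : L (x + y) = L x + L y.
  rewrite /L (lam_lin c0 cf cg).1.
  have -> : \sum_mu (lam (K1 u mu) (shift mu f) g (x + y) + lam (K1 u mu) f (shift mu g) (x + y)) =
    \sum_mu (lam (K1 u mu) (shift mu f) g x + lam (K1 u mu) f (shift mu g) x) +
    \sum_mu (lam (K1 u mu) (shift mu f) g y + lam (K1 u mu) f (shift mu g) y).
    rewrite -big_split; apply: eq_bigr => mu _ /=.
    by rewrite (lam_lin (c1 mu) (csf mu) cg).1 (lam_lin (c1 mu) cf (csg mu)).1; bring.
  set S := \sum_mu \sum_nu _; rewrite (_ : S =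
    \sum_mu \sum_nu (lam (K2 u mu nu) (shift mu f) (shift nu g) x
                            + lam (K2 u mu nu) (shift nu f) (shift mu g) x) +
    \sum_mu \sum_nu (lam (K2 u mu nu) (shift mu f) (shift nu g) y
                            + lam (K2 u mu nu) (shift nu f) (shift mu g) y)); first by ring.
  rewrite -big_split; apply: eq_bigr => mu _ /=; rewrite -big_split; apply: eq_bigr => nu _ /=.
  by rewrite (lam_lin (c2 mu nu) (csf mu) (csg nu)).1 (lam_lin (c2 mu nu) (csf nu) (csg mu)).1; bring.
have Lp rho x : L ('d_rho x) = 0.
  rewrite -(@Lam_pder R n N true u (fun x => D true f (D true g x))
    (fun mu x => D true (shift mu f) (D true g x) + D true f (D true (shift mu g) x))
    (fun mu nu x => D true (shift mu f) (D true (shift nu g) x)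
                    + D true (shift nu f) (D true (shift mu g) x)) rho x) //.
  - rewrite /L /Lam /lam; congr (_ - _ + _ * _); apply: eq_bigr => mu _.
      by rewrite (D_add (c1 mu)) cstD.
    by apply: eq_bigr => nu _; rewrite (D_add (c2 mu nu)) cstD.
  - by move=> r y /=; rewrite (D_pder _ _ cg) (D_add cf) (D_pder _ _ cf); lin.
  - move=> mu r y /=; rewrite !(D_pder _ _ cg, D_pder _ _ (csg mu)).
    rewrite (D_zero true y (s2g r mu)) addr0.
    rewrite (D_add (csf mu)) !D_pder // (D_zero true (D true g y) (s2f r mu)) addr0.
    rewrite pderD; lin.
  - move=> mu nu r y /=; rewrite !(D_pder _ _ (csg _)).
    rewrite (D_zero true y (s2g r mu)) (D_zero true y (s2g r nu)) !addr0 !D_pder //.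
    by rewrite (D_zero true _ (s2f r mu)) (D_zero true _ (s2f r nu)) !addr0 pderD.
  - by move=> mu nu y; rewrite addrC.
have gs mu b : gam (shift mu (rot b)) =1 fun=> 0.
  by move=> v; rewrite gam_shift /shift gam_rot.
have gu kap : gam (Pk u kap) =1 fun=> 0 by apply/gam_onHs/onHs_Pk.
have gu2 mu nu : gam (K2 u mu nu) =1 fun=> 0 by apply/gam_onHs/onHs_K2.
have Lg : L (gamma a1) = 0.
  rewrite /L [X in _ - X + _]big1; last first.
    move=> mu _; rewrite (lam_gamma0 _ (c1 mu) (csf mu) cg) ?(lam_gamma0 _ (c1 mu) cf (csg mu)) ?addr0 //;
      by [apply: gam_rot | apply: gs | apply: gu].
  rewrite [X in _ + _ * X]big1; last first.
    by move=> mu _; rewrite big1 // => nu _; rewrite !lam_gamma0 ?addr0 //; apply: gs.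
  rewrite (lam_gamma0 _ c0 cf cg) ?mulr0 ?subr0 ?addr0 //; by [apply: gam_rot | apply: gu].
have := functional_div LD Lp; rewrite Lg oppr0 /L.
(* [delta] of a2 contains h^* only through its divergence at the origin, so constant and quadratic
   test functions contribute nothing. *)
rewrite lam_a2_0 //; try exact: onC_rot; try exact: onHs_Pk; try exact: dhs_K0.
rewrite sub0r [X in _ + 2^-1 * X]big1; last first.
  move=> mu _; rewrite big1 // => nu _; rewrite !lam_a2_0 ?addr0 //;
  by [apply/onC_shift/onC_rot | apply: onHs_K2 | apply: dhs_K2].
rewrite mulr0 addr0 => /eqP; rewrite oppr_eq0.
have val f' g' mu : conf true f' -> conf true g' -> onC f' -> onC g' ->
  lam (K1 u mu) f' g' (delta k (a2 n a)) = (mu == i1)%:R * \sum_al \sum_b \sum_c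
     (- 2 * a i b c) * (ep al *
      (g' (FC b al, k0) * f' (FC c al, e1 i1) - f' (FC b al, k0) * g' (FC c al, e1 i1))).
  move=> cf' cg' of' og'; rewrite (lam_a2 k a (c1 mu) cf' cg' (onHs_Pk _ hu) of' og').
  rewrite (sum_only (j0 := i)); last first.
    move=> j /negPf ji; do 4 (rewrite big1 // => ? _).
    by rewrite dhs_K1 /u /gU11 ji mul0r mul0r mulr0.
  rewrite (sum_only (j0 := i1)); last first.
    move=> j /negPf ji; do 3 (rewrite big1 // => ? _).
    by rewrite dhs_K1 /u /gU11 ji andbF mulr0 mul0r mulr0.
  rewrite mulr_sumr; apply: eq_bigr => al _; rewrite mulr_sumr; apply: eq_bigr => b _.
  rewrite mulr_sumr; apply: eq_bigr => c _; rewrite dhs_K1 /u /gU11 !eqxx andbT; bring.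
rewrite (sum_only (j0 := i1)); last first.
  move=> mu /negPf mi; rewrite !val ?mi ?mul0r ?addr0 //; by [apply: onC_rot | apply/onC_shift/onC_rot].
rewrite !val //; try exact: onC_rot; try by apply/onC_shift/onC_rot.
rewrite eqxx !mul1r.
(* Rotations vanish at the origin: the undifferentiated ghost must be the shifted one, and the other
   one supplies its gradient. *)
have rk b c al : rot b (FC c al, k0) = 0.
  by rewrite /rot /K1 /Pk /= ![k0 == _]eq_sym !jet_incr_k0; bring.
have re b c al : rot b (FC c al, e1 i1) = - ((c == b)%:R * (al == i2)%:R).
  by rewrite /rot /K1 /Pk /= !e1_inj !eij; bring.
have sk b c al : shift i1 (rot b) (FC c al, k0) = - ((c == b)%:R * (al == i2)%:R).
  exact: re.
have se b c al : shift i1 (rot b) (FC c al, e1 i1) = 0.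
  by rewrite /shift /rot /K1 /Pk /= !jet_incr_e1 /e1 !jet_incr_k0 !andbF; bring.
rewrite (sum_only (j0 := i2)); last first.
  move=> j /negPf ji; rewrite big1 // => b _; rewrite big1 // => c _.
  by rewrite /f /g !rk !se !sk !re ji; bring.
rewrite (sum_only (j0 := p)); last first.
  move=> j /negPf ji; rewrite big1 // => c _.
  by rewrite /f /g !rk !se !sk !re ji; bring.
rewrite (sum_only (j0 := q)); last first.
  move=> j /negPf ji; by rewrite /f /g !rk !se !sk !re ji; bring.
rewrite (sum_only (j0 := i2)); last first.
  move=> j /negPf ji; rewrite big1 // => b _; rewrite big1 // => c _.
  by rewrite /f /g !rk !se !sk !re ji; bring.
rewrite (sum_only (j0 := q)); last first.
  move=> j /negPf ji; rewrite big1 // => c _.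
  by rewrite /f /g !rk !se !sk !re ji; bring.
rewrite (sum_only (j0 := p)); last first.
  move=> j /negPf ji; by rewrite /f /g !rk !se !sk !re ji; bring.
rewrite /f /g !rk !se !sk !re !eqxx => /eqP h.
have en : ep i2 != 0 by case: (ep_pm R i2) => ->; rewrite ?oppr_eq0 oner_eq0.
have : 2 * ep i2 * (a i p q - a i q p) = 0 by rewrite -[RHS]h; bring.
move/eqP; rewrite !mulf_eq0 (negPf en) pnatr_eq0 /= subr_eq0 => /eqP.
by [].
Qed.
(** A gauge parameter whose variation is the single component h_{12} = 2 x^0 (see [gam_quad]). Its
    last term cancels the components 01 and 02 created by the first two. *)
Definition quad b : jt -> R := fun v => K2 (gC b i2) i0 i1 v + K2 (gC b i1) i0 i2 v
  + (- 1) * K2 (gC b i0) i1 i2 v.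

Lemma conf_quad b : conf true (quad b).
Proof.
by apply: conf_add; [apply: conf_add|apply: conf_scale]; apply/conf_K2/gC_conf.
Qed.
Lemma onC_quad b : onC (quad b).
Proof. by move=> v hv; rewrite /quad /K2 !onC_Pk // !mulr0 !addr0. Qed.

Lemma shift3_quad r s t b : shift r (shift s (shift t (quad b))) =1 fun=> 0.
Proof.
move=> v; rewrite /shift /quad /K2 /Pk /= !jet_incr_e2 !jet_incr_e1 !jet_incr_k0 !andbF /=.
bring.
Qed.

Lemma gam_quad b : gam (quad b) =1 fun v => 2 * K1 (gH b) i0 v.
Proof.
move=> [[c mu nu|c mu|c mu nu|c mu] kap]; rewrite /gam /K1 /Pk /= ?mul0r ?mulr0 //.
rewrite /quad /K2 /Pk /= !jet_incr_e2 /sym12 !eij.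
have [e|_] := eqVneq mu i0; last (have [e|_] := eqVneq mu i1; last (have [e|_] := eqVneq mu i2));
rewrite ?e ?eij /=;
(have [e'|_] := eqVneq nu i0; last (have [e'|_] := eqVneq nu i1; last (have [e'|_] := eqVneq nu i2)));
rewrite ?e' ?eij /=;
(have [e''|_] := eqVneq kap (e1 i0); last (have [e''|_] := eqVneq kap (e1 i1); last (have [e''|_] := eqVneq kap (e1 i2))));
rewrite ?e'' ?e1_inj ?eij /=; bring.
Qed.

Definition Tval i b c (x : A) : R :=
  cst (D true (K0 (gU i)) (D false (K1 (gH b) i0) (D true (K0 (gC c i0)) x)))
  - cst (D true (K1 (gU i) i0) (D false (K0 (gH b)) (D true (K0 (gC c i0)) x))).

(** The first equation is read on a constant ghost in the internal direction c and on [quad b]. The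
    constant ghost is Killing and [gamma] turns the other one into h_{12} = 2 x^0, so a1 enters
    through [Tval]; in [delta] of a2 only the gradient of [quad b] times the constant ghost
    survives. *)
Lemma a1_translation i b c : Tval i b c a1 = - 2 * ep i0 * a i c b.
Proof.
pose u := gU i; pose f := quad b; pose g := K0 (gC c i0) : jt -> R.
have cu : fconf true u := gU_conf i.
have cf : conf true f := conf_quad b; have cg : conf true g := conf_Pk k0 (gC_conf c i0).
have csf mu := conf_shift mu cf; have cssf mu nu := conf_shift nu (csf mu).
have c0 := conf_Pk k0 cu; have c1 mu := conf_Pk (e1 mu) cu; have c2 mu nu := conf_K2 mu nu cu.
have hu : forall p, (if p is Fhs _ _ _ then false else true) -> u p = 0 by case.
pose L x := lam (K0 u) f g x - \sum_mu lam (K1 u mu) (shift mu f) g x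
  + 2^-1 * \sum_mu \sum_nu lam (K2 u mu nu) (shift nu (shift mu f)) g x.
have LD x y : L (x + y) = L x + L y.
  rewrite /L (lam_lin c0 cf cg).1.
  under eq_bigr => mu _ do rewrite (lam_lin (c1 mu) (csf mu) cg).1.
  under [X in _ + _ * X]eq_bigr => mu _ do (under eq_bigr => nu _ do rewrite (lam_lin (c2 mu nu) (cssf mu nu) cg).1).
  under [X in _ + _ * X]eq_bigr => mu _ do rewrite big_split.
  rewrite !big_split /=; ring.
have dg r y : D true g ('d_r y) = 'd_r (D true g y) by apply/D_K0_pder/gC_conf.
have Lp rho x : L ('d_rho x) = 0.
  rewrite -(@Lam_pder R n N true u (fun x => D true f (D true g x))
    (fun mu x => D true (shift mu f) (D true g x))
    (fun mu nu x => D true (shift nu (shift mu f)) (D true g x)) rho x) //.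
  - by move=> r y; rewrite dg (D_pder _ _ cf).
  - by move=> mu r y; rewrite dg (D_pder _ _ (csf mu)).
  - move=> mu nu r y; rewrite dg (D_pder _ _ (cssf mu nu)).
    by rewrite (D_zero true _ (shift3_quad r nu mu b)) addr0.
  - move=> mu nu y; apply: (congr1 (fun f => D true f _)); apply: funext => v.
    by rewrite /shift /= jet_incrC.
have gg : gam g =1 fun=> 0.
  move=> [[d mu nu|d mu|d mu nu|d mu] kap] //.
  by rewrite /gam /g /K0 /Pk /= !jet_incr_k0 !mulr0 addr0.
have gu kap : gam (Pk u kap) =1 fun=> 0 by apply/gam_onHs/onHs_Pk.
have gu2 mu nu : gam (K2 u mu nu) =1 fun=> 0 by apply/gam_onHs/onHs_K2.
have cH kap : conf false (Pk (gH b) kap : jt -> R) := conf_Pk kap (gH_conf b).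
have g1 mu : gam (shift mu f) =1 fun v => 2 * ((mu == i0)%:R * K0 (gH b) v).
  by move=> v; rewrite gam_shift /shift gam_quad -(shift_K1 mu (gH b) i0).
have g2 mu nu : gam (shift nu (shift mu f)) =1 fun=> 0.
  move=> v; rewrite gam_shift /shift g1 -/(shift nu (K0 (gH b)) v) shift_K0 !mulr0 //.
have Lg : L (gamma a1) = - 2 * Tval i b c a1.
  rewrite /L (lam_gamma _ c0 cf cg (gu _) gg).
  rewrite [X in _ + _ * X]big1; last first.
    by move=> mu _; rewrite big1 // => nu _; rewrite (lam_gamma0 _ (c2 mu nu) (cssf mu nu) cg).
  rewrite (sum_only (j0 := i0)); last first.
    move=> mu /negPf mi; rewrite (lam_gamma _ (c1 mu) (csf mu) cg (gu _) gg).
    rewrite (D_zero false _ _) ?(D_0 (c1 mu)) ?cst0 ?oppr0 // => v.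
    by rewrite g1 mi mul0r mulr0.
  rewrite (lam_gamma _ (c1 i0) (csf i0) cg (gu _) gg).
  have -> y : D false (gam f) y = 2 *: D false (K1 (gH b) i0) y.
    by rewrite (D_ext false (gam_quad b)) (D_scalef _ _ (cH _)).
  have -> y : D false (gam (shift i0 f)) y = 2 *: D false (K0 (gH b)) y.
    rewrite (D_ext false (g1 i0)) (D_scalef _ _ (conf_scale _ (cH _))) (D_scalef _ _ (cH _)).
    by rewrite eqxx scale1r.
  rewrite (D_scale c0) (D_scale (c1 i0)) !cstZ /Tval -/u -/g; bring.
have := functional_div LD Lp; rewrite Lg /L.
have hg : onC g by apply: onC_Pk.
rewrite lam_a2_0 //; try exact: onC_quad; try exact: onHs_Pk; try exact: dhs_K0.
rewrite [X in _ + 2^-1 * X]big1; last first.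
  move=> mu _; rewrite big1 // => nu _; rewrite lam_a2_0 //;
  by [apply/onC_shift/onC_shift/onC_quad | apply: onHs_K2 | apply: dhs_K2].
have -> : \sum_mu lam (K1 u mu) (shift mu f) g (delta k (a2 n a)) =
    \sum_mu \sum_be sym12 mu be * (2 * a i c b * ep i0).
  apply: eq_bigr => mu _.
  rewrite (lam_a2 k a (c1 mu) (csf mu) cg (onHs_Pk _ hu) (onC_shift mu (onC_quad b)) hg).
  rewrite (sum_only (j0 := i)); last first.
    move=> j /negPf ji; do 4 (rewrite big1 // => ? _).
    by rewrite dhs_K1 /u /gU ji mul0r mul0r mulr0.
  apply: eq_bigr => be _; rewrite dhs_K1 /u /gU eqxx /=.
  have [hs|] := boolP ((mu == i1) && (be == i2) || (mu == i2) && (be == i1)); last first.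
    move=> /negPf hs; rewrite /sym12 hs mul0r; do 3 (rewrite big1 // => ? _).
    by rewrite mulr0 mul0r mulr0.
  have ge b' al : g (FC b' al, e1 be) = 0.
    by rewrite /g /K0 /Pk /= jet_incr_k0 mulr0.
  rewrite (sum_only (j0 := i0)); last first.
    move=> al /negPf ali; do 2 (rewrite big1 // => ? _).
    by rewrite ge /g /K0 /Pk /= ali; bring.
  rewrite (sum_only (j0 := c)); last first.
    move=> d /negPf dc; rewrite big1 // => ? _.
    by rewrite ge /g /K0 /Pk /= dc; bring.
  have fe d : shift mu f (FC d i0, e1 be) = - (d == b)%:R.
    rewrite /shift /f /quad /K2 /Pk /= !jet_incr_e2 !e1_inj !eij /=.
    by case/orP: hs => /andP[/eqP -> /eqP ->]; rewrite !eij /=; bring.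
  rewrite (sum_only (j0 := b)); last first.
    by move=> d /negPf db; rewrite ge fe db; bring.
  by rewrite ge fe /g /K0 /Pk /= !eqxx /sym12 hs; bring.
have -> X : \sum_mu \sum_be sym12 mu be * X = 2 * X.
  transitivity (\sum_mu ((i1 == mu)%:R * X + (i2 == mu)%:R * X)); last first.
    by rewrite big_split /= !sum_dlR; ring.
  apply: eq_bigr => mu _.
  transitivity (\sum_be ((i2 == be)%:R * ((i1 == mu)%:R * X) + (i1 == be)%:R * ((i2 == mu)%:R * X)));
    last by rewrite big_split /= !sum_dlR.
  apply: eq_bigr => be _; rewrite /sym12 ![_ == i1]eq_sym ![_ == i2]eq_sym.
  have [e|_] := eqVneq i1 mu; have [e'|_] := eqVneq i2 be; rewrite -?e -?e' ?eij /= ?andbF ?orbF -?mulnb ?natrM; bring.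
rewrite mulr0 addr0 sub0r => h; apply: (mulfI (x := 2)); first by rewrite pnatr_eq0.
transitivity (- (-2 * Tval i b c a1)); first by ring.
by rewrite -h; ring.
Qed.
End FirstEquation.

(** * The second equation: translations as symmetries of the free action *)

Section SecondEquation.
Variables (R : realType) (n N : nat).
Local Notation A := (locfun R n N).
Local Notation I := 'I_n.
Local Notation jt := (jet n N).
Local Notation "'d_ mu" := (@pder R n N mu) (at level 8, mu at level 2, format "''d_' mu").
Local Notation k0 := (k0 n).
Local Notation D := (@D R n N).
Local Notation ep := (ep R).
Variables (k : 'M[R]_N) (a1 a0 : A) (b0 : I -> A).
Hypothesis ks : k^T = k.
Hypothesis eq2 : delta k a1 + gamma a0 = \sum_mu 'd_mu (b0 mu).
Variables (i0 i1 i2 : I).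
Hypotheses (e01 : (i0 == i1) = false) (e02 : (i0 == i2) = false) (e12 : (i1 == i2) = false).
Local Notation gH := (@gH R n N i1 i2).
Local Notation gU := (@gU R n N i1 i2).
Local Notation gC := (@gC R n N).
Local Notation sym12 := (@sym12 R n i1 i2).
Local Notation Tval := (@Tval R n N i0 i1 i2).

Definition kp m : {ffun I -> nat} := iter m (jet_incr i0) k0.
(** The transverse traceless wave h_{12} = (x^0)^m / m!. *)
Definition Q b m : jt -> R := Pk (gH b) (kp m).
(** The signs from raising both indices of h_{12} and from the wave operator along x^0. *)
Definition ee := ep i0 * ep i1 * ep i2.

Lemma Q_conf b m : conf false (Q b m).
Proof. exact/conf_Pk/gH_conf. Qed.
Lemma Q_onH b m : onH (Q b m).
Proof. by move=> [[]] *; rewrite /Q /Pk /= ?mul0r. Qed.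

Lemma jet_incr_kp rho m kap : (jet_incr rho kap == kp m.+1) = (rho == i0) && (kap == kp m).
Proof.
have [->|ri] := eqVneq rho i0; first by rewrite (inj_eq (@jet_incr_inj n i0)).
apply/eqP => /ffunP/(_ rho); rewrite /= !ffunE eqxx (negPf ri) addn0.
have -> : kp m rho = 0%N; last by rewrite addn1.
by elim: m => [|m IH]; rewrite /kp /= ffunE //= -/(kp m) IH (negPf ri).
Qed.

Lemma D_Q0_pder b rho x : D false (Q b 0) ('d_rho x) = 'd_rho (D false (Q b 0) x).
Proof. exact/D_K0_pder/gH_conf. Qed.
Lemma D_QS_pder b m rho x : D false (Q b m.+1) ('d_rho x) =
  'd_rho (D false (Q b m.+1) x) + (rho == i0)%:R *: D false (Q b m) x.
Proof.
rewrite D_pder; last exact: Q_conf; rewrite -D_scalef; last exact: Q_conf.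
congr (_ + _); apply: (congr1 (fun f => D false f x)); apply: funext => v.
by rewrite /shift /Q /Pk jet_incr_kp -mulnb natrM mulrCA.
Qed.

Lemma linear_euler i mu nu : linear_loc (euler (lagrangian0 n k) i mu nu : A).
Proof.
have lG b al r s : linear_loc (Gm R b al r s : A).
  apply: linear_loc_scale; apply: linear_loc_add; [apply: linear_loc_add|apply: linear_loc_opp];
  by apply/linear_loc_pder/linear_loc_var.
have lR b r s : linear_loc (ric (Gm R b) r s : A).
  apply: linear_loc_add; [apply: linear_loc_sum => al|apply: linear_loc_opp]; apply: linear_loc_pder => //.
  exact: linear_loc_sum.
rewrite euler_lagrangian //; apply: linear_loc_sum => b; apply: linear_loc_scale.
apply: linear_loc_add; last by apply/linear_loc_opp/linear_loc_scale/lR.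
by apply: linear_loc_scale; apply: linear_loc_sum => r; apply/linear_loc_scale/lR.
Qed.

(** For a transverse traceless h_{12} depending on x^0 alone, divergences and traces vanish and only
    the wave operator survives. The profile w is kept general because [D_iterD] supplies shifted
    configurations. *)
Lemma D_euler f b (w : {ffun I -> nat} -> R) i mu nu : conf false f ->
  (forall c s t kap, f (Fh c s t, kap) = gH b (Fh c s t) * w kap) ->
  (forall r s, s != i0 -> w (e2 r s) = 0) ->
  D false f (euler (lagrangian0 n k) i mu nu) =
  (ee * k i b * sym12 mu nu * w (e2 i0 i0))%:A.
Proof.
move=> cf fw w0.
have dd c r s t u : D false f ('d_r ('d_s (hf R c t u))) = (f (Fh c t u, e2 r s))%:A.
  by rewrite /hf !pder_var D_var.
have s0 t : sym12 i0 t = 0 by rewrite sym12E e01 e02.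
have stt t : sym12 t t = 0.
  rewrite sym12E; have [->|] := eqVneq t i1; last by rewrite andbF.
  by rewrite e12.
have ddv c r t : D false f ('d_r (dv R c t)) = 0.
  rewrite dvD pder_sum (D_sum cf) big1 // => s _.
  rewrite pder_scale (D_scale cf) dd fw gHE.
  have [->|si] := eqVneq s i0; first by rewrite s0 mulr0 mul0r scale0r scaler0.
  by rewrite w0 // mulr0 scale0r scaler0.
have dtr c r s : D false f ('d_r ('d_s (tr R n c))) = 0.
  rewrite trD !pder_sum (D_sum cf) big1 // => t _.
  by rewrite !pder_scale (D_scale cf) dd fw gHE stt mulr0 mul0r scale0r scaler0.
have dbox c t u : D false f (box (hf R c t u)) = (ep i0 * (gH b (Fh c t u) * w (e2 i0 i0)))%:A.
  rewrite /box (D_sum cf) (bigD1 i0) //= big1 ?addr0 => [|s si]; rewrite (D_scale cf) dd fw.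
    by rewrite scalerA.
  by rewrite w0 // mulr0 scale0r scaler0.
have dric c t u : D false f (ric (Gm R c) t u) =
    (- 2^-1 * (ep i0 * (gH b (Fh c t u) * w (e2 i0 i0))))%:A.
  by rewrite ricGm (D_scale cf) !(D_add cf, D_N cf) !ddv dtr dbox; lin.
have dRs c : D false f (Rs R n c) = 0.
  rewrite /Rs (D_sum cf) big1 // => t _.
  by rewrite (D_scale cf) dric gHE stt mulr0 mul0r !mulr0 scale0r scaler0.
rewrite euler_lagrangian // (D_sum cf) (bigD1 b) //= big1 ?addr0 => [|c /negPf cb]; last first.
  rewrite (D_scale cf) (D_add cf) (D_N cf) !(D_scale cf) dRs dric gHE cb.
  by rewrite !mul0r !mulr0 scale0r !scaler0 subr0 scaler0.
rewrite (D_scale cf) (D_add cf) (D_N cf) !(D_scale cf) dRs dric gHE eqxx scaler0 sub0r.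
rewrite scalerN !scalerA -scaleNr; congr (_ *: _).
have [hs|/negPf hs] := boolP ((mu == i1) && (nu == i2) || (mu == i2) && (nu == i1)); last first.
  by rewrite sym12E hs /= ?mulr0n; ring.
by case/orP: hs => /andP[/eqP -> /eqP ->]; rewrite /ee mulr1n; field.
Qed.

Lemma addk_incr (mu : I) kap l : addk (jet_incr mu kap) l = jet_incr mu (addk kap l).
Proof. by apply/ffunP => r; rewrite !ffunE addnAC. Qed.
Lemma addk0 l : addk k0 l = l.
Proof. by apply/ffunP => r; rewrite !ffunE. Qed.

(** The antifield direction into which [delta] converts [Q b m]: the field equation differentiates
    twice, which lowers the degree by two and kills degrees 0 and 1. *)
Definition del b m : jt -> R := fun v =>
  if m is m'.+2 then \sum_i (ee * k i b) * Pk (gU i) (kp m') v else 0.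

Lemma conf_del b m : conf true (del b m).
Proof.
case: m => [|[|m]]; try exact: conf_zero.
by apply: (@conf_lin R n N true _ (fun i => ee * k i b) (fun i => Pk (gU i) (kp m))) => i; apply/conf_Pk/gU_conf.
Qed.

Lemma D_Q_delta b m x : D false (Q b m) (delta k x) =
  delta k (D false (Q b m) x) + D true (del b m) x.
Proof.
rewrite -[delta k (D _ _ _)]scale1r.
apply: (D_prolong x (@delta0_par R n N k) (@delta0_sym R n N k) (Q_conf b m) (conf_del b m)) => -[p kap].
rewrite (prolong_var (@delta0_par R n N k) (@delta0_sym R n N k)) /=.
have cq := conf_shiftk kap (Q_conf b m).
have z q : (if q is Fhs _ _ _ then false else true) -> del b m (q, kap) = 0.
  case: m {cq} => [|[|m]] //= hq; rewrite big1 // => i _.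
  by case: q hq => // *; rewrite /Pk /= mul0r mulr0.
case: p => [c mu nu|c mu|c mu nu|c mu]; rewrite /delta0 ?iterD_zero ?(D_0 (Q_conf b m)).
- by rewrite z // scale0r.
- by rewrite z // scale0r.
- rewrite D_iterD; [|exact: Q_conf|exact: linear_euler].
  rewrite (D_euler (b := b) (w := fun kap' => (addk kap' kap == kp m)%:R)) //.
    congr (_ *: _); rewrite /e2 /e1 !addk_incr addk0.
    case: m {cq z} => [|[|m]]; first by rewrite jet_incr_k0 mulr0.
      by rewrite jet_incr_kp jet_incr_k0 andbF mulr0.
    rewrite !jet_incr_kp !eqxx /= -(sum_dlR c (fun i => ee * k i b * sym12 mu nu * (kap == kp m)%:R)).
    by apply: eq_bigr => i _; rewrite /Pk /=; ring.
  move=> r s si; rewrite /e2 /e1 jet_incrC addk_incr.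
  case: m {cq z} => [|m]; first by rewrite jet_incr_k0.
  by rewrite jet_incr_kp (negPf si).
- have lh (l : 'I_N) be mu' : linear_loc ('d_be (hsf R l be mu') : A) by apply/linear_loc_pder/linear_loc_var.
  rewrite z // scale0r D_iterD; [|exact: Q_conf|by apply/linear_loc_scale/linear_loc_sum].
  rewrite (D_scale cq) (D_sum cq) big1 ?scaler0 // => be _.
  by rewrite /hsf pder_var D_var // /shiftk /Q /Pk /= mul0r scale0r.
Qed.

Lemma D_C_delta c mu x : D true (K0 (gC c mu)) (delta k x) =
  - delta k (D true (K0 (gC c mu)) x).
Proof.
have cc : conf true (K0 (gC c mu)) := conf_Pk k0 (gC_conf R c mu).
rewrite -[RHS]addr0 -(D_zero (f := fun=> 0) false x) // -scaleN1r.
apply: (D_prolong x (@delta0_par R n N k) (@delta0_sym R n N k) cc (conf_zero _ _ _ _)) => -[p kap].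
rewrite (prolong_var (@delta0_par R n N k) (@delta0_sym R n N k)) /=.
have cq := conf_shiftk kap cc.
case: p => [d r s|d r|d r s|d r]; rewrite /delta0 ?iterD_zero ?(D_0 cc) ?scale0r //.
- have dh (l : 'I_N) t u kap' : shiftk kap (K0 (gC c mu) : jt -> R) (Fh l t u, kap') = 0.
    by rewrite /shiftk /K0 /Pk /= mul0r.
  have dd (l : 'I_N) p q t u : D true (shiftk kap (K0 (gC c mu))) ('d_p ('d_q (hf R l t u))) = 0.
    by rewrite /hf !pder_var D_var // dh scale0r.
  rewrite D_iterD //; last exact: linear_euler.
  have dric l t u : D true (shiftk kap (K0 (gC c mu))) (ric (Gm R l) t u) = 0.
    rewrite ricGm (D_scale cq) !(D_add cq, D_N cq) /box !dvD trD !pder_sum !(D_sum cq).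
    rewrite !big1 ?subr0 ?addr0 ?oppr0 ?scaler0 // => q _;
      by rewrite ?pder_scale ?pder_sum ?pder_scale !(D_scale cq) dd scaler0.
  rewrite euler_lagrangian // (D_sum cq) big1 // => l _.
  rewrite (D_scale cq) (D_add cq) (D_N cq) !(D_scale cq) dric (D_sum cq) big1 => [|t _].
    by rewrite !scaler0 subr0 scaler0.
  by rewrite (D_scale cq) dric scaler0.
- have lh (l : 'I_N) be mu' : linear_loc ('d_be (hsf R l be mu') : A) by apply/linear_loc_pder/linear_loc_var.
  rewrite D_iterD //; last by apply/linear_loc_scale/linear_loc_sum.
  rewrite (D_scale cq) (D_sum cq) big1 ?scaler0 // => be _.
  by rewrite /hsf pder_var D_var // /shiftk /K0 /Pk /= mul0r scale0r.
Qed.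

Definition tt3 b b' c m l (x : A) : R :=
  cst (D false (Q b m) (D false (Q b' l) (D true (K0 (gC c i0)) x))).

(** In the second equation [delta] converts either wave into a test antifield for a1, weighted by k.
    With a constant ghost, [gamma a0] drops out, and what remains compares the translation of b'
    paired with b to that of b paired with b'. *)
Lemma translation_invariance b b' c :
  \sum_i k i b * Tval i b' c a1 = \sum_i k i b' * Tval i b c a1.
Proof.
have cc : conf true (K0 (gC c i0)) := conf_Pk k0 (gC_conf R c i0).
have tD m l x y : tt3 b b' c m l (x + y) = tt3 b b' c m l x + tt3 b b' c m l y.
  by rewrite /tt3 (D_add cc) (D_add (Q_conf _ _)) (D_add (Q_conf _ _)) cstD.
(* The total degree is three because the field equation takes two derivatives and the translation
   one. A total derivative along x^0 lowers either degree by one, so the alternating signs make its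
   contributions telescope to zero. *)
pose L x := tt3 b b' c 3 0 x - tt3 b b' c 2 1 x + tt3 b b' c 1 2 x - tt3 b b' c 0 3 x.
have LD x y : L (x + y) = L x + L y by rewrite /L !tD; ring.
have L0 : L 0 = 0 by apply: (addrI (L 0)); rewrite -LD !addr0.
have dc rho x : D true (K0 (gC c i0)) ('d_rho x) = 'd_rho (D true (K0 (gC c i0)) x).
  exact/D_K0_pder/gC_conf.
have Lp rho x : L ('d_rho x) = 0.
  rewrite /L /tt3 !dc !(D_Q0_pder, D_QS_pder, D_add (Q_conf _ _), D_scale (Q_conf _ _)).
  by rewrite !(cstD, cstZ) !cst_pder; ring.
have tg m l x : tt3 b b' c m l (gamma x) = 0.
  rewrite /tt3 (D_gamma0 x cc); last first.
    move=> [[d mu nu|d mu|d mu nu|d mu] kap] //.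
    by rewrite /gam /K0 /Pk /= !jet_incr_k0 !mulr0 addr0.
  rewrite (D_scale (Q_conf _ _)) (D_gamma0 _ (Q_conf _ _)); last exact/gam_onH/Q_onH.
  rewrite !(D_scale (Q_conf _ _)) (D_gamma0 _ (Q_conf _ _)); last exact/gam_onH/Q_onH.
  by rewrite !cstZ cst_gamma !mulr0.
have Lg : L (gamma a0) = 0 by rewrite /L !tg; ring.
have Ld : L (delta k a1) = 0.
  have : L (\sum_mu 'd_mu (b0 mu)) = 0 by rewrite (big_morph _ LD L0) big1.
  by rewrite -eq2 LD Lg addr0.
have td m l x : tt3 b b' c m l (delta k x) =
  - cst (D true (del b m) (D false (Q b' l) (D true (K0 (gC c i0)) x)))
  - cst (D true (del b' l) (D false (Q b m) (D true (K0 (gC c i0)) x))).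
  rewrite /tt3 D_C_delta !(D_N (Q_conf _ _)) D_Q_delta (D_add (Q_conf _ _)) D_Q_delta.
  rewrite cstN !cstD cst_delta // (D_comm _ (Q_conf b m) (conf_del b' l)) andFb /sgn expr0 scale1r; ring.
pose X i j d m := cst (D true (Pk (gU i) (kp j)) (D false (Q d m) (D true (K0 (gC c i0)) a1))).
have dS d m y : D true (del d m.+2) y = \sum_i (ee * k i d) *: D true (Pk (gU i) (kp m)) y.
  by apply: D_lin => i; apply/conf_Pk/gU_conf.
have cdS d m d' j : cst (D true (del d m.+2) (D false (Q d' j) (D true (K0 (gC c i0)) a1))) =
  \sum_i (ee * k i d) * X i m d' j.
  by rewrite dS cst_sum; apply: eq_bigr => i _; rewrite cstZ.
have d0 d y : D true (del d 0) y = 0 by apply: D_zero.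
have ht i d : Tval i d c a1 = X i 0%N d 1%N - X i 1%N d 0%N by [].
have := Ld; rewrite /L !td !(d0 b) !cst0 !cdS => h.
have e0 : ee != 0.
  by rewrite /ee; case: (ep_pm R i0) => ->; case: (ep_pm R i1) => ->; case: (ep_pm R i2) => ->;
    rewrite ?mulr1 ?mulrN1 ?opprK ?oppr_eq0 oner_eq0.
apply: (mulfI e0); rewrite !mulr_sumr.
have -> : \sum_i ee * (k i b * Tval i b' c a1) =
   \sum_i (ee * k i b) * X i 0%N b' 1%N - \sum_i (ee * k i b) * X i 1%N b' 0%N.
  by rewrite -sumrB; apply: eq_bigr => i _; rewrite ht; ring.
have -> : \sum_i ee * (k i b' * Tval i b c a1) =
   \sum_i (ee * k i b') * X i 0%N b 1%N - \sum_i (ee * k i b') * X i 1%N b 0%N.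
  by rewrite -sumrB; apply: eq_bigr => i _; rewrite ht; ring.
by apply/eqP; rewrite -subr_eq0; apply/eqP; rewrite -[RHS]h; ring.
Qed.
End SecondEquation.

(** * Commutativity and total symmetry in components *)

Section InternalTensor.
Variables (R : realType) (N : nat) (k : 'M[R]_N) (a : 'I_N -> 'I_N -> 'I_N -> R).

Lemma alg_mul_commutativeP :
  commutative (alg_mul a) <-> forall i b c, a i b c = a i c b.
Proof.
split=> h => [i b c|x y].
  have := congr1 (fun X : 'rV[R]_N => X 0 i) (h (delta_mx 0 b) (delta_mx 0 c)).
  have e p q : (alg_mul a (delta_mx 0 p) (delta_mx 0 q)) 0 i = a i p q.
    rewrite mxE (sum_only (j0 := p)); last first.
      by move=> j /negPf jp; rewrite big1 // => l _; rewrite !mxE eqxx jp mulr0 mul0r.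
    rewrite (sum_only (j0 := q)); last first.
      by move=> j /negPf jq; rewrite !mxE !eqxx jq mulr0.
    by rewrite !mxE !eqxx !mulr1.
  by rewrite !e.
apply/rowP => i; rewrite !mxE exchange_big; apply: eq_bigr => b _; apply: eq_bigr => c _ /=.
by rewrite h; ring.
Qed.

(** The two adjacent transpositions generate the permutations of three indices. *)
Lemma sym3P (t : 'I_N -> 'I_N -> 'I_N -> R) :
  (forall p q r, t p q r = sym3 t p q r) <->
  (forall p q r, t p q r = t q p r) /\ (forall p q r, t p q r = t p r q).
Proof.
split=> [h|[h1 h2] p q r].
  by split=> p q r; rewrite h [RHS]h /sym3; congr (_ * _); ring.
have e1 : t p r q = t p q r by rewrite h2.
have e2 : t q p r = t p q r by rewrite h1.
have e3 : t q r p = t p q r by rewrite h2 h1.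
have e4 : t r p q = t p q r by rewrite h1 h2.
have e5 : t r q p = t p q r by rewrite h2 h1 h2.
by rewrite /sym3 e1 e2 e3 e4 e5; field.
Qed.
End InternalTensor.

Theorem mainTheorem4 (R : realType) (n N : nat) (hn : (3 <= n)%N)
    (k : 'M[R]_N) (k_sym : k^T = k) (k_pos : positive_definite k)
    (a : 'I_N -> 'I_N -> 'I_N -> R) :
  (exists (a1 a0 : locfun R n N) (b1 b0 : 'I_n -> locfun R n N),
    [/\ [/\ lorentz_invariant a1, antifield_number 1 a1 & ghost_number 0 a1],
        [/\ lorentz_invariant a0, antifield_number 0 a0, ghost_number 0 a0
          & at_most_derivatives 2 a0],
        delta k (a2 n a) + gamma a1 = \sum_mu pder mu (b1 mu)
      & delta k a1 + gamma a0 = \sum_mu pder mu (b0 mu)])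
  <->
  (commutative (alg_mul a) /\
   forall i b c : 'I_N, lower k a i b c = sym3 (lower k a) i b c).
Proof.
have kC i j : k i j = k j i by rewrite -{1}k_sym mxE.
rewrite alg_mul_commutativeP sym3P; split=> [[a1 [a0 [b1 [b0 [_ _ eq1 eq2]]]]]|[asym [la12 la23]]].
  pose i0 : 'I_n := Ordinal (leq_trans (isT : (0 < 3)%N) hn).
  pose i1 : 'I_n := Ordinal (leq_trans (isT : (1 < 3)%N) hn).
  pose i2 : 'I_n := Ordinal (leq_trans (isT : (2 < 3)%N) hn).
  have e01 : (i0 == i1) = false by [].
  have e02 : (i0 == i2) = false by [].
  have e12 : (i1 == i2) = false by [].
  have asym i b c : a i b c = a i c b := algebra_commutative eq1 e12 i b c.
  have la23 p q r : lower k a p q r = lower k a p r q.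
    by apply: eq_bigr => d _; rewrite asym.
  have la13 p q r : lower k a p q r = lower k a r q p.
    have := translation_invariance k_sym eq2 e01 e02 e12 p r q.
    under eq_bigr => i _ do rewrite (a1_translation eq1 e01 e02 e12).
    under [in RHS]eq_bigr => i _ do rewrite (a1_translation eq1 e01 e02 e12).
    have sE x y : \sum_i k i x * (- 2 * ep R i0 * a i q y) = - 2 * ep R i0 * lower k a x q y.
      by rewrite /lower mulr_sumr; apply: eq_bigr => i _; rewrite (kC i x); ring.
    rewrite !sE; apply: mulfI; rewrite mulf_neq0 ?oppr_eq0 ?pnatr_eq0 //.
    by case: (ep_pm R i0) => ->; rewrite ?oppr_eq0 oner_eq0.
  (* The transposition of the first two indices is the conjugate of (13) by (23). *)
  by split=> //; split=> // p q r; rewrite la23 la13 la23.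
have n2 : n%:R - 2 != 0 :> R by rewrite subr_eq0 eqr_nat; case: n hn => [|[|[|]]].
have [b1 e1] := first_descent k asym n2; have [b0 e0] := second_descent k_sym n2 la12 la23.
have g1 := graded_a1 n a; have g0 := graded_a0 n k a.
exists (def_a1 n a), (def_a0 n k a), b1, b0; split=> //.
  split; [by move=> L hL; apply: lor_a1 | exact: graded_antifield g1 | exact: graded_ghost g1].
split; [by move=> L hL; apply: lor_a0 | exact: graded_antifield g0 | exact: graded_ghost g0 |].
exact: graded_nderiv g0.
Qed.
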